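(* Let $\mathcal{F}$ be the rank 3 hyperbolic Kac-Moody algebra with simple roots $\alpha_{-1},\alpha_0,\alpha_1$ and Cartan matrix $$\begin{bmatrix} 2&-1&0\\-1&2&-2\\0&-2&2\end{bmatrix}.$$ Fix any integer $m\ge 1$ and a choice of sign $\pm$. In the root system $\Phi$ of $\mathcal{F}$, identified with a set of $2\times 2$ symmetric integral matrices, there are the positive roots $$\beta_0=\alpha_{-1}=\begin{pmatrix}1&0\\0&-1\end{pmatrix},\qquad \beta_1=\beta_1^{(m)}=m(\alpha_0+\alpha_1)\pm\alpha_1=\begin{pmatrix}-m&\pm1\\ \pm1&0\end{pmatrix}.$$ The Lie subalgebra $\mathfrak{g}(\beta_0,\beta_1)$ of $\mathcal{F}$ generated by nonzero root vectors $E_i\in\mathcal{F}_{\beta_i}$, $F_i\in\mathcal{F}_{-\beta_i}$ and $H_i=[E_i,F_i]$, $i=0,1$, is a Kac-Moody Lie algebra with Cartan matrix $$\begin{bmatrix}2&-m\\-m&2\end{bmatrix},$$ which is rank 2 hyperbolic for $m\ge 3$.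
   Context: Identification of the root lattice of $\mathcal{F}$: on real symmetric $2\times2$ matrices use the bilinear form $$\begin{pmatrix}a&b\\ b&c\end{pmatrix}\cdot\begin{pmatrix}a'&b'\\ b'&c'\end{pmatrix}=2bb'-ac'-a'c,$$ with quadratic form $-2\det$. The root lattice of $\mathcal{F}$, with its form given by the Cartan matrix, is isometric to the integral symmetric $2\times 2$ matrices $S_2(\mathbb{Z})$ via $$\alpha_{-1}=\begin{pmatrix}1&0\\0&-1\end{pmatrix},\quad \alpha_0=\begin{pmatrix}-1&-1\\-1&0\end{pmatrix},\quad \alpha_1=\begin{pmatrix}0&1\\1&0\end{pmatrix}.$$ The roots are the nonzero $N\in S_2(\mathbb{Z})$ with $\det N\ge -1$; the real roots are those with $\det N=-1$, and they have one-dimensional root spaces $\mathcal{F}_\beta$. That the subalgebra generated by $E_i,F_i,H_i$ is a Kac-Moody algebra with Cartan matrix $C$ means that, after rescaling the $F_i$ so that $\beta_i(H_i)=2$, it is the Lie algebra defined by these generators and the Serre relations determined by $C$: $[H_i,H_j]=0$, $[H_i,E_j]=C_{ji}E_j$, $[H_i,F_j]=-C_{ji}F_j$, $[E_i,F_j]=\delta_{ij}H_i$, and $(\mathrm{ad}\,E_i)^{1-C_{ji}}E_j=0=(\mathrm{ad}\,F_i)^{1-C_{ji}}F_j$ for $i\neq j$ (no derivations are adjoined). *)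

(* Defs.v *)
From HB Require Import structures.
From mathcomp Require Import all_boot all_order all_algebra generic_quotient.
From mathcomp Require Import boolp classical_sets reals.
From mathcomp Require Import ring.

Set Implicit Arguments.
Unset Strict Implicit.
Unset Printing Implicit Defensive.

Import Order.TTheory GRing.Theory Num.Theory.
Local Open Scope ring_scope.

HB.mixin Record Lmodule_isLieAlgebra (K : fieldType) L of GRing.Lmodule K L := {
  lie : L -> L -> L;
  lieDl : forall x y z, lie (x + y) z = lie x z + lie y z;
  lieDr : forall x y z, lie x (y + z) = lie x y + lie x z;
  lieZl : forall a x y, lie (a *: x) y = a *: lie x y;
  lieZr : forall a x y, lie x (a *: y) = a *: lie x y;
  liexx : forall x, lie x x = 0;
  lie_jacobi : forall x y z,
    lie x (lie y z) + lie y (lie z x) + lie z (lie x y) = 0 }.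

#[short(type="lieAlgType")]
HB.structure Definition LieAlgebra (K : fieldType) :=
  {L of GRing.Lmodule K L & Lmodule_isLieAlgebra K L}.

Arguments lie {K L} : rename.

Definition lie_morphism (K : fieldType) (L L' : lieAlgType K) (f : L -> L') :=
  linear f /\ {morph f : x y / lie x y}.

Definition lie_subalgebra (K : fieldType) (L : lieAlgType K) (A : set L) :=
  [/\ A 0, forall a x y, A x -> A y -> A (a *: x + y)
    & forall x y, A x -> A y -> A (lie x y)].

Definition lie_generated (K : fieldType) (L : lieAlgType K) (G : set L) : set L :=
  smallest (@lie_subalgebra K L) G.

(** The Lie algebra over [K] presented by generators [X] and a set [R] of
    equations between Lie polynomials: formal terms modulo the least congruence
    that contains [R] and the Lie algebra axioms. [pres_lift_exists] and
    [pres_lift_unique] give its universal property. *)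

Inductive lie_term (K X : Type) : Type :=
| TGen (x : X)
| TZero
| TAdd (s t : lie_term K X)
| TScale (a : K) (t : lie_term K X)
| TLie (s t : lie_term K X).

Arguments TGen {K X}.
Arguments TZero {K X}.

HB.instance Definition _ (K X : Type) := gen_eqMixin (lie_term K X).
HB.instance Definition _ (K X : Type) := gen_choiceMixin (lie_term K X).

Section Presentation.
Variables (K : fieldType) (X : Type).
Local Notation term := (lie_term K X).
Variable R : term -> term -> Prop.

Inductive lie_cong : term -> term -> Prop :=
| cong_rel s t : R s t -> lie_cong s t
| cong_refl s : lie_cong s s
| cong_sym s t : lie_cong s t -> lie_cong t s
| cong_trans s t u : lie_cong s t -> lie_cong t u -> lie_cong s u
| cong_add s s' t t' :
    lie_cong s s' -> lie_cong t t' -> lie_cong (TAdd s t) (TAdd s' t')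
| cong_scale a t t' : lie_cong t t' -> lie_cong (TScale a t) (TScale a t')
| cong_lie s s' t t' :
    lie_cong s s' -> lie_cong t t' -> lie_cong (TLie s t) (TLie s' t')
| cong_addA s t u : lie_cong (TAdd s (TAdd t u)) (TAdd (TAdd s t) u)
| cong_addC s t : lie_cong (TAdd s t) (TAdd t s)
| cong_add0 t : lie_cong (TAdd TZero t) t
| cong_scale0 t : lie_cong (TScale 0 t) TZero
| cong_scale1 t : lie_cong (TScale 1 t) t
| cong_scaleA a b t : lie_cong (TScale a (TScale b t)) (TScale (a * b) t)
| cong_scaleDr a s t :
    lie_cong (TScale a (TAdd s t)) (TAdd (TScale a s) (TScale a t))
| cong_scaleDl a b t :
    lie_cong (TScale (a + b) t) (TAdd (TScale a t) (TScale b t))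
| cong_lieDl s t u :
    lie_cong (TLie (TAdd s t) u) (TAdd (TLie s u) (TLie t u))
| cong_lieDr s t u :
    lie_cong (TLie s (TAdd t u)) (TAdd (TLie s t) (TLie s u))
| cong_lieZl a s t : lie_cong (TLie (TScale a s) t) (TScale a (TLie s t))
| cong_lieZr a s t : lie_cong (TLie s (TScale a t)) (TScale a (TLie s t))
| cong_liexx t : lie_cong (TLie t t) TZero
| cong_jacobi s t u :
    lie_cong
      (TAdd (TAdd (TLie s (TLie t u)) (TLie t (TLie u s))) (TLie u (TLie s t)))
      TZero.

Definition lie_congb : rel term := fun s t => `[< lie_cong s t >].

Lemma lie_congb_refl : reflexive lie_congb.
Proof. by move=> s; apply/asboolP/cong_refl. Qed.

Lemma lie_congb_sym : symmetric lie_congb.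
Proof. by move=> s t; apply/asboolP/asboolP => /cong_sym. Qed.

Lemma lie_congb_trans : transitive lie_congb.
Proof.
by move=> t s u /asboolP st /asboolP tu; apply/asboolP/(cong_trans st tu).
Qed.

Canonical lie_congb_equiv :=
  EquivRel lie_congb lie_congb_refl lie_congb_sym lie_congb_trans.

Definition presented_lie := {eq_quot lie_congb}%qT.

HB.instance Definition _ := Choice.on presented_lie.
HB.instance Definition _ := Quotient.on presented_lie.

Definition pres_pi (t : term) : presented_lie := \pi_presented_lie%qT t.

Lemma pres_piP s t : pres_pi s = pres_pi t <-> lie_cong s t.
Proof.
split=> [/eqP|st]; first by rewrite eqmodE => /asboolP.
by apply/eqP; rewrite eqmodE; apply/asboolP.
Qed.

Lemma pres_piK (x : presented_lie) : pres_pi (repr x) = x.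
Proof. exact: reprK. Qed.

Lemma cong_repr t : lie_cong (repr (pres_pi t)) t.
Proof. by apply/pres_piP; rewrite pres_piK. Qed.

Definition pres_add (x y : presented_lie) := pres_pi (TAdd (repr x) (repr y)).
Definition pres_scale (a : K) (x : presented_lie) :=
  pres_pi (TScale a (repr x)).
Definition pres_bracket (x y : presented_lie) :=
  pres_pi (TLie (repr x) (repr y)).

Lemma pres_piD s t : pres_pi (TAdd s t) = pres_add (pres_pi s) (pres_pi t).
Proof. by apply/pres_piP/cong_add; apply/cong_sym/cong_repr. Qed.

Lemma pres_piZ a t : pres_pi (TScale a t) = pres_scale a (pres_pi t).
Proof. by apply/pres_piP/cong_scale; apply/cong_sym/cong_repr. Qed.

Lemma pres_piL s t : pres_pi (TLie s t) = pres_bracket (pres_pi s) (pres_pi t).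
Proof. by apply/pres_piP/cong_lie; apply/cong_sym/cong_repr. Qed.

Local Ltac lift :=
  repeat match goal with x : presented_lie |- _ =>
    rewrite -(pres_piK x); move: (repr x) => {}x end;
  rewrite -?(pres_piD, pres_piZ, pres_piL); apply/pres_piP.

Fact pres_addA : associative pres_add.
Proof. by move=> x y z; lift; exact: cong_addA. Qed.
Fact pres_addC : commutative pres_add.
Proof. by move=> x y; lift; exact: cong_addC. Qed.
Fact pres_add0 : left_id (pres_pi TZero) pres_add.
Proof. by move=> x; lift; exact: cong_add0. Qed.
Fact pres_addN :
  left_inverse (pres_pi TZero) (pres_scale (-1)) pres_add.
Proof.
move=> x; lift; apply: cong_trans (cong_scale0 x).
rewrite -(addNr 1); apply: cong_sym; apply: cong_trans (cong_scaleDl _ _ _) _.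
by apply: cong_add; [exact: cong_refl | exact: cong_scale1].
Qed.

HB.instance Definition _ := GRing.isZmodule.Build presented_lie
  pres_addA pres_addC pres_add0 pres_addN.

Fact pres_addE (x y : presented_lie) : x + y = pres_add x y.
Proof. by []. Qed.
Fact pres_zeroE : 0 = pres_pi TZero :> presented_lie.
Proof. by []. Qed.

Fact pres_scaleA a b (x : presented_lie) :
  pres_scale a (pres_scale b x) = pres_scale (a * b) x.
Proof. by lift; exact: cong_scaleA. Qed.
Fact pres_scale1 : left_id 1 pres_scale.
Proof. by move=> x; lift; exact: cong_scale1. Qed.
Fact pres_scaleDr : right_distributive pres_scale +%R.
Proof.
by move=> a x y; rewrite !pres_addE; lift; exact: cong_scaleDr.
Qed.
Fact pres_scaleDl (x : presented_lie) : {morph pres_scale^~ x : a b / a + b}.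
Proof.
by move=> a b; rewrite !pres_addE; lift; exact: cong_scaleDl.
Qed.

HB.instance Definition _ := GRing.Zmodule_isLmodule.Build K presented_lie
  pres_scaleA pres_scale1 pres_scaleDr pres_scaleDl.

Fact pres_scaleE a (x : presented_lie) : a *: x = pres_scale a x.
Proof. by []. Qed.

Fact pres_lieDl (x y z : presented_lie) :
  pres_bracket (x + y) z = pres_bracket x z + pres_bracket y z.
Proof. by rewrite !pres_addE; lift; exact: cong_lieDl. Qed.
Fact pres_lieDr (x y z : presented_lie) :
  pres_bracket x (y + z) = pres_bracket x y + pres_bracket x z.
Proof. by rewrite !pres_addE; lift; exact: cong_lieDr. Qed.
Fact pres_lieZl a (x y : presented_lie) :
  pres_bracket (a *: x) y = a *: pres_bracket x y.
Proof. by rewrite !pres_scaleE; lift; exact: cong_lieZl. Qed.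
Fact pres_lieZr a (x y : presented_lie) :
  pres_bracket x (a *: y) = a *: pres_bracket x y.
Proof. by rewrite !pres_scaleE; lift; exact: cong_lieZr. Qed.
Fact pres_liexx (x : presented_lie) : pres_bracket x x = 0.
Proof. by rewrite pres_zeroE; lift; exact: cong_liexx. Qed.
Fact pres_jacobi (x y z : presented_lie) :
  pres_bracket x (pres_bracket y z) + pres_bracket y (pres_bracket z x)
    + pres_bracket z (pres_bracket x y) = 0.
Proof. by rewrite !pres_addE pres_zeroE; lift; exact: cong_jacobi. Qed.

HB.instance Definition _ := Lmodule_isLieAlgebra.Build K presented_lie
  pres_lieDl pres_lieDr pres_lieZl pres_lieZr pres_liexx pres_jacobi.

Fixpoint term_eval (L : lieAlgType K) (g : X -> L) (t : term) : L :=
  match t with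
  | TGen x => g x
  | TZero => 0
  | TAdd s t => term_eval g s + term_eval g t
  | TScale a t => a *: term_eval g t
  | TLie s t => lie (term_eval g s) (term_eval g t)
  end.

Lemma pres_lift_exists (L : lieAlgType K) (g : X -> L) :
  (forall s t, R s t -> term_eval g s = term_eval g t) ->
  exists2 f : presented_lie -> L,
    lie_morphism f & forall x, f (pres_pi (TGen x)) = g x.
Proof.
move=> gR.
have gC s t : lie_cong s t -> term_eval g s = term_eval g t.
  elim=> //=; do ?[by move=> * /=; congruence].
  - by move=> *; rewrite addrA.
  - by move=> *; rewrite addrC.
  - by move=> *; rewrite add0r.
  - by move=> *; rewrite scale0r.
  - by move=> *; rewrite scale1r.
  - by move=> *; rewrite scalerA.
  - by move=> *; rewrite scalerDr.
  - by move=> *; rewrite scalerDl.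
  - by move=> *; rewrite lieDl.
  - by move=> *; rewrite lieDr.
  - by move=> *; rewrite lieZl.
  - by move=> *; rewrite lieZr.
  - by move=> *; rewrite liexx.
  - by move=> *; rewrite lie_jacobi.
exists (fun x => term_eval g (repr x)); last first.
  by move=> x; exact: (gC _ (TGen x) (cong_repr _)).
split=> [a x y|x y]; last exact: (gC _ (TLie _ _) (cong_repr _)).
rewrite (gC _ (TAdd (repr (a *: x)) (repr y)) (cong_repr _)) /=.
by congr (_ + _); exact: (gC _ (TScale _ _) (cong_repr _)).
Qed.

Lemma pres_lift_unique (L : lieAlgType K) (f f' : presented_lie -> L) :
  lie_morphism f -> lie_morphism f' ->
  (forall x, f (pres_pi (TGen x)) = f' (pres_pi (TGen x))) -> f =1 f'.
Proof.
have lin0 (h : presented_lie -> L) : linear h -> h 0 = 0.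
  by move=> hl; have:= hl (-1) 0 0; rewrite scaler0 addr0 scaleN1r addNr.
move=> [fl fb] [fl' fb'] ff' x; rewrite -(pres_piK x).
elim: (repr x) => {x} [x||s IHs t IHt|a t IHt|s IHs t IHt].
- exact: ff'.
- by rewrite -/(0 : presented_lie) !lin0.
- rewrite pres_piD -[pres_add _ _]/(pres_pi s + pres_pi t).
  by rewrite -[pres_pi s]scale1r fl fl' IHs IHt.
- rewrite pres_piZ -[pres_scale _ _]/(a *: pres_pi t).
  by rewrite -[_ *: _]addr0 fl fl' !lin0 // IHt.
- rewrite pres_piL -[pres_bracket _ _]/(lie (pres_pi s) (pres_pi t)).
  by rewrite fb fb' IHs IHt.
Qed.

End Presentation.

(** The derived Kac-Moody algebra (no derivations adjoined) of a matrix [C], by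
    Chevalley generators and Serre relations; [C j i] is the value of the simple
    root [j] on [h_i]. *)

Inductive chevalley (n : nat) : Type :=
| GenE (i : 'I_n)
| GenF (i : 'I_n)
| GenH (i : 'I_n).

Section KacMoody.
Variables (K : fieldType) (n : nat).
Implicit Type C : 'M[int]_n.

Local Notation te i := (TGen (GenE i) : lie_term K (chevalley n)).
Local Notation tf i := (TGen (GenF i) : lie_term K (chevalley n)).
Local Notation th i := (TGen (GenH i) : lie_term K (chevalley n)).

(* The exponent is [1 - C j i], nonnegative for a generalized Cartan matrix. *)
Inductive serre_rel C :
  lie_term K (chevalley n) -> lie_term K (chevalley n) -> Prop :=
| serre_hh i j : serre_rel C (TLie (th i) (th j)) TZero
| serre_he i j :
    serre_rel C (TLie (th i) (te j)) (TScale (C j i)%:~R (te j))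
| serre_hf i j :
    serre_rel C (TLie (th i) (tf j)) (TScale (- (C j i)%:~R) (tf j))
| serre_ef_eq i : serre_rel C (TLie (te i) (tf i)) (th i)
| serre_ef_neq i j : i != j -> serre_rel C (TLie (te i) (tf j)) TZero
| serre_ee i j : i != j ->
    serre_rel C (iter `|1 - C j i|%N (TLie (te i)) (te j)) TZero
| serre_ff i j : i != j ->
    serre_rel C (iter `|1 - C j i|%N (TLie (tf i)) (tf j)) TZero.

Definition kac_moody C : lieAlgType K := presented_lie (serre_rel C).

Definition km_e C (i : 'I_n) : kac_moody C := pres_pi _ (te i).
Definition km_f C (i : 'I_n) : kac_moody C := pres_pi _ (tf i).
Definition km_h C (i : 'I_n) : kac_moody C := pres_pi _ (th i).

(** The root lattice is [Z^n] in the basis of simple roots. The component of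
    weight [b] is taken for the span of the [h_i]; these are the root spaces when
    [C] is nonsingular and [K] has characteristic 0. *)

Definition simple_root (i : 'I_n) : 'rV[int]_n := delta_mx 0 i.

Definition root_space C (b : 'rV[int]_n) : set (kac_moody C) :=
  [set x | forall i, lie (km_h C i) x = ((b *m C) 0 i)%:~R *: x].
Arguments root_space : clear implicits.

Definition is_root C (b : 'rV[int]_n) :=
  b <> 0 /\ exists2 x, root_space C b x & x <> 0.

Definition is_positive_root C (b : 'rV[int]_n) :=
  is_root C b /\ forall i, 0 <= b 0 i.

Definition gen_cartan_matrix C :=
  [/\ forall i, C i i = 2, forall i j, i != j -> C i j <= 0
    & forall i j, C i j = 0 -> C j i = 0].

(** The subalgebra generated by [E_i], [F_i] and [H_i = [E_i, F_i]]. *)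
Definition chevalley_subalgebra (L : lieAlgType K) (E F : 'I_n -> L) : set L :=
  lie_generated [set x | exists i,
    x = E i \/ x = F i \/ x = lie (E i) (F i)]%classic.

(** After rescaling the [F_i] (hence the [H_i]), the canonical morphism from
    [kac_moody C] is an isomorphism onto the subalgebra generated by [E_i], [F_i]
    and [H_i]. Since [C i i = 2], the relation [[h_i, e_i] = C i i e_i]
    makes the rescaling the one for which the root of [E_i] takes the value 2
    on [H_i]. *)
Definition generates_kac_moody C (L : lieAlgType K) (E F : 'I_n -> L) :=
  gen_cartan_matrix C /\
  exists c : 'I_n -> K, (forall i, c i != 0) /\
  exists phi : kac_moody C -> L,
    [/\ lie_morphism phi, injective phi,
        range phi = chevalley_subalgebra E F
      & forall i, [/\ phi (km_e C i) = E i,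
                      phi (km_f C i) = c i *: F i
                    & phi (km_h C i) = c i *: lie (E i) (F i)]].

End KacMoody.

Arguments root_space {K n}.

(** Hyperbolic generalized Cartan matrices (Kac, Infinite dimensional Lie
    algebras, 4.3 and 4.10). *)

Section Hyperbolic.
Variable R : realType.

Definition cv_ge0 n (u : 'cV[R]_n) := forall i, 0 <= u i 0.
Definition cv_gt0 n (u : 'cV[R]_n) := forall i, 0 < u i 0.

Definition finite_type n (A : 'M[int]_n) :=
  let AR : 'M[R]_n := map_mx intr A in
  [/\ \det AR != 0, exists2 u, cv_gt0 u & cv_gt0 (AR *m u)
    & forall v, cv_ge0 (AR *m v) -> cv_gt0 v \/ v = 0].

Definition affine_type n (A : 'M[int]_n) :=
  let AR : 'M[R]_n := map_mx intr A in
  [/\ (\rank AR).+1 = n, exists2 u, cv_gt0 u & AR *m u = 0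
    & forall v, cv_ge0 (AR *m v) -> AR *m v = 0].

Definition indefinite_type n (A : 'M[int]_n) :=
  let AR : 'M[R]_n := map_mx intr A in
  (exists2 u, cv_gt0 u & cv_gt0 (- (AR *m u))) /\
  forall v, cv_ge0 (AR *m v) -> cv_ge0 v -> v = 0.

Definition indecomposable n (A : 'M[int]_n) :=
  forall S : {set 'I_n},
    (exists i, i \in S) -> (exists j, j \notin S) ->
    exists i j, [/\ i \in S, j \notin S & (A i j != 0) || (A j i != 0)].

Definition symmetrizable n (A : 'M[int]_n) :=
  exists (d : 'rV[R]_n) (B : 'M[R]_n),
    [/\ forall i, d 0 i != 0, B^T = B & map_mx intr A = diag_mx d *m B].

Definition principal_submx n (A : 'M[int]_n) (S : {set 'I_n}) : 'M[int]_#|S| :=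
  mxsub enum_val enum_val A.

Definition hyperbolic_type n (A : 'M[int]_n) :=
  [/\ gen_cartan_matrix A, symmetrizable A, indecomposable A, indefinite_type A
    & forall S : {set 'I_n},
        (exists i, i \in S) -> (exists j, j \notin S) ->
        indecomposable (principal_submx A S) ->
        finite_type (principal_submx A S) \/ affine_type (principal_submx A S)].

End Hyperbolic.

(** The hyperbolic algebra of rank 3; the nodes -1, 0, 1 are numbered 0, 1, 2. *)

Definition int_mx n (rows : seq (seq int)) : 'M[int]_n :=
  \matrix_(i, j) (nth [::] rows i)`_j.

Definition cartan_F : 'M[int]_3 :=
  int_mx 3 [:: [:: 2; -1; 0]; [:: -1; 2; -2]; [:: 0; -2; 2]].

Definition alpha_m1 : 'rV[int]_3 := simple_root 0.
Definition alpha_0 : 'rV[int]_3 := simple_root 1.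
Definition alpha_1 : 'rV[int]_3 := simple_root 2.

Definition sym2 (a b c : int) : 'M[int]_2 :=
  int_mx 2 [:: [:: a; b]; [:: b; c]].

(** The identification of the root lattice with S_2(Z), and the bilinear form
    polarizing [-2 det]. *)
Definition root_mx (b : 'rV[int]_3) : 'M[int]_2 :=
  b 0 0 *: sym2 1 0 (-1) + b 0 1 *: sym2 (-1) (-1) 0 + b 0 2 *: sym2 0 1 0.

Definition sym2_form (M N : 'M[int]_2) : int :=
  2 * (M 0 1 * N 0 1) - M 0 0 * N 1 1 - M 1 1 * N 0 0.

Lemma root_mxE b :
  root_mx b = sym2 (b 0 0 - b 0 1) (b 0 2 - b 0 1) (- b 0 0).
Proof.
apply/matrixP=> i j; rewrite !mxE.
by case: i => [[|[|[]]] //= ?]; case: j => [[|[|[]]] //= ?]; ring.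
Qed.

Lemma root_mx_isometry b b' :
  sym2_form (root_mx b) (root_mx b') = (b *m cartan_F *m b'^T) 0 0.
Proof.
rewrite !root_mxE /sym2_form.
rewrite !mxE !big_ord_recl big_ord0 /= !mxE !big_ord_recl !big_ord0 /= !mxE /=.
have -> : lift ord0 ord0 = 1 :> 'I_3 by exact/val_inj.
have -> : lift ord0 (lift ord0 ord0) = 2 :> 'I_3 by exact/val_inj.
by ring.
Qed.

Lemma root_mx_inj : injective root_mx.
Proof.
move=> b b' /matrixP bb'; rewrite !root_mxE in bb'.
have e0 : b 0 0 = b' 0 0 by have := bb' 1 1; rewrite !mxE /=; exact: oppr_inj.
have e1 : b 0 1 = b' 0 1.
  by have := bb' 0 0; rewrite !mxE /= e0 => /addrI /oppr_inj.
have e2 : b 0 2 = b' 0 2.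
  by have := bb' 0 1; rewrite !mxE /= e1 => /addIr.
apply/rowP=> -[[|[|[|//]]] i3].
- by rewrite (_ : Ordinal i3 = 0) //; exact/val_inj.
- by rewrite (_ : Ordinal i3 = 1) //; exact/val_inj.
- by rewrite (_ : Ordinal i3 = 2) //; exact/val_inj.
Qed.

Lemma root_mx_surj (M : 'M[int]_2) : M^T = M -> exists b, root_mx b = M.
Proof.
move=> /matrixP Msym; have M01 := Msym 0 1; rewrite mxE in M01.
exists (- M 1 1 *: alpha_m1 + (- M 1 1 - M 0 0) *: alpha_0
        + (M 0 1 - M 1 1 - M 0 0) *: alpha_1).
have i2 (i : 'I_2) : i = 0 \/ i = 1.
  by case: i => [[|[|//]] ?]; [left | right]; exact/val_inj.
rewrite root_mxE; apply/matrixP=> i j.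
by case: (i2 i) => ->; case: (i2 j) => ->; rewrite !mxE /= ?M01; ring.
Qed.

Definition beta (m : nat) (s : int) (i : 'I_2) : 'rV[int]_3 :=
  if i == 0 then alpha_m1 else (alpha_0 + alpha_1) *+ m + s *: alpha_1.

Definition cartan_rank2 (m : nat) : 'M[int]_2 :=
  int_mx 2 [:: [:: 2; - m%:Z]; [:: - m%:Z; 2]].

(* Main.v *)
(** A Kac-Moody algebra carries a cobracket, the cocycle that maps [e_i] to
    [h_i /\ e_i] and [f_i] to [h_i /\ f_i]; followed by the bracket it is a
    derivation, four times the height. If [x] has positive weight [c] and is
    killed by all the [f_j], then its cobracket is [h_c /\ x], by induction on the
    height; followed by the bracket this is [2 (c, c) x], so
    [(c, c) = 2 ht c > 0]. But [(c, c) <= 0], because [ad e_j] is locally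
    nilpotent and [x] is a lowest weight vector. Hence [x = 0], and an ideal that
    is stable under the degree derivations and meets the span of the [h_i]
    trivially is zero: this is the theorem of Gabber and Kac.

    Reflections, built as products of exponentials, carry the root [beta_1] of the
    affine subalgebra to a simple root. So its root vectors and those of [beta_0]
    behave as Chevalley generators; [beta_0 - beta_1] has coefficients of both
    signs and is not a root, which gives the relations [[E_i, F_j] = 0], and the
    Serre relations follow from local nilpotency. The morphism from the rank 2
    algebra is then injective by the theorem of Gabber and Kac applied to its
    kernel. *)

(* A presentation gives maps out of an algebra, but does not show that anything in it is nonzero.
   Here that comes from a module: [e_i] acts nontrivially on the highest weight module inside a dual
   Verma module. Bracketing with the [e_j] then makes the [h_i] independent when [C] is nonsingular,
   hence also the coroots of the [beta_i], and the kernel of the morphism cannot meet the Cartan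
   part. For any [x] of positive weight [c], the cobracket is [h_c /\ x] plus a term with both
   factors of positive weight. If [x] is singular, the first factors of least height in this term
   are singular too and of smaller height, so induction removes the term. The bound [(c, c) <= 0] is
   the sum of the [(c, alpha_j) <= 0] weighted by the nonnegative coefficients of [c]. Root spaces
   are defined by the [h_i], while the arguments need the gradation by the root lattice. The
   adjugate of [C] passes from one to the other. *)
Require Import Defs.
From mathcomp Require Import all_boot all_order all_algebra.
From mathcomp Require Import boolp classical_sets functions reals.
From mathcomp Require Import ring lra zify.
Set Implicit Arguments.
Unset Strict Implicit.
Unset Printing Implicit Defensive.
Import Order.TTheory GRing.Theory Num.Theory.
Local Open Scope ring_scope.

(** * Linear algebra *)

(* The tactic [module K] proves an equality of linear combinations over [K] by
   comparing the coefficients of their atoms with [ring]. *)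
Inductive mexp (K : Type) :=
| MVar (i : nat)
| MZero
| MAdd (s t : mexp K)
| MOpp (s : mexp K)
| MScale (a : K) (s : mexp K).
Arguments MVar {K}.
Arguments MZero {K}.

Fixpoint mval (K : fieldType) (V : lmodType K) (e : seq V) (s : mexp K) : V :=
  match s with
  | MVar i => e`_i
  | MZero => 0
  | MAdd s t => mval e s + mval e t
  | MOpp s => - mval e s
  | MScale a s => a *: mval e s
  end.

Fixpoint mcoef (K : fieldType) (s : mexp K) (i : nat) : K :=
  match s with
  | MVar j => (j == i)%:R
  | MZero => 0
  | MAdd s t => mcoef s i + mcoef t i
  | MOpp s => - mcoef s i
  | MScale a s => a * mcoef s i
  end.

(** A nested conjunction, so that simplification and splitting leave one [ring] goal for each
    atom. *)
Fixpoint mcoef_eq (K : fieldType) (s t : mexp K) (n : nat) : Prop :=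
  if n is n'.+1 then mcoef s n' = mcoef t n' /\ mcoef_eq s t n' else True.

Lemma mvalE (K : fieldType) (V : lmodType K) (e : seq V) (s : mexp K) :
  mval e s = \sum_(i < size e) mcoef s i *: e`_i.
Proof.
elim: s => [j||s IHs t IHt|s IHs|a s IHs] /=.
- case: (ltnP j (size e)) => [jn|nj].
    rewrite (bigD1 (Ordinal jn)) //= eqxx scale1r big1 ?addr0 // => i.
    rewrite -val_eqE /= eq_sym => /negbTE->; exact: scale0r.
  rewrite nth_default // big1 // => i _.
  by rewrite (gtn_eqF (leq_trans (ltn_ord i) nj)) scale0r.
- by rewrite big1 // => i _; rewrite scale0r.
- by rewrite IHs IHt -big_split; apply: eq_bigr => i _; rewrite scalerDl.
- by rewrite IHs -sumrN; apply: eq_bigr => i _; rewrite scaleNr.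
- by rewrite IHs scaler_sumr; apply: eq_bigr => i _; rewrite scalerA.
Qed.

Lemma mval_eq (K : fieldType) (V : lmodType K) (e : seq V) (s t : mexp K) :
  mcoef_eq s t (size e) -> mval e s = mval e t.
Proof.
move=> st; rewrite !mvalE; apply: eq_bigr => i _; congr (_ *: _).
elim: (size e) i st => [[]//|n IHn] i /= [stn stn'].
have [->//|ni] := eqVneq (i : nat) n.
have lt_in : (i < n)%N by rewrite ltn_neqAle ni -ltnS ltn_ord.
exact: (IHn (Ordinal lt_in)).
Qed.

Ltac matom_mem x l :=
  lazymatch l with
  | nil => constr:(false)
  | ?y :: ?l' => match x with y => constr:(true) | _ => matom_mem x l' end
  end.
Ltac matom_add x l :=
  let b := matom_mem x l in
  lazymatch b with true => l | false => constr:(cons x l) end.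
Ltac matom_index x l :=
  lazymatch l with
  | ?y :: ?l' =>
    match x with
    | y => constr:(O)
    | _ => let n := matom_index x l' in constr:(S n)
    end
  end.
Ltac matoms t l :=
  lazymatch t with
  | @GRing.add _ ?x ?y => let l := matoms x l in matoms y l
  | @GRing.opp _ ?x => matoms x l
  | @GRing.scale _ _ _ ?x => matoms x l
  | @GRing.zero _ => l
  | _ => matom_add t l
  end.
Ltac mreify K t l :=
  lazymatch t with
  | @GRing.add _ ?x ?y =>
    let s := mreify K x l in let t := mreify K y l in constr:(@MAdd K s t)
  | @GRing.opp _ ?x => let s := mreify K x l in constr:(@MOpp K s)
  | @GRing.scale _ _ ?a ?x => let s := mreify K x l in constr:(@MScale K a s)
  | @GRing.zero _ => constr:(@MZero K)
  | _ => let i := matom_index t l in constr:(@MVar K i)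
  end.
Ltac module K :=
  lazymatch goal with
  | |- @eq ?V ?x ?y =>
    let l := matoms x (@nil V) in
    let l := matoms y l in
    let s := mreify K x l in
    let t := mreify K y l in
    apply: (@mval_eq K _ l s t); rewrite /=; do ?split; try (by []);
    rewrite ?(mulr0, mulr1, addr0, add0r, oppr0) /=; try (by []); try ring
  end.

Section LinearMaps.
Variables (K : fieldType) (U V : lmodType K) (f : U -> V).
Hypothesis fl : linear f.

Lemma lin0 : f 0 = 0.
Proof. by have := fl (-1) 0 0; rewrite scaler0 addr0 scaleN1r addNr. Qed.

Lemma linD x y : f (x + y) = f x + f y.
Proof. by have := fl 1 x y; rewrite !scale1r. Qed.

Lemma linZ a x : f (a *: x) = a *: f x.
Proof. by have := fl a x 0; rewrite lin0 !addr0. Qed.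

Lemma linN x : f (- x) = - f x.
Proof. by rewrite -scaleN1r linZ scaleN1r. Qed.

Lemma linB x y : f (x - y) = f x - f y.
Proof. by rewrite linD linN. Qed.

Lemma lin_sum (I : Type) (r : seq I) (P : pred I) (F : I -> U) :
  f (\sum_(i <- r | P i) F i) = \sum_(i <- r | P i) f (F i).
Proof. exact: (big_morph f linD lin0). Qed.

End LinearMaps.

Lemma lin_comp (K : fieldType) (U V W : lmodType K) (f : V -> W) (g : U -> V) :
  linear f -> linear g -> linear (f \o g).
Proof. by move=> fl gl a x y; rewrite /= gl fl. Qed.

Section Subspaces.
Variables (K : fieldType) (V : lmodType K).
Implicit Types A B G : set V.

Definition subspace A := A 0 /\ forall a x y, A x -> A y -> A (a *: x + y).

Lemma subspaceD A x y : subspace A -> A x -> A y -> A (x + y).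
Proof. by move=> [_ As] Ax Ay; rewrite -[x]scale1r; exact: As. Qed.

Lemma subspaceZ A a x : subspace A -> A x -> A (a *: x).
Proof. by move=> [A0 As] Ax; rewrite -[_ *: _]addr0; exact: As. Qed.

Lemma subspaceN A x : subspace A -> A x -> A (- x).
Proof. by move=> As Ax; rewrite -scaleN1r; exact: subspaceZ. Qed.

Lemma subspaceB A x y : subspace A -> A x -> A y -> A (x - y).
Proof. by move=> As Ax Ay; apply: subspaceD => //; exact: subspaceN. Qed.

Lemma subspace_sum A (I : eqType) (r : seq I) (F : I -> V) :
  subspace A -> (forall i, i \in r -> A (F i)) -> A (\sum_(i <- r) F i).
Proof.
move=> As AF; rewrite big_seq; elim/big_ind: _ => //; first by case: As.
by move=> x y; exact: subspaceD.
Qed.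

Inductive span G : V -> Prop :=
| span0 : span G 0
| span_cons a x y of G x & span G y : span G (a *: x + y).

Lemma span_sub G A : subspace A -> (forall x, G x -> A x) ->
  forall x, span G x -> A x.
Proof.
move=> [A0 As] GA x; elim=> // a y z Gy _ Az.
by apply: As => //; exact: GA.
Qed.

Lemma span_subspace G : subspace (span G).
Proof.
split=> [|a x y]; first exact: span0.
elim=> [|b z t Gz _ IHt] Gy; first by rewrite scaler0 add0r.
rewrite scalerDr scalerA -addrA; apply: span_cons => //; exact: IHt.
Qed.

Lemma span_gen G x : G x -> span G x.
Proof.
move=> Gx; rewrite -[x]scale1r -[_ *: _]addr0; apply: span_cons => //.
exact: span0.
Qed.

Lemma span_mono G G' x : (forall y, G y -> G' y) -> span G x -> span G' x.
Proof.
by move=> GG'; apply: span_sub; [exact: span_subspace|move=> y /GG' /span_gen].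
Qed.

End Subspaces.

Lemma subspace_preim (K : fieldType) (U V : lmodType K) (f : U -> V) (A : set V) :
  linear f -> subspace A -> subspace (fun x => A (f x)).
Proof.
move=> fl As; split=> [|a x y Ax Ay]; first by rewrite (lin0 fl); case: As.
by rewrite fl; case: As => _; apply.
Qed.

Lemma subspace_ker (K : fieldType) (U V : lmodType K) (f : U -> V) :
  linear f -> subspace (fun x => f x = 0).
Proof.
move=> fl; split=> [|a x y x0 y0]; first exact: lin0.
by rewrite fl x0 y0 scaler0 addr0.
Qed.

Lemma subspaceI (K : fieldType) (V : lmodType K) (A B : set V) :
  subspace A -> subspace B -> subspace (fun x => A x /\ B x).
Proof.
move=> [A0 As] [B0 Bs]; split=> // a x y [Ax Bx] [Ay By].
by split; [exact: As|exact: Bs].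
Qed.

Lemma complement_proj (K : fieldType) (V : lmodType K) (S P : set V) :
  subspace S -> subspace P -> (forall x, S x -> P x -> x = 0) ->
  (forall x, exists2 y, S y & P (x - y)) ->
  exists2 p : V -> V, linear p & forall x, S (p x) /\ P (x - p x).
Proof.
move=> Ss Ps SP0 SP.
have /choice[p pP] : forall x, exists y, S y /\ P (x - y).
  by move=> x; have [y] := SP x; exists y.
exists p => // a x y; apply/subr0_eq/SP0.
  have [Sx _] := pP x; have [Sy _] := pP y; have [Sxy _] := pP (a *: x + y).
  by apply: subspaceB => //; apply: (Ss.2).
have [_ Px] := pP x; have [_ Py] := pP y; have [_ Pxy] := pP (a *: x + y).
have -> : p (a *: x + y) - (a *: p x + p y)
    = (a *: (x - p x) + (y - p y)) - (a *: x + y - p (a *: x + y)).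
  by module K.
by apply: subspaceB => //; apply: (Ps.2).
Qed.

Lemma complement_exists (K : fieldType) (V : lmodType K) (S : set V) :
  subspace S -> exists P : set V, [/\ subspace P, forall x, S x -> P x -> x = 0
    & forall x, exists2 y, S y & P (x - y)].
Proof.
move=> Ss.
(* A chain may be empty, and its union is then empty and not a subspace; hence 0 is adjoined to
   [P]. *)
pose ok (P : set V) := subspace (P `|` [set 0])%classic /\
  forall x, S x -> P x -> x = 0.
have [F Fok Ftot|P [[Ps SP0] Pmax]] := @Zorn_bigcup V ok.
  split; last by move=> x Sx [P /Fok[_ SP]]; exact: SP.
  split=> [|a x y]; first by right.
  have sub P z : F P -> (P z \/ z = 0) -> (\bigcup_(X in F) X `|` [set 0])%classic z.
    by move=> FP [Pz|->]; [left; exists P|right].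
  have Fs P : F P -> subspace (P `|` [set 0])%classic by move=> /Fok[].
  move=> [[P FP Px]|->]; last first.
    move=> [[Q FQ Qy]|->]; last by right; rewrite scaler0 addr0.
    by rewrite scaler0 add0r; apply: (sub Q) => //; left.
  move=> [[Q FQ Qy]|->]; last first.
    by rewrite addr0; apply: (sub P) => //; apply: (subspaceZ a (Fs _ FP)); left.
  have [PQ|QP] := Ftot _ _ FP FQ.
    by apply: (sub Q) => //; apply: (Fs _ FQ).2; left => //; exact: PQ.
  by apply: (sub P) => //; apply: (Fs _ FP).2; left => //; exact: QP.
exists (P `|` [set 0])%classic; split=> //.
  by move=> x Sx [|//]; exact: SP0.
move=> x; apply: contrapT => noy.
(* [P] and [Q] together form the span of [P] and [x]. Since [a != 0] in [Q], an element of [S] that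
   lies in [Q] would put [x] into [S + P]. *)
pose Q : set V := fun z => exists2 a, a != 0 & (P `|` [set 0])%classic (z - a *: x).
have Px : ~ (P `|` [set 0])%classic x.
  by move=> Px; apply: noy; exists 0; [case: Ss|rewrite subr0].
apply: (Pmax (P `|` Q)%classic).
  split; last first.
    move=> PQP; apply: Px; left; apply: PQP; right; exists 1; first exact: oner_neq0.
    by right; rewrite scale1r subrr.
  by move=> z; left.
have PQE z : (P `|` Q `|` [set 0])%classic z <->
    exists a, (P `|` [set 0])%classic (z - a *: x).
  split=> [[[Pz|[a _ Pz]]|->]|[a]].
  - by exists 0; rewrite scale0r subr0; left.
  - by exists a.
  - by exists 0; rewrite scale0r subr0; right.
  have [->|a0] := eqVneq a 0.
    by rewrite scale0r subr0 => -[]; [left; left|right].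
  by left; right; exists a.
split.
  split=> [|a y z /PQE[b Py] /PQE[c Pz]]; first by right.
  apply/PQE; exists (a * b + c).
  have -> : a *: y + z - (a * b + c) *: x = a *: (y - b *: x) + (z - c *: x).
    by module K.
  exact: Ps.2.
move=> z Sz [Pz|[a a0 Pz]]; first exact: SP0.
exfalso; apply: noy; exists (a^-1 *: z); first exact: subspaceZ.
have -> : x - a^-1 *: z = - a^-1 *: (z - a *: x).
  by rewrite scalerBr scalerA mulNr mulVf // scaleN1r scaleNr opprK addrC.
exact: subspaceZ.
Qed.

(** Project onto the image of [S] along a complement, then invert [A] there. It will be applied to
    the map that sends [u] to the family of all [lie (f j) u]. *)
Lemma left_inverse_on (K : fieldType) (V W : lmodType K) (A : V -> W) (S : set V) :
  linear A -> subspace S -> (forall x, S x -> A x = 0 -> x = 0) ->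
  exists2 s : W -> V, linear s & forall x, S x -> s (A x) = x.
Proof.
move=> Al Ss Ainj.
pose T : set W := fun w => exists2 x, S x & A x = w.
have Ts : subspace T.
  split; first by exists 0; [case: Ss|exact: lin0].
  move=> a _ _ [x Sx <-] [y Sy <-]; exists (a *: x + y); last exact: Al.
  exact: Ss.2.
have [P [Ps TP0 TP]] := complement_exists Ts.
have [p pl pP] := complement_proj Ts Ps TP0 TP.
have /choice[s sP] : forall w, exists x, S x /\ A x = p w.
  by move=> w; have [[x Sx Ax] _] := pP w; exists x.
have pT w : T w -> p w = w.
  move=> Tw; have [Tp Pp] := pP w; apply/esym/subr0_eq/TP0 => //.
  exact: subspaceB.
exists s => [a w w'|x Sx].
  apply/subr0_eq/Ainj.
    by apply: subspaceB; [|case: (sP (a *: w + w'))|apply: (Ss.2);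
      [case: (sP w)|case: (sP w')]].
  rewrite (linB Al) Al !(sP _).2 pl subrr //.
apply/subr0_eq/Ainj; first by apply: subspaceB => //; case: (sP (A x)).
by rewrite (linB Al) (sP _).2 pT ?subrr //; exists x.
Qed.

(** * Eigenspaces of an operator with integer eigenvalues *)

Section IntegerEigenvalues.
Variables (K : fieldType) (charK0 : [pchar K] =i pred0).

Lemma intr_inj0 : injective (intr : int -> K).
Proof.
have nat0 (n : nat) : n%:R = 0 :> K -> n = 0%N.
  by move=> n0; apply/eqP; rewrite -((pcharf0P K).1 charK0) n0.
move=> k l /eqP; rewrite -subr_eq0 -intrB => /eqP kl; apply/subr0_eq; move: kl.
case: (k - l) => n; first by rewrite -[(Posz n)%:~R]/(n%:R) => /nat0->.
by rewrite NegzE mulrNz => /eqP; rewrite oppr_eq0 => /eqP/nat0.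
Qed.

Lemma intr_eq00 (k : int) : (k%:~R == 0 :> K) = (k == 0).
Proof. by apply/eqP/eqP => [|->//]; exact: (@intr_inj0 k 0). Qed.

Variables (V : lmodType K) (D : V -> V).
Hypothesis Dl : linear D.

Definition eigen (k : int) : set V := fun x => D x = k%:~R *: x.

Lemma eigen_subspace k : subspace (eigen k).
Proof.
split; first by rewrite /eigen (lin0 Dl) scaler0.
by move=> a x y Dx Dy; rewrite /eigen Dl Dx Dy; module K.
Qed.

(** [D - l] kills the component [f l] and multiplies each other one by a nonzero scalar, so the
    induction hypothesis applies to the remaining components. *)
Lemma stable_components (A : set V) (r : seq int) (f : int -> V) :
  subspace A -> (forall x, A x -> A (D x)) -> uniq r ->
  (forall k, k \in r -> eigen k (f k)) -> A (\sum_(k <- r) f k) ->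
  forall k, k \in r -> A (f k).
Proof.
move=> As AD; elim: r f => [//|l r IHr] f /= /andP[lr ur] fe.
rewrite big_cons => Afl.
have Ar k : k \in r -> A (f k).
  move=> kr.
  have kl : (k - l)%:~R != 0 :> K.
    by rewrite intr_eq00 subr_eq0; apply: contraNneq lr => <-.
  rewrite -[f k]scale1r -(mulVf kl) -scalerA; apply: subspaceZ => //.
  apply: (IHr (fun k => (k - l)%:~R *: f k)) => //.
    move=> j jr; have fj := fe j; rewrite /eigen (linZ Dl) fj ?inE ?jr ?orbT //.
    by rewrite scalerA mulrC -scalerA.
  have -> : \sum_(j <- r) (j - l)%:~R *: f j
      = D (f l + \sum_(j <- r) f j) - l%:~R *: (f l + \sum_(j <- r) f j).
    rewrite (linD Dl) fe ?inE ?eqxx // scalerDr opprD addrACA subrr add0r.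
    rewrite (lin_sum Dl) scaler_sumr -sumrB; apply: eq_big_seq => j jr.
    by rewrite (fe j) ?inE ?jr ?orbT // intrB scalerBl.
  by apply: subspaceB => //; [exact: AD|exact: subspaceZ].
move=> k; rewrite inE => /orP[/eqP->|]; last exact: Ar.
rewrite -[f l](addrK (\sum_(j <- r) f j)); apply: subspaceB => //.
exact: subspace_sum.
Qed.

Hypothesis Dspan : forall x, span (fun y => exists k, eigen k y) x.

Lemma eigen_decomposition x : exists r f, [/\ uniq r,
  forall k, eigen k (f k) & x = \sum_(k <- r) f k].
Proof.
elim: (Dspan x) => [|a y z [k yk] _ [r [f [ur fe ->]]]].
  exists [::], (fun=> 0); split=> // [k|]; last by rewrite big_nil.
  by case: (eigen_subspace k).
pose g l := if l == k then (a *: y + (if k \in r then f k else 0)) else f l.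
exists (if k \in r then r else k :: r), g; split.
- by case: ifP => //= ->.
- move=> l; rewrite /g; case: eqP => [->|//].
  apply: (eigen_subspace k).2 => //; case: ifP => // _.
  by case: (eigen_subspace k).
case: ifP => kr.
  rewrite (perm_big _ (perm_to_rem kr)) [RHS](perm_big _ (perm_to_rem kr)) /=.
  rewrite !big_cons /g eqxx kr addrA; congr (_ + _).
  apply: eq_big_seq => l; rewrite mem_rem_uniq // inE => /andP[/= lk _].
  by rewrite (negPf lk).
rewrite big_cons /g eqxx kr addr0; congr (_ + _); apply: eq_big_seq => l lr.
by case: eqP => // lk; rewrite -lk lr in kr.
Qed.

(** The complement of the eigenspace of [k] is the image of [D - k]: it contains every other
    eigenspace, and it meets that of [k] in 0 because [D] is diagonalizable. *)
Lemma eigen_proj k : exists2 p : V -> V, linear p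
  & forall l x, eigen l x -> p x = if l == k then x else 0.
Proof.
pose P x := exists y, x = D y - k%:~R *: y.
have Ps : subspace P.
  split; first by exists 0; rewrite (lin0 Dl) scaler0 subr0.
  move=> a _ _ [x ->] [y ->]; exists (a *: x + y).
  by rewrite Dl; module K.
have eP l x : l != k -> eigen l x -> P x.
  move=> lk xl; have lk0 : (l - k)%:~R != 0 :> K by rewrite intr_eq00 subr_eq0.
  exists ((l - k)%:~R^-1 *: x); rewrite (linZ Dl) xl !scalerA -scalerBl.
  by rewrite mulrC -mulrBl -intrB mulfV // scale1r.
have SP0 x : eigen k x -> P x -> x = 0.
  move=> xk [y xE]; have [r [f [ur fe yE]]] := eigen_decomposition y.
  pose g l := (l - k)%:~R *: f l.
  have ge l : eigen l (g l) by apply: subspaceZ => //; exact: eigen_subspace.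
  have xg : x = \sum_(l <- r) g l.
    rewrite xE yE (lin_sum Dl) scaler_sumr -sumrB; apply: eq_bigr => l _.
    by rewrite fe -scalerBl -intrB.
  rewrite xg big1_seq // => l /andP[_ lr].
  have : eigen k (g l).
    apply: (@stable_components (eigen k) r) => //; [exact: eigen_subspace| |].
      by move=> z zk; rewrite zk; apply: subspaceZ => //; exact: eigen_subspace.
    by rewrite -xg.
  rewrite /eigen ge => /eqP; rewrite -subr_eq0 -scalerBl scaler_eq0 -intrB.
  by rewrite intr_eq00 => /orP[]/eqP; [rewrite /g => ->; rewrite scale0r|].
have SP x : exists2 y, eigen k y & P (x - y).
  elim: (Dspan x) => [|a y z [l yl] _ [t tk Pzt]].
    by exists 0; [case: (eigen_subspace k)|rewrite subr0; case: Ps].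
  have [lk|lk] := eqVneq l k.
    exists (a *: y + t); first by rewrite lk in yl; apply: (eigen_subspace k).2.
    by rewrite opprD addrACA subrr add0r.
  exists t => //; rewrite -addrA; apply: Ps.2 => //; exact: eP yl.
have [p pl pP] := complement_proj (eigen_subspace k) Ps SP0 SP.
exists p => // l x xl; have [Sp Pp] := pP x; apply/subr0_eq/SP0.
  apply: subspaceB => //; first exact: eigen_subspace.
  by case: eqP => [<-//|_]; case: (eigen_subspace k).
case: eqP => [lk|/eqP lk]; first by rewrite -opprB; exact: subspaceN.
rewrite subr0 -[p x](subKr x); apply: subspaceB => //; exact: eP xl.
Qed.

End IntegerEigenvalues.

(** * Lie algebras *)

Section LieTheory.
Variables (K : fieldType) (L : lieAlgType K).
Implicit Types x y z : L.

Lemma lie_linear x : linear (lie x).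
Proof. by move=> a y z; rewrite lieDr lieZr. Qed.

Lemma lie_linearl y : linear (lie^~ y).
Proof. by move=> a x z; rewrite /= lieDl lieZl. Qed.

Lemma lie0r x : lie x 0 = 0. Proof. exact: lin0 (lie_linear x). Qed.
Lemma lie0l x : lie 0 x = 0. Proof. exact: lin0 (lie_linearl x). Qed.
Lemma lieNr x y : lie x (- y) = - lie x y.
Proof. exact: linN (lie_linear x) _. Qed.
Lemma lieNl x y : lie (- x) y = - lie x y.
Proof. exact: linN (lie_linearl y) _. Qed.

Lemma lieC x y : lie x y = - lie y x.
Proof.
apply/eqP; rewrite -addr_eq0; apply/eqP.
by have := liexx (x + y); rewrite lieDl !lieDr !liexx add0r addr0.
Qed.

Lemma lie_lie x y z : lie x (lie y z) = lie (lie x y) z + lie y (lie x z).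
Proof.
apply/eqP; rewrite -subr_eq0; apply/eqP; rewrite -[RHS](lie_jacobi x y z).
by rewrite [lie (lie x y) z]lieC [lie z x]lieC lieNr opprD opprK addrA addrAC.
Qed.
End LieTheory.

Lemma lie_lieC (K : fieldType) (L : lieAlgType K) (x y z : L) :
  lie x (lie y z) - lie y (lie x z) = lie (lie x y) z.
Proof. by rewrite lie_lie addrK. Qed.

Lemma lie_morph_comp (K : fieldType) (L L' L'' : lieAlgType K)
    (f : L' -> L'') (g : L -> L') :
  lie_morphism f -> lie_morphism g -> lie_morphism (f \o g).
Proof.
move=> [fl fm] [gl gm]; split; first exact: lin_comp.
by move=> x y; rewrite /= gm fm.
Qed.

(** * Representations of presented Lie algebras *)

Section Representation.
Variables (K : fieldType) (X : Type).
Variable R : lie_term K X -> lie_term K X -> Prop.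
Variables (V : lmodType K) (op : X -> V -> V) (A : set V).

Fixpoint term_act (t : lie_term K X) (v : V) : V :=
  match t with
  | TGen x => op x v
  | TZero => 0
  | TAdd s t => term_act s v + term_act t v
  | TScale a t => a *: term_act t v
  | TLie s t => term_act s (term_act t v) - term_act t (term_act s v)
  end.

Hypothesis op_linear : forall x, linear (op x).
Hypothesis A_subspace : subspace A.
Hypothesis A_stable : forall x v, A v -> A (op x v).
Hypothesis op_rel : forall s t, R s t ->
  forall v, A v -> term_act s v = term_act t v.

Lemma term_act_linear t : linear (term_act t).
Proof.
elim: t => /= [x||s IHs t IHt|b t IHt|s IHs t IHt] a u v.
- exact: op_linear.
- by rewrite scaler0 addr0.
- by rewrite IHs IHt; module K.
- by rewrite IHt; module K.
- by rewrite !(IHs, IHt); module K.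
Qed.

Lemma term_act_stable t v : A v -> A (term_act t v).
Proof.
elim: t v => /= [x||s IHs t IHt|b t IHt|s IHs t IHt] v Av.
- exact: A_stable.
- by case: A_subspace.
- by apply: subspaceD; [|exact: IHs|exact: IHt].
- by apply: subspaceZ; [|exact: IHt].
- by apply: subspaceB; [|exact/IHs/IHt|exact/IHt/IHs].
Qed.

Lemma term_act_cong s t : lie_cong R s t ->
  forall v, A v -> term_act s v = term_act t v.
Proof.
have lD t' := linD (term_act_linear t').
have lZ t' := linZ (term_act_linear t').
have lB t' := linB (term_act_linear t').
elim=> {s t} /=; do ?[by move=> * /=; rewrite ?(lD, lZ); module K].
- exact: op_rel.
- by move=> s t _ IH v Av; rewrite IH.
- by move=> s t u _ IHs _ IHt v Av; rewrite IHs // IHt.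
- by move=> s s' t t' _ IHs _ IHt v Av; rewrite IHs // IHt.
- by move=> a t t' _ IHt v Av; rewrite IHt.
- move=> s s' t t' _ IHs _ IHt v Av.
  by rewrite !(IHs, IHt) //; apply: term_act_stable.
- by move=> *; rewrite !lB; module K.
Qed.

(** [A] stays a predicate on [V]: the operators are linear on all of [V], and only the relations are
    restricted to [A]. This serves the module generated by a vacuum vector and the space of bilinear
    maps. *)
Lemma representation_exists : exists rho : presented_lie R -> V -> V,
  [/\ forall x, linear (rho x),
      forall x v, A v -> A (rho x v),
      forall a x y v, A v -> rho (a *: x + y) v = a *: rho x v + rho y v,
      forall x y v, A v -> rho (lie x y) v = rho x (rho y v) - rho y (rho x v)
    & forall t v, A v -> rho (pres_pi R t) v = term_act t v].
Proof.
exists (fun x => term_act (repr x)); split=> [x|x v|a x y v Av|x y v Av|t v Av].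
- exact: term_act_linear.
- exact: term_act_stable.
- rewrite (term_act_cong (t := TAdd (TScale a (repr x)) (repr y))) //.
  by apply/pres_piP; rewrite pres_piK pres_piD pres_piZ !pres_piK.
- rewrite (term_act_cong (t := TLie (repr x) (repr y))) //.
  by apply/pres_piP; rewrite pres_piK pres_piL !pres_piK.
- by rewrite (term_act_cong (cong_repr R t)).
Qed.

End Representation.

Lemma presented_lie_ind (K : fieldType) (X : Type)
    (R : lie_term K X -> lie_term K X -> Prop) (P : set (presented_lie R)) :
  subspace P -> (forall x, P (pres_pi R (TGen x))) ->
  (forall x y, P x -> P y -> P (lie x y)) -> forall x, P x.
Proof.
move=> Ps Pg Pl x; rewrite -(pres_piK x).
elim: (repr x) => {x} [x||s IHs t IHt|a t IHt|s IHs t IHt].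
- exact: Pg.
- by case: Ps.
- by rewrite pres_piD; exact: (subspaceD Ps IHs IHt).
- by rewrite pres_piZ; exact: (subspaceZ a Ps IHt).
- by rewrite pres_piL; exact: (Pl _ _ IHs IHt).
Qed.

(** * Lowest weight vectors *)

Section LowestWeight.
Variables (K : fieldType) (L : lieAlgType K) (e f h x : L) (a : K).
Hypotheses (ef : lie e f = h) (he : lie h e = 2 *: e).
Hypotheses (fx : lie f x = 0) (hx : lie h x = a *: x).

Lemma lowest_weight_h k :
  lie h (iter k (lie e) x) = (a + 2 * k%:R) *: iter k (lie e) x.
Proof.
elim: k => [|k IHk] /=; first by rewrite mulr0 addr0.
rewrite lie_lie he lieZl IHk lieZr -natr1; move: (lie e _) => y.
by module K.
Qed.

Lemma lowest_weight_f k : lie f (iter k.+1 (lie e) x)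
  = - (k.+1%:R * (a + k%:R)) *: iter k (lie e) x.
Proof.
have fe : lie f e = - h by rewrite lieC ef.
elim: k => [|k IHk]; first by rewrite /= lie_lie fe lieNl hx fx lie0r; module K.
rewrite iterS lie_lie fe lieNl lowest_weight_h IHk lieZr -iterS -!natr1.
by move: (iter _ _ _) => y; module K.
Qed.

Hypothesis charK0 : [pchar K] =i pred0.

(** At the last nonzero vector of the string, the coefficient [N.+1 * (a + N)] of [lowest_weight_f]
    has to vanish. The weight [a] thus fixes where the string ends. *)
Lemma lowest_weight_nilpotent N : x <> 0 -> iter N (lie e) x = 0 ->
  exists2 k : nat, a = - k%:R & iter k.+1 (lie e) x = 0.
Proof.
move=> x0; elim: N => [//|N IHN] eN.
have [/IHN //|eN0] := pselect (iter N (lie e) x = 0).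
exists N => //; have := lowest_weight_f N; rewrite eN lie0r => /esym/eqP.
rewrite scaler_eq0 (introF eqP eN0) orbF oppr_eq0 mulf_eq0.
by rewrite (pcharf0P K).1 //= addr_eq0 => /eqP.
Qed.

End LowestWeight.

(** * Chevalley generators *)

Definition chevalley_rel (K : fieldType) (n : nat) (C : 'M[int]_n)
    (L : lieAlgType K) (E F H : 'I_n -> L) :=
  [/\ forall i j, lie (H i) (H j) = 0,
      forall i j, lie (H i) (E j) = (C j i)%:~R *: E j,
      forall i j, lie (H i) (F j) = - (C j i)%:~R *: F j
    & forall i j, lie (E i) (F j) = if i == j then H i else 0].

(** The Chevalley involution as a symmetry of the relations; it turns results on the [E i] into
    results on the [F i]. *)
Lemma chevalley_rel_opp (K : fieldType) (n : nat) (C : 'M[int]_n)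
    (L : lieAlgType K) (E F H : 'I_n -> L) :
  chevalley_rel C E F H -> chevalley_rel C F E (fun i => - H i).
Proof.
case=> HH HE HF EF; split=> i j.
- by rewrite lieNl lieNr HH !oppr0.
- by rewrite lieNl HF scaleNr opprK.
- by rewrite lieNl HE scaleNr.
- by rewrite lieC EF eq_sym; case: eqP => [->//|]; rewrite oppr0.
Qed.

(** For [k = i] the coefficient of [lowest_weight_f] is zero exactly at the Serre exponent. For
    [k != i], [E k] commutes with [F i], so only its bracket with [F j] matters. *)
Lemma serre_element_singular (K : fieldType) (n : nat) (C : 'M[int]_n)
    (L : lieAlgType K) (E F H : 'I_n -> L) i j k :
  gen_cartan_matrix C -> chevalley_rel C E F H -> i != j ->
  lie (E k) (iter `|1 - C j i|%N (lie (F i)) (F j)) = 0.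
Proof.
move=> [Cd Cn C0] [HH HE HF EF] ij.
have [N CN] : exists N : nat, C j i = - N%:Z.
  by exists `|C j i|%N; have := Cn j i; rewrite eq_sym => /(_ ij); lia.
have -> : `|1 - C j i|%N = N.+1 by rewrite CN; lia.
have [->|ki] := eqVneq k i.
  have -> : lie (E i) (iter N.+1 (lie (F i)) (F j))
      = - (N.+1%:R * (- N%:R + N%:R)) *: iter N (lie (F i)) (F j).
    apply: (@lowest_weight_f _ _ _ _ (- H i)).
    - by rewrite lieC EF eqxx.
    - by rewrite lieNl HF Cd scaleNr opprK.
    - by rewrite EF (negbTE ij).
    - by rewrite lieNl HF CN mulrNz scaleNr opprK scaleNr.
  by rewrite addNr mulr0 oppr0 scale0r.
have comm m : lie (E k) (iter m (lie (F i)) (F j))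
    = iter m (lie (F i)) (lie (E k) (F j)).
  by elim: m => //= m IHm; rewrite lie_lie EF (negbTE ki) lie0l add0r IHm.
rewrite comm EF; case: eqP => [kj|_]; last first.
  by elim: {CN comm} N => [|N IHN]; rewrite iterS ?IHN lie0r.
(* Here [k = j]. The first bracket turns [H j] into a multiple of [F i], which a second bracket
   kills. If there is only one bracket then [C j i = 0], hence [C i j = 0]. *)
rewrite iterSr kj lieC HF scaleNr opprK; case: N CN {comm} => [|N] CN.
  by rewrite (C0 j i) ?scale0r // CN.
rewrite iterSr lieZr liexx scaler0.
by elim: N {CN} => //= N ->; rewrite lie0r.
Qed.

(** The relations other than Serre's. In the algebra that they present the Serre elements are
    singular, which is what proves the Serre relations on the module below. *)
Inductive tilde_rel (K : fieldType) (n : nat) (C : 'M[int]_n) :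
  lie_term K (chevalley n) -> lie_term K (chevalley n) -> Prop :=
| tilde_hh i j : tilde_rel C (TLie (TGen (GenH i)) (TGen (GenH j))) TZero
| tilde_he i j : tilde_rel C (TLie (TGen (GenH i)) (TGen (GenE j)))
    (TScale (C j i)%:~R (TGen (GenE j)))
| tilde_hf i j : tilde_rel C (TLie (TGen (GenH i)) (TGen (GenF j)))
    (TScale (- (C j i)%:~R) (TGen (GenF j)))
| tilde_ef i j : tilde_rel C (TLie (TGen (GenE i)) (TGen (GenF j)))
    (if i == j then TGen (GenH i) else TZero).

Section PresentedChevalley.
Variables (K : fieldType) (n : nat) (C : 'M[int]_n).

Lemma tilde_chevalley_rel : @chevalley_rel K n C (presented_lie (tilde_rel C))
  (fun i => pres_pi _ (TGen (GenE i))) (fun i => pres_pi _ (TGen (GenF i)))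
  (fun i => pres_pi _ (TGen (GenH i))).
Proof.
split=> i j.
- by apply/pres_piP; apply: cong_trans (cong_rel (tilde_hh K C i j));
    rewrite -/(lie_cong _ _ _); apply/pres_piP; rewrite [RHS]pres_piL.
- by have /cong_rel/pres_piP := tilde_he K C i j; rewrite pres_piL pres_piZ.
- by have /cong_rel/pres_piP := tilde_hf K C i j; rewrite pres_piL pres_piZ.
- by have /cong_rel/pres_piP := tilde_ef K C i j; rewrite pres_piL; case: eqP.
Qed.

Lemma km_chevalley_rel :
  @chevalley_rel K n C (kac_moody K C) (@km_e K n C) (@km_f K n C) (@km_h K n C).
Proof.
split=> i j.
- by have /cong_rel/pres_piP := serre_hh K C i j; rewrite pres_piL.
- by have /cong_rel/pres_piP := serre_he K C i j; rewrite pres_piL pres_piZ.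
- by have /cong_rel/pres_piP := serre_hf K C i j; rewrite pres_piL pres_piZ.
- have [->|/eqP ij] := eqP.
    by have /cong_rel/pres_piP := serre_ef_eq K C j; rewrite pres_piL.
  by have /cong_rel/pres_piP := serre_ef_neq K C ij; rewrite pres_piL.
Qed.

Lemma pres_pi_iter
    (R : lie_term K (chevalley n) -> lie_term K (chevalley n) -> Prop) s t N :
  pres_pi R (iter N (TLie s) t) = iter N (lie (pres_pi R s)) (pres_pi R t).
Proof. by elim: N => //= N <-; rewrite pres_piL. Qed.

Lemma km_serre_e i j : i != j ->
  iter `|1 - C j i|%N (lie (km_e K C i)) (km_e K C j) = 0.
Proof.
by move=> ij; have /cong_rel/pres_piP := serre_ee K C ij; rewrite pres_pi_iter.
Qed.

Lemma km_serre_f i j : i != j ->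
  iter `|1 - C j i|%N (lie (km_f K C i)) (km_f K C j) = 0.
Proof.
by move=> ij; have /cong_rel/pres_piP := serre_ff K C ij; rewrite pres_pi_iter.
Qed.

Lemma km_lift (L : lieAlgType K) (E F H : 'I_n -> L) : chevalley_rel C E F H ->
  (forall i j, i != j -> iter `|1 - C j i|%N (lie (E i)) (E j) = 0) ->
  (forall i j, i != j -> iter `|1 - C j i|%N (lie (F i)) (F j) = 0) ->
  exists2 phi : kac_moody K C -> L, lie_morphism phi
    & forall i, [/\ phi (km_e K C i) = E i, phi (km_f K C i) = F i
                  & phi (km_h K C i) = H i].
Proof.
move=> [HH HE HF EF] SE SF.
pose g (x : chevalley n) :=
  match x with GenE i => E i | GenF i => F i | GenH i => H i end.
have iterE N s t : term_eval g (iter N (TLie s) t)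
    = iter N (lie (term_eval g s)) (term_eval g t).
  by elim: N => //= N ->.
have [|phi phim phig] := @pres_lift_exists K _ (serre_rel C) L g.
  move=> s t [] /=; try by [].
  - by move=> i; rewrite EF eqxx.
  - by move=> i j ij; rewrite EF (negbTE ij).
  - by move=> i j ij; rewrite iterE; exact: SE.
  - by move=> i j ij; rewrite iterE; exact: SF.
by exists phi => // i; split; rewrite /km_e /km_f /km_h phig.
Qed.

End PresentedChevalley.

(** * A highest weight representation *)

Section HighestWeight.
Variables (K : fieldType) (n : nat) (C : 'M[int]_n) (wt : 'I_n -> K).
Variables (M : lmodType K) (m0 : M).
Hypothesis Cgcm : gen_cartan_matrix C.
Local Notation V := (seq 'I_n -> M).

Definition word_wt (i : 'I_n) (w : seq 'I_n) : K :=
  wt i - \sum_(j <- w) (C j i)%:~R.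

Fixpoint lower (i : 'I_n) (v : V) (w : seq 'I_n) : M :=
  if w is j :: w' then
    lower i (fun u => v (j :: u)) w' + (j == i)%:R *: (word_wt i w' *: v w')
  else 0.

(* The dual of a Verma module with highest weight space [M], whose elements are
   the functions on the words [w] standing for the monomials [f_w]. The values
   of [GenF] are forced by [[e_j, f_i] = (j == i) h_i]. *)
Definition hw_op (x : chevalley n) (v : V) : V :=
  match x with
  | GenE i => fun w => v (i :: w)
  | GenF i => lower i v
  | GenH i => fun w => word_wt i w *: v w
  end.

Lemma word_wt_cons i j w : word_wt i (j :: w) = word_wt i w - (C j i)%:~R.
Proof. by rewrite /word_wt big_cons opprD addrA addrAC. Qed.

Lemma lowerE i a (u v : V) w :
  lower i (a *: u + v) w = a *: lower i u w + lower i v w.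
Proof.
elim: w u v => [|j w IHw] u v /=; first by rewrite scaler0 addr0.
rewrite -[(a *: u + v) w]/(a *: u w + v w).
have -> : (fun w' => (a *: u + v) (j :: w'))
    = a *: (fun w' => u (j :: w')) + (fun w' => v (j :: w')) by [].
by rewrite IHw; module K.
Qed.

Lemma hw_op_linear x : linear (hw_op x).
Proof.
move=> a u v; apply/funext; case: x => i w; rewrite -[RHS]/(a *: _ + _) //=.
  exact: lowerE.
by rewrite -[(a *: u + v) w]/(a *: u w + v w); module K.
Qed.

Lemma lower_h i j v w :
  lower j (hw_op (GenH i) v) w = (word_wt i w + (C j i)%:~R) *: lower j v w.
Proof.
elim: w v => [|k w IHw] v /=; first by rewrite scaler0.
have -> : (fun u => word_wt i (k :: u) *: v (k :: u))
    = - (C k i)%:~R *: (fun u => v (k :: u))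
      + hw_op (GenH i) (fun u => v (k :: u)).
  by apply/funext => u; rewrite word_wt_cons scalerDl addrC.
rewrite lowerE IHw word_wt_cons; case: eqP => [->|_]; first by module K.
by rewrite !scale0r; module K.
Qed.

Lemma hw_tilde s t : tilde_rel C s t ->
  forall v : V, term_act hw_op s v = term_act hw_op t v.
Proof.
case=> [i j|i j|i j|i j] v; apply/funext => w /=.
- rewrite -[LHS]/(_ *: (_ *: _) - _ *: (_ *: _)) -[RHS]/0; module K.
- rewrite -[LHS]/(_ *: _ - _ *: _) -[RHS]/(_ *: _) word_wt_cons; module K.
- rewrite -[LHS]/(_ *: _ - lower j (hw_op (GenH i) v) w) -[RHS]/(_ *: _) lower_h.
  module K.
- rewrite -[LHS]/(lower j (hw_op (GenE i) v) w + _ - lower j (hw_op (GenE i) v) w).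
  rewrite addrC addKr; have [->|ij] := eqVneq; first by rewrite scale1r.
  by rewrite scale0r.
Qed.

Definition vac : V := fun w => if w is [::] then m0 else 0.

(** The submodule generated by the vacuum vector. Closure under [lower] is all that is asked, as
    [vac_e] and the commutation relations then give stability under the other operators. *)
Definition vac_span : set V := fun v => forall A : set V, subspace A -> A vac ->
  (forall i u, A u -> A (lower i u)) -> A v.

Lemma vac_span_subspace : subspace vac_span.
Proof.
split=> [A []|a u v Au Av A As A0 Al] //.
exact: (As.2 _ _ _ (Au A As A0 Al) (Av A As A0 Al)).
Qed.

Lemma vac_span_lower i v : vac_span v -> vac_span (lower i v).
Proof. by move=> Av A As A0 Al; exact: (Al _ _ (Av A As A0 Al)). Qed.

Lemma vac_span_vac : vac_span vac. Proof. by []. Qed.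

Lemma vac_e i : hw_op (GenE i) vac = 0.
Proof. by apply/funext. Qed.

Lemma vac_span_stable x v : vac_span v -> vac_span (hw_op x v).
Proof.
move=> Av; suff [Ae Ah] : (forall i, vac_span (hw_op (GenE i) v)) /\
    (forall i, vac_span (hw_op (GenH i) v)).
  by case: x => i //; exact: vac_span_lower.
have As := vac_span_subspace.
pose A u := vac_span u /\ ((forall i, vac_span (hw_op (GenE i) u)) /\
    (forall i, vac_span (hw_op (GenH i) u))).
suff [] : A v by [].
apply: (Av A) => [|| j u [Au [Ae Ah]]].
- apply: subspaceI => //; split=> [|a u w [ue uh] [we wh]].
    by split=> i; rewrite (lin0 (hw_op_linear _)); case: As.
  by split=> i; rewrite hw_op_linear; apply: As.2.
- split=> //; split=> i; first by rewrite vac_e; case: As.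
  have -> : hw_op (GenH i) vac = wt i *: vac.
    apply/funext => -[|j w] /=; last by rewrite scaler0 -[RHS]/(_ *: 0) scaler0.
    by rewrite /word_wt big_nil subr0.
  exact: (subspaceZ _ As vac_span_vac).
- split; first exact: vac_span_lower.
  split=> i.
    have -> : hw_op (GenE i) (lower j u) = lower j (hw_op (GenE i) u)
        + (i == j)%:R *: hw_op (GenH j) u by apply/funext.
    exact: (subspaceD As (vac_span_lower j (Ae i)) (subspaceZ _ As (Ah j))).
  have -> : hw_op (GenH i) (lower j u)
      = lower j (hw_op (GenH i) u) - (C j i)%:~R *: lower j u.
    apply/funext => w.
    rewrite -[RHS]/(lower j (hw_op (GenH i) u) w - _ *: lower j u w) lower_h /=.
    by module K.
  have Al := @vac_span_lower j.
  exact: (subspaceB As (Al _ (Ah i)) (subspaceZ _ As (Al _ Au))).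
Qed.

(** The Serre element of the [e]'s commutes with every [f_k] and kills [vac], hence kills all that
    the [f_k] make from [vac]. That of the [f]'s commutes with every [e_k] and takes values
    vanishing at the empty word; since [e_k] reads off the values at longer words, these vanish
    too. *)
Lemma hw_serre s t : serre_rel C s t ->
  forall v, vac_span v -> term_act hw_op s v = term_act hw_op t v.
Proof.
move=> st v Av.
have Tt : subspace [set: V] by split.
have [rho [rl _ rx rb rt]] := representation_exists (R := tilde_rel C)
  hw_op_linear Tt (fun _ _ _ => I) (fun s t st v _ => hw_tilde st v).
have rE x u : rho (pres_pi (tilde_rel C) (TGen x)) u = hw_op x u by rewrite rt.
have tilde s' t' : tilde_rel C s' t' -> term_act hw_op s' v = term_act hw_op t' v.
  by move=> ?; exact: hw_tilde.
case: st => [i j|i j|i j|i|i j ij|i j ij|i j ij].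
- exact: tilde (tilde_hh K C i j).
- exact: tilde (tilde_he K C i j).
- exact: tilde (tilde_hf K C i j).
- by apply: tilde; have := tilde_ef K C i i; rewrite eqxx.
- by apply: tilde; have := tilde_ef K C i j; rewrite (negbTE ij).
- rewrite -rt // pres_pi_iter.
  set x := iter _ _ _; rewrite /=.
  have xf k : lie (pres_pi (tilde_rel C) (TGen (GenF k))) x = 0.
    exact: (serre_element_singular k Cgcm
      (chevalley_rel_opp (tilde_chevalley_rel K C)) ij).
  apply: (Av (fun u => rho x u = 0)).
  + exact: subspace_ker.
  + have comm (y z : presented_lie (tilde_rel C)) : rho y vac = 0 ->
        rho z vac = 0 -> rho (lie y z) vac = 0.
      by move=> y0 z0; rewrite rb // y0 z0 !(lin0 (rl _)) subr0.
    rewrite /x; elim: `|_|%N => [|N IHN]; first by rewrite rE vac_e.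
    by rewrite iterS; apply: comm => //; rewrite rE vac_e.
  + move=> k u xu; rewrite -[lower k u]/(hw_op (GenF k) u) -rE.
    have := rb (pres_pi _ (TGen (GenF k))) x u I.
    rewrite xf xu (lin0 (rl _)) sub0r.
    have -> : rho 0 u = 0.
      by have := rx (-1) 0 0 u I; rewrite scaler0 addr0 scaleN1r addNr.
    by move=> /esym/eqP; rewrite oppr_eq0 => /eqP.
- rewrite -rt // pres_pi_iter.
  set x := iter _ _ _; rewrite /=.
  have xe k : lie (pres_pi (tilde_rel C) (TGen (GenE k))) x = 0.
    exact: (serre_element_singular k Cgcm (tilde_chevalley_rel K C) ij).
  have x0 u : rho x u [::] = 0.
    rewrite /x; elim: `|_|%N u => [|N IHN] u; first by rewrite rE.
    by rewrite iterS rb // rE -[LHS]/(0 - _) IHN subr0.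
  apply/funext => w; elim: w v {Av tilde} => [//|k w IHw] v.
  rewrite -[LHS]/(hw_op (GenE k) (rho x v) w) -rE.
  have := rb (pres_pi _ (TGen (GenE k))) x v I.
  have -> : rho (lie (pres_pi (tilde_rel C) (TGen (GenE k))) x) v = 0.
    rewrite xe; have := rx (-1) 0 0 v I.
    by rewrite scaler0 addr0 scaleN1r addNr.
  by move=> /esym/subr0_eq->.
Qed.

End HighestWeight.

(** With highest weight 1 at every node, [e_i f_i] applied to the vacuum vector has value 1 at the
    empty word. *)
Lemma km_e_neq0 (K : fieldType) (n : nat) (C : 'M[int]_n) i :
  gen_cartan_matrix C -> km_e K C i <> 0.
Proof.
move=> Cgcm e0; pose wt (_ : 'I_n) : K := 1.
pose v : seq 'I_n -> K^o := vac (1 : K^o).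
have [rho [rl _ rx _ rt]] := representation_exists
  (@hw_op_linear K n C wt K^o) (vac_span_subspace C wt 1)
  (@vac_span_stable K n C wt K^o 1) (@hw_serre K n C wt K^o 1 Cgcm).
have fv : vac_span C wt 1 (lower C wt i v).
  exact: (vac_span_lower i (@vac_span_vac K n C wt K^o 1)).
have : rho (km_e K C i) (lower C wt i v) [::] = 1.
  by rewrite rt //= eqxx scale1r /word_wt big_nil subr0 scale1r add0r.
have := rx (-1) 0 0 _ fv.
rewrite e0 scaler0 addr0 scaleN1r addNr => -> /esym/eqP.
by rewrite oner_eq0.
Qed.

(** * Gradation and triangular decomposition *)

Definition wt_pair (n : nat) (p : 'I_n -> int) (g : 'rV[int]_n) : int :=
  \sum_i p i * g 0 i.

Lemma wt_pairD n (p : 'I_n -> int) : {morph wt_pair p : g g' / g + g'}.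
Proof.
by move=> g g'; rewrite -big_split; apply: eq_bigr => i _; rewrite mxE mulrDr.
Qed.

Lemma wt_pair0 n (p : 'I_n -> int) : wt_pair p 0 = 0.
Proof. by apply: big1 => i _; rewrite mxE mulr0. Qed.

Lemma wt_pairN n (p : 'I_n -> int) g : wt_pair p (- g) = - wt_pair p g.
Proof. by rewrite -sumrN; apply: eq_bigr => i _; rewrite mxE mulrN. Qed.

Lemma wt_pair_root n (p : 'I_n -> int) i : wt_pair p (simple_root i) = p i.
Proof.
rewrite /wt_pair (bigD1 i) //= mxE !eqxx mulr1 big1 ?addr0 // => j ji.
by rewrite mxE eqxx (negbTE ji) mulr0.
Qed.

Lemma wt_pair_coord n i (g : 'rV[int]_n) :
  wt_pair (fun j => (j == i)%:R) g = g 0 i.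
Proof.
rewrite /wt_pair (bigD1 i) //= eqxx mul1r big1 ?addr0 // => j /negbTE->.
by rewrite mul0r.
Qed.

Section Gradation.
Variables (K : fieldType) (n : nat) (C : 'M[int]_n).
Local Notation g := (kac_moody K C).
Local Notation e := (km_e K C).
Local Notation f := (km_f K C).
Local Notation h := (km_h K C).

Lemma km_ind (P : set g) : subspace P ->
  (forall i, P (e i)) -> (forall i, P (f i)) -> (forall i, P (h i)) ->
  (forall x y, P x -> P y -> P (lie x y)) -> forall x, P x.
Proof.
by move=> Ps Pe Pf Ph Pl; apply: presented_lie_ind => // -[].
Qed.

Definition gen_deg (p : 'I_n -> int) (x : chevalley n) : int :=
  match x with GenE i => p i | GenF i => - p i | GenH i => 0 end.

Definition km_pi (t : lie_term K (chevalley n)) : g := pres_pi (serre_rel C) t.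
Definition km_gen (x : chevalley n) : g := km_pi (TGen x).

Lemma km_pi0 : km_pi TZero = 0. Proof. by []. Qed.
Lemma km_piZ a t : km_pi (TScale a t) = a *: km_pi t.
Proof. exact: pres_piZ. Qed.
Lemma km_piL s t : km_pi (TLie s t) = lie (km_pi s) (km_pi t).
Proof. exact: pres_piL. Qed.

(** The universal property yields actions, so the derivation [D] is encoded as one: on [g * K], [x]
    sends [(y, a)] to [(lie x y + a D x, 0)]. *)
Lemma km_derivation_exists (p : 'I_n -> int) : exists D : g -> g,
  [/\ linear D, forall x y, D (lie x y) = lie (D x) y + lie x (D y)
    & forall x, D (km_gen x) = (gen_deg p x)%:~R *: km_gen x].
Proof.
pose V : lmodType K := (g * K^o)%type.
(* The identity, made opaque; it takes the second component from the module [K^o] to the scalars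
   [K]. *)
have [k [kl k1]] : exists k : K^o -> K,
    (forall a u v, k (a *: u + v) = a * k u + k v) /\ k 1 = 1 by exists id.
have k0 : k 0 = 0.
  by have := kl (-1) 0 0; rewrite scaler0 addr0 mulN1r addNr.
pose op (x : chevalley n) (v : V) : V :=
  (lie (km_gen x) v.1 + k v.2 *: ((gen_deg p x)%:~R *: km_gen x), 0).
have opl x : linear (op x).
  move=> a u v; congr pair => /=; last by rewrite scaler0 addr0.
  by rewrite lieDr lieZr kl; module K.
pose good (t : lie_term K (chevalley n)) d := forall v : V, term_act op t v
  = (lie (km_pi t) v.1 + k v.2 *: (d%:~R *: km_pi t), 0).
have goodG x : good (TGen x) (gen_deg p x) by [].
have good0 d : good TZero d.
  by move=> v; rewrite km_pi0 lie0l !scaler0 addr0.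
have goodZ a t d : good t d -> good (TScale a t) d.
  move=> td v; rewrite /= td; congr pair; last exact: scaler0.
  by rewrite km_piZ lieZl /=; module K.
have goodL s t c d : good s c -> good t d -> good (TLie s t) (c + d).
  move=> sc td v; rewrite /= !(sc, td) /=; congr pair; last exact: subr0.
  rewrite km_piL.
  rewrite k0 !scale0r !addr0 !lieDr !lieZr -[lie (lie _ _) _]lie_lieC intrD.
  by rewrite [lie (km_pi t) (km_pi s)]lieC /=; module K.
have good_iter s t c d N : good s c -> good t d ->
    good (iter N (TLie s) t) (c *+ N + d).
  move=> sc td; elim: N => [|N IHN]; first by rewrite mulr0n add0r.
  by rewrite mulrS -addrA; apply: goodL.
(* Both sides of each relation share a degree, as [TZero] is homogeneous of every degree. *)
have rel s t : serre_rel C s t -> exists d, good s d /\ good t d.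
  case=> [i j|i j|i j|i|i j ij|i j ij|i j ij].
  - by exists 0; split=> //; rewrite -[0]addr0; exact: goodL.
  - by exists (p j); split; [rewrite -[p j]add0r; exact: goodL|exact: goodZ].
  - by exists (- p j); split; [rewrite -[- p j]add0r; exact: goodL|exact: goodZ].
  - by exists 0; split=> //; rewrite -(subrr (p i)); exact: goodL.
  - by exists (p i - p j); split=> //; exact: goodL.
  - by exists (p i *+ `|1 - C j i|%N + p j); split=> //; exact: good_iter.
  - by exists (- p i *+ `|1 - C j i|%N - p j); split=> //; exact: good_iter.
have [|rho [rl _ rx rb rt]] := representation_exists (R := serre_rel C) opl
  (A := setT) (conj I (fun _ _ _ _ _ => I)) (fun _ _ _ => I).
  move=> s t st v _; have [d [sd td]] := rel s t st.
  by rewrite sd td /km_pi; have /cong_rel/pres_piP-> := st.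
pose D x := (rho x (0, 1)).1.
have rhoE x v : rho x v = (lie x v.1 + k v.2 *: D x, 0).
  suff [D0 ->] : (rho x (0, 1)).2 = 0 /\
    forall v, rho x v = (lie x v.1 + k v.2 *: D x, 0) by [].
  move: x; apply: presented_lie_ind => [|x|x y [x0 xE] [y0 yE]].
  - split=> [|a x y [x0 xE] [y0 yE]].
      have r0 v' : rho 0 v' = 0.
        by have := rx (-1) 0 0 v' I; rewrite scaler0 addr0 scaleN1r addNr.
      rewrite /D !r0; split=> // v'; rewrite r0 lie0l scaler0 addr0 //.
    split=> [|v']; first by rewrite rx //= x0 y0 scaler0 addr0.
    have -> : D (a *: x + y) = a *: D x + D y by rewrite /D rx.
    rewrite rx // xE yE lieDl lieZl; congr pair; last by rewrite /= scaler0 addr0.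
    by rewrite /=; module K.
  - by rewrite /D !rt //= lie0r add0r k1 scale1r; split=> // v'; rewrite rt.
  - have DE : D (lie x y) = lie x (D y) - lie y (D x).
      by rewrite /D rb // yE !xE yE /= !lie0r !k0 !k1; module K.
    split=> [|v']; first by rewrite rb // yE !xE yE /= subrr.
    rewrite DE rb // yE !xE yE; congr pair; last exact: subr0.
    rewrite !k0 !scale0r !addr0 !lieDr !lieZr -[lie (lie _ _) _]lie_lieC /=.
    by module K.
exists D; split=> [a x y|x y|x].
- by rewrite /D rx.
- rewrite /D rb // !rhoE /= !k0 !k1 !lie0r !scale0r !scale1r !add0r !addr0.
  by rewrite [lie (D x) y]lieC addrC.
- by rewrite /D rt //= lie0r add0r k1 scale1r.
Qed.

Definition km_deg (p : 'I_n -> int) : g -> g := sval (cid (km_derivation_exists p)).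

Lemma km_deg_linear p : linear (km_deg p).
Proof. by rewrite /km_deg; case: cid => D []. Qed.

Lemma km_deg_lie p x y :
  km_deg p (lie x y) = lie (km_deg p x) y + lie x (km_deg p y).
Proof. by rewrite /km_deg; case: cid => D []. Qed.

Lemma km_deg_gen p x : km_deg p (km_gen x) = (gen_deg p x)%:~R *: km_gen x.
Proof. by rewrite /km_deg; case: cid => D []. Qed.

(** The gradation by the root lattice itself, tested by all degree derivations at once. The [h_i]
    see only [c *m C]. *)
Definition homog (c : 'rV[int]_n) : set g :=
  fun x => forall p, eigen (km_deg p) (wt_pair p c) x.

Lemma homog_subspace c : subspace (homog c).
Proof.
split=> [p|a x y hx hy p].
  by case: (eigen_subspace (km_deg_linear p) (wt_pair p c)).
exact: (eigen_subspace (km_deg_linear p) (wt_pair p c)).2.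
Qed.

Lemma eigen_lie p k l x y : eigen (km_deg p) k x -> eigen (km_deg p) l y ->
  eigen (km_deg p) (k + l) (lie x y).
Proof.
move=> xk yl; rewrite /eigen km_deg_lie xk yl lieZl lieZr intrD.
by module K.
Qed.

Lemma homog_lie c d x y : homog c x -> homog d y -> homog (c + d) (lie x y).
Proof.
by move=> hx hy p; rewrite wt_pairD; exact: eigen_lie.
Qed.

Lemma homog_e i : homog (simple_root i) (e i).
Proof. by move=> p; rewrite /eigen wt_pair_root; exact: km_deg_gen. Qed.

Lemma homog_f i : homog (- simple_root i) (f i).
Proof. by move=> p; rewrite /eigen wt_pairN wt_pair_root; exact: km_deg_gen. Qed.

Lemma homog_h i : homog 0 (h i).
Proof. by move=> p; rewrite /eigen wt_pair0; exact: km_deg_gen. Qed.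

End Gradation.

(** * Right-normed monomials in the generators *)

Section Monomials.
Variables (K : fieldType) (n : nat) (C : 'M[int]_n) (L : lieAlgType K).
Implicit Types E F H : 'I_n -> L.

Inductive lmon E : 'rV[int]_n -> L -> Prop :=
| lmon1 i : lmon E (simple_root i) (E i)
| lmonS i c x of lmon E c x : lmon E (simple_root i + c) (lie (E i) x).

Lemma simple_root_ge0 (i j : 'I_n) : 0 <= simple_root i 0 j :> int.
Proof. by rewrite mxE. Qed.

Lemma lmon_ge0 E c x j : lmon E c x -> 0 <= c 0 j.
Proof.
elim=> [i|i {}c {}x _ IH]; first exact: simple_root_ge0.
by rewrite mxE addr_ge0 // simple_root_ge0.
Qed.

Lemma lmon_gt0 E c x : lmon E c x -> exists j, 0 < c 0 j.
Proof.
case=> [i|i {}c {}x cx]; exists i; first by rewrite mxE !eqxx.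
by rewrite mxE ltr_pwDl ?(lmon_ge0 _ cx) // mxE !eqxx.
Qed.

Lemma lmon_root E c x i : lmon E c x -> c = simple_root i -> x = E i.
Proof.
case=> [j /rowP/(_ j)|j {}c {}x cx /rowP ji].
  by rewrite !mxE !eqxx /=; case: eqVneq => [->|].
have [k k0] := lmon_gt0 cx.
have jk (l : 'I_n) : c 0 l + (if l == j then 1 else 0) = if l == i then 1 else 0.
  by have := ji l; rewrite !mxE eqxx addrC /=; do 2!case: eqP.
have cj : 0 <= c 0 j by exact: lmon_ge0 cx.
move: k0 cj (jk k) (jk j); rewrite eqxx.
case: (eqVneq k j) => [->|kj]; first by case: (j == i); lia.
case: (eqVneq j i) kj => [->|_ _]; last by lia.
by case: (k == i) => //; lia.
Qed.

(** Moving [F i] inwards replaces one factor [E i] by [H i], and [H i] multiplies the monomial to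
    its right by a scalar; if [E i] is the innermost factor, [H i] remains and the next bracket with
    some [E j] gives a multiple of [E j]. *)
Lemma lie_lmon E F H i c x : chevalley_rel C E F H -> lmon E c x ->
  span (fun y => (exists c, lmon E c y) \/ exists j, y = H j) (lie (F i) x).
Proof.
set G := (G in span G); have As := span_subspace G.
move=> [HH HE HF EF]; elim=> [j|j {}c {}x cx IH].
  rewrite lieC EF; apply: subspaceN; first exact: As.
  case: eqP => _; last exact: span0.
  by apply: span_gen; right; exists j.
rewrite lie_lie; apply: subspaceD; first exact: As.
  rewrite [lie (F i) _]lieC EF; case: eqP => _; last first.
    by rewrite oppr0 lie0l; exact: span0.
  rewrite lieNl; apply: subspaceN; first exact: As.
  elim: cx {IH} => [k|k {}c {}x cx IH].
    rewrite HE; apply: (subspaceZ _ As); apply: span_gen; left.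
    by exists (simple_root k); constructor.
  rewrite lie_lie HE lieZl; apply: (subspaceD As).
    apply: (subspaceZ _ As); apply: span_gen; left.
    by exists (simple_root k + c); constructor.
  suff [a ->] : exists a, lie (H j) x = a *: x.
    rewrite lieZr; apply: (subspaceZ _ As); apply: span_gen; left.
    by exists (simple_root k + c); constructor.
  elim: cx {IH} => [l|l {}c {}x cx [a IH]]; first by exists (C l j)%:~R; rewrite HE.
  by exists ((C l j)%:~R + a); rewrite lie_lie HE IH lieZl lieZr scalerDl.
move: IH; apply: (@span_sub _ _ _ (fun y => span G (lie (E j) y))).
  exact: (subspace_preim (lie_linear (E j)) As).
move=> y [[d dy]|[k ->]].
  by apply: span_gen; left; exists (simple_root j + d); constructor.
rewrite lieC HE; apply: subspaceN; first exact: As.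
apply: subspaceZ; first exact: As.
by apply: span_gen; left; exists (simple_root j); constructor.
Qed.

End Monomials.

(** * Local nilpotency of the adjoint action *)

Section AdNilpotent.
Variables (K : fieldType) (L : lieAlgType K).
Implicit Types x y z : L.

Definition ad_nil z x := exists N, iter N (lie z) x = 0.

Lemma iter_lie0 z N : iter N (lie z) (0 : L) = 0.
Proof. by elim: N => //= N ->; rewrite lie0r. Qed.

Lemma iter_lie_linear z N : linear (iter N (lie z)).
Proof. by elim: N => [//|N IHN] a x y; rewrite !iterS IHN lieDr lieZr. Qed.

Lemma iter_lie_ge z x N M : (N <= M)%N ->
  iter N (lie z) x = 0 -> iter M (lie z) x = 0.
Proof. by move=> /subnK<- xN; rewrite iterD xN iter_lie0. Qed.

Lemma ad_nil_subspace z : subspace (ad_nil z).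
Proof.
split=> [|a x y [N xN] [M yM]]; first by exists 0%N.
exists (maxn N M); rewrite iter_lie_linear (iter_lie_ge _ xN) ?leq_maxl //.
by rewrite (iter_lie_ge _ yM) ?leq_maxr // scaler0 addr0.
Qed.

Lemma ad_nil_lie z x y : ad_nil z x -> ad_nil z y -> ad_nil z (lie x y).
Proof.
move=> [N xN] [M yM]; exists (N + M)%N.
move NM: (N + M)%N => k; elim: k N M x y NM xN yM => [|k IHk] N M x y NM xN yM.
  by case: N NM xN => //= _ ->; rewrite lie0l.
rewrite iterSr lie_lie (linD (iter_lie_linear z _)).
case: N NM xN => [_ /= ->|N NM xN].
  by rewrite lie0r !lie0l iter_lie0 addr0.
rewrite (IHk N M) ?add0r //; [|by lia|by rewrite -iterSr].
case: M NM yM => [_ /= ->|M NM yM]; first by rewrite !lie0r iter_lie0.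
by rewrite (IHk N.+1 M) //; [lia|rewrite -iterSr].
Qed.

Lemma chevalley_ad_nil n (C : 'M[int]_n) (E F H : 'I_n -> L) i :
  gen_cartan_matrix C -> chevalley_rel C E F H ->
  (forall j, i != j -> iter `|1 - C j i|%N (lie (E i)) (E j) = 0) ->
  forall j, [/\ ad_nil (E i) (E j), ad_nil (E i) (F j) & ad_nil (E i) (H j)].
Proof.
move=> [Cd _ _] [HH HE HF EF] SE j.
have EH k : iter 2 (lie (E i)) (H k) = 0.
  by rewrite /= [lie (E i) (H k)]lieC HE lieNr lieZr liexx scaler0 oppr0.
split; last by exists 2; exact: EH.
  have [<-|ij] := eqVneq i j; first by exists 1%N; exact: liexx.
  by exists `|1 - C j i|%N; exact: SE.
exists 3; rewrite iterSr EF; case: eqP => _; [exact: EH|exact: iter_lie0].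
Qed.

End AdNilpotent.

(** * Triangular decomposition and weight spaces *)

Section Triangular.
Variables (K : fieldType) (charK0 : [pchar K] =i pred0).
Variables (n : nat) (C : 'M[int]_n).
Local Notation g := (kac_moody K C).
Local Notation e := (km_e K C).
Local Notation f := (km_f K C).
Local Notation h := (km_h K C).
Implicit Types (c : 'rV[int]_n) (x y : g).
Let crel := km_chevalley_rel K C.

Lemma derivation_eq (D D' : g -> g) : linear D -> linear D' ->
  (forall x y, D (lie x y) = lie (D x) y + lie x (D y)) ->
  (forall x y, D' (lie x y) = lie (D' x) y + lie x (D' y)) ->
  (forall s, D (km_gen K C s) = D' (km_gen K C s)) -> D =1 D'.
Proof.
move=> Dl D'l Dd D'd Dg; apply: presented_lie_ind => [|x|x y Dx Dy].
- split=> [|a x y Dx Dy]; first by rewrite !lin0.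
  by rewrite Dl D'l Dx Dy.
- exact: Dg.
- by rewrite Dd D'd Dx Dy.
Qed.

Lemma lie_h_deg i x : lie (h i) x = km_deg (fun k => C k i) x.
Proof.
move: x; apply: derivation_eq; [exact: lie_linear|exact: km_deg_linear| | |].
- by move=> x y; rewrite lie_lie.
- by move=> x y; rewrite km_deg_lie.
- move=> x; rewrite km_deg_gen; case: x => k /=; case: crel => HH HE HF _.
  + exact: HE.
  + by rewrite mulrNz; exact: HF.
  + by rewrite scale0r; exact: HH.
Qed.

Lemma lie_h_homog i c x : homog c x -> lie (h i) x = ((c *m C) 0 i)%:~R *: x.
Proof.
move=> cx; rewrite lie_h_deg cx; congr (_%:~R *: _); rewrite mxE.
by apply: eq_bigr => k _; rewrite mulrC.
Qed.

Lemma km_deg_coord p x :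
  km_deg p x = \sum_i (p i)%:~R *: km_deg (fun j => (j == i)%:R) x :> g.
Proof.
move: x; apply: (@derivation_eq (km_deg p)
  (fun x => \sum_i (p i)%:~R *: km_deg (fun j => (j == i)%:R) x)).
- exact: km_deg_linear.
- move=> a x y; rewrite scaler_sumr -big_split; apply: eq_bigr => i _ /=.
  by rewrite km_deg_linear; module K.
- by move=> x y; rewrite km_deg_lie.
- move=> x y; rewrite (lin_sum (lie_linearl y)) (lin_sum (lie_linear x)).
  rewrite -big_split; apply: eq_bigr => i _.
  by rewrite /= km_deg_lie lieZl lieZr scalerDr.
- move=> x; rewrite km_deg_gen; under eq_bigr do rewrite km_deg_gen scalerA.
  rewrite -scaler_suml; congr (_ *: _); case: x => k /=.
  + rewrite (bigD1 k) //= eqxx mulr1 big1 ?addr0 // => i.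
    by rewrite eq_sym => /negbTE->; rewrite mulr0.
  + rewrite (bigD1 k) //= eqxx mulrN1 mulrNz big1 ?addr0 // => i.
    by rewrite eq_sym => /negbTE->; rewrite oppr0 mulr0.
  + by rewrite big1 // => i _; rewrite mulr0.
Qed.

Lemma homog_coord c (x : g) :
  (forall i, eigen (km_deg (fun j => (j == i)%:R)) (c 0 i) x) -> homog c x.
Proof.
move=> xc p; rewrite /eigen km_deg_coord /wt_pair rmorph_sum scaler_suml /=.
by apply: eq_bigr => i _; rewrite xc scalerA intrM.
Qed.

(** By [C *m A = d], [d] times a coordinate degree is an integer combination of the [ad h_i]. So the
    weight of [x] determines its degree in characteristic 0. *)
Lemma root_space_homog (A : 'M[int]_n) d : C *m A = d%:M -> d != 0 ->
  forall c x, root_space C c x <-> homog c (x : g).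
Proof.
move=> CA d0 c x; split=> [cx|cx i]; last exact: lie_h_homog.
apply: homog_coord => l; have dK : d%:~R != 0 :> K by rewrite intr_eq00.
apply: (scalerI dK); pose D y : g := d%:~R *: km_deg (fun j => (j == l)%:R) y.
pose D' y : g := \sum_i (A i l)%:~R *: lie (h i) y.
have DD' : D =1 D'.
  apply: derivation_eq => [a y z|a y z|y z|y z|y].
  - by rewrite /D km_deg_linear; module K.
  - rewrite /D' scaler_sumr -big_split; apply: eq_bigr => i _ /=.
    by rewrite lieDr lieZr; module K.
  - by rewrite /D km_deg_lie lieZl lieZr scalerDr.
  - rewrite /D' (lin_sum (lie_linearl z)) (lin_sum (lie_linear y)) -big_split.
    by apply: eq_bigr => i _; rewrite /= lie_lie lieZl lieZr scalerDr.
  - rewrite /D /D' km_deg_gen; under eq_bigr do rewrite lie_h_deg km_deg_gen scalerA -intrM.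
    rewrite -scaler_suml scalerA -intrM -rmorph_sum; congr (_%:~R *: _).
    have /matrixP CAl := CA; case: y => k /=.
    + by have := CAl k l; rewrite !mxE mulr_natr => <-; apply: eq_bigr => i _; rewrite mulrC.
    + have := CAl k l; rewrite !mxE mulrN mulr_natr => <-; rewrite -sumrN.
      by apply: eq_bigr => i _; rewrite mulrN mulrC.
    + by rewrite mulr0 big1 // => i _; rewrite mulr0.
have -> : d%:~R *: ((c 0 l)%:~R *: x) = D' x.
  rewrite /D'; under eq_bigr do rewrite cx scalerA -intrM.
  rewrite -scaler_suml scalerA -intrM -rmorph_sum; congr (_%:~R *: _).
  have /rowP/(_ l) : c *m (C *m A) = c *m d%:M by rewrite CA.
  rewrite mulmxA mul_mx_scalar !mxE => <-.
  by apply: eq_bigr => i _; rewrite mulrC.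
exact: DD'.
Qed.

Inductive mono : 'rV[int]_n -> g -> Prop :=
| mono_e c x of lmon e c x : mono c x
| mono_f c x of lmon f c x : mono (- c) x
| mono_h i : mono 0 (h i).

Lemma mono_homog c x : mono c x -> homog c x.
Proof.
case=> {c x} [c x|c x|i]; last exact: homog_h.
- by elim=> [i|i {}c {}x _]; [exact: homog_e|apply: homog_lie; exact: homog_e].
- elim=> [i|i {}c {}x _]; first exact: homog_f.
  by rewrite opprD; apply: homog_lie; exact: homog_f.
Qed.

Lemma mono_stable i c x : mono c x ->
  [/\ span (fun y => exists d, mono d y) (lie (e i) x),
      span (fun y => exists d, mono d y) (lie (f i) x)
    & span (fun y => exists d, mono d y) (lie (h i) x)].
Proof.
set G := (G in span G) => cx; have Gs := span_subspace G.
have mG d y : mono d y -> span G y by move=> dy; apply: span_gen; exists d.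
have [_ HE HF _] := crel.
split; last by rewrite (lie_h_homog i (mono_homog cx)); exact: (subspaceZ _ Gs (mG _ _ cx)).
- case: cx => [d y dy|d y dy|j].
  + exact: (mG _ _ (mono_e (lmonS i dy))).
  + apply: (span_sub Gs _ (lie_lmon i (chevalley_rel_opp crel) dy)).
    move=> z [[b bz]|[j ->]]; first exact: (mG _ _ (mono_f bz)).
    exact: (subspaceN Gs (mG _ _ (mono_h j))).
  + rewrite lieC HE; apply: (subspaceN Gs (subspaceZ _ Gs _)).
    exact: (mG _ _ (mono_e (lmon1 _ i))).
- case: cx => [d y dy|d y dy|j].
  + apply: (span_sub Gs _ (lie_lmon i crel dy)).
    move=> z [[b bz]|[j ->]]; first exact: (mG _ _ (mono_e bz)).
    exact: (mG _ _ (mono_h j)).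
  + exact: (mG _ _ (mono_f (lmonS i dy))).
  + rewrite lieC HF; apply: (subspaceN Gs (subspaceZ _ Gs _)).
    exact: (mG _ _ (mono_f (lmon1 _ i))).
Qed.

Lemma km_span x : span (fun y => exists c, mono c y) x.
Proof.
set G := (G in span G); have Gs := span_subspace G.
have mG d y : mono d y -> span G y by move=> dy; apply: span_gen; exists d.
have stab (z : g) : (forall d y, mono d y -> span G (lie z y)) ->
    forall y, span G y -> span G (lie z y).
  move=> zG; apply: (@span_sub _ _ _ (fun y => span G (lie z y))).
    exact: (subspace_preim (lie_linear z) Gs).
  by move=> y [d dy]; exact: zG dy.
(* The elements of the span whose bracket preserves the span form a subalgebra, and it contains the
   generators. *)
suff [] : span G x /\ forall y, span G y -> span G (lie x y) by [].
move: x; apply: km_ind => [|i|i|i|x y [xG xl] [yG yl]].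
- split=> [|a x y [xG xl] [yG yl]].
    by split=> [|y _]; rewrite ?lie0l; exact: span0.
  split=> [|z zG]; first exact: Gs.2.
  by rewrite lieDl lieZl; apply: Gs.2; [exact: xl|exact: yl].
- split; first exact: (mG _ _ (mono_e (lmon1 _ i))).
  by apply: stab => d y /(mono_stable i)[].
- split; first exact: (mG _ _ (mono_f (lmon1 _ i))).
  by apply: stab => d y /(mono_stable i)[].
- split; first exact: (mG _ _ (mono_h i)).
  by apply: stab => d y /(mono_stable i)[].
- split=> [|z zG]; first exact: xl.
  by rewrite -lie_lieC; exact: (subspaceB Gs (xl _ (yl _ zG)) (yl _ (xl _ zG))).
Qed.

Lemma km_deg_span p x : span (fun y => exists k, eigen (km_deg p) k y) (x : g).
Proof.
apply: span_mono (km_span x) => y [c /mono_homog cy].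
by exists (wt_pair p c); exact: cy.
Qed.

(** Project onto the eigenspaces of the coordinate degrees one coordinate at a time; each projection
    discards the monomials whose degree differs from [c] there. *)
Lemma homog_span c x : homog c x -> span (mono c) x.
Proof.
move=> cx; suff : span (fun y => exists2 d, mono d y &
    forall i, i \in enum 'I_n -> d 0 i = c 0 i) x.
  apply: span_mono => y [d dy dc]; suff <- : d = c by [].
  by apply/rowP => i; rewrite dc // mem_enum.
elim: (enum 'I_n) => [|i s IHs].
  by apply: span_mono (km_span x) => y [d dy]; exists d.
have [p pl pE] := eigen_proj charK0 (km_deg_linear (fun j => (j == i)%:R))
  (@km_deg_span (fun j => (j == i)%:R)) (c 0 i).
have px : p x = x by rewrite (pE _ _ (cx _)) wt_pair_coord eqxx.
rewrite -px; move: IHs; apply: (@span_sub _ _ _ (fun x => span _ (p x))).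
  exact: (subspace_preim pl (span_subspace _)).
move=> y [d dy ds]; rewrite (pE _ _ (mono_homog dy _)) wt_pair_coord.
case: eqP => [di|_]; last exact: span0.
apply: span_gen; exists d => // j; rewrite inE => /orP[/eqP->//|]; exact: ds.
Qed.

Lemma mono_case c x : mono c x ->
  [\/ lmon e c x, lmon f (- c) x | c = 0 /\ exists i, x = h i].
Proof.
case=> [d y dy|d y dy|i]; first by constructor 1.
  by constructor 2; rewrite opprK.
by constructor 3; split=> //; exists i.
Qed.

Lemma homog_pos c x i : homog c x -> 0 < c 0 i -> span (lmon e c) x.
Proof.
move=> /homog_span cx c0; apply: span_mono cx => y /mono_case[//|cy|[c00 _]].
  by have := lmon_ge0 i cy; rewrite mxE oppr_ge0 leNgt c0.
by rewrite c00 mxE ltxx in c0.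
Qed.

Lemma homog_neg c x i : homog c x -> c 0 i < 0 -> span (lmon f (- c)) x.
Proof.
move=> /homog_span cx c0; apply: span_mono cx => y /mono_case[cy|//|[c00 _]].
  by have := lmon_ge0 i cy; rewrite leNgt c0.
by rewrite c00 mxE ltxx in c0.
Qed.

Lemma homog_mixed c x i j : homog c x -> 0 < c 0 i -> c 0 j < 0 -> x = 0.
Proof.
move=> cx ci cj; case: (homog_pos cx ci) => // a y z cy _.
by have := lmon_ge0 j cy; rewrite leNgt cj.
Qed.

Lemma homog0_span x : homog 0 x -> span (fun y => exists i, y = h i) x.
Proof.
move=> /homog_span; apply: span_mono => y /mono_case[cy|cy|[]//].
  by have [i] := lmon_gt0 cy; rewrite mxE ltxx.
by have [i] := lmon_gt0 cy; rewrite oppr0 mxE ltxx.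
Qed.

Lemma homog_simple_root i x : homog (simple_root i) x -> exists a, x = a *: e i.
Proof.
move=> cx; have : span (lmon e (simple_root i)) x.
  by apply: (homog_pos (i := i) cx); rewrite mxE !eqxx.
elim=> [|a y z cy _ [b ->]]; first by exists 0; rewrite scale0r.
by exists (a + b); rewrite (lmon_root cy erefl) scalerDl.
Qed.

Lemma homog_simple_rootN i x : homog (- simple_root i) x -> exists a, x = a *: f i.
Proof.
move=> cx; have : span (lmon f (- - simple_root i)) x.
  by apply: (homog_neg (i := i) cx); rewrite !mxE !eqxx.
elim=> [|a y z cy _ [b ->]]; first by exists 0; rewrite scale0r.
by exists (a + b); rewrite (lmon_root cy (opprK _)) scalerDl.
Qed.

Lemma homog_sign c x : homog c x -> x <> 0 ->
  [\/ c = 0, (forall i, 0 <= c 0 i) /\ exists i, 0 < c 0 i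
    | (forall i, c 0 i <= 0) /\ exists i, c 0 i < 0].
Proof.
move=> /homog_span; elim=> [//|a y z /mono_case yc _ _ _]; case: yc => [yc|yc|[]].
- by constructor 2; split=> [i|]; [exact: lmon_ge0 yc|exact: lmon_gt0 yc].
- constructor 3; split=> [i|].
    by have := lmon_ge0 i yc; rewrite mxE oppr_ge0.
  by have [i] := lmon_gt0 yc; rewrite mxE oppr_gt0; exists i.
- by constructor 1.
Qed.

Hypothesis Cgcm : gen_cartan_matrix C.

Lemma km_ad_nil (z : g) :
  (forall j, [/\ ad_nil z (e j), ad_nil z (f j) & ad_nil z (h j)]) ->
  forall x, ad_nil z x.
Proof.
move=> zn; apply: km_ind; [exact: ad_nil_subspace|by move=> j; case: (zn j)..|].
by move=> x y; exact: ad_nil_lie.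
Qed.

Lemma km_ad_nil_e i x : ad_nil (e i) x.
Proof.
move: x; apply: km_ad_nil => j.
exact: (chevalley_ad_nil Cgcm crel (@km_serre_e K n C i)).
Qed.

Lemma km_ad_nil_f i x : ad_nil (f i) x.
Proof.
move: x; apply: km_ad_nil => j.
have [nf ne nh] :=
  chevalley_ad_nil Cgcm (chevalley_rel_opp crel) (@km_serre_f K n C i) j.
split=> //; rewrite -[h j]opprK; exact: subspaceN (ad_nil_subspace _) nh.
Qed.

End Triangular.

(** * The cobracket and ideals meeting the Cartan subalgebra trivially *)

Section Bilinear.
Variables (K : fieldType) (L : lieAlgType K).
Implicit Types (B : L -> L -> L) (x y z u v : L).

Definition bilin B := (forall u, linear (B u)) /\ forall v, linear (B^~ v).

(** A tensor in the square of [L] is represented by its values on bilinear maps [B] into [L]. This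
    is the right action on such maps dual to the action of [x] on tensors; a left action needs the
    opposite sign. *)
Definition bil_act B x : L -> L -> L := fun u v => B (lie x u) v + B u (lie x v).

Lemma bilin_subspace : subspace bilin.
Proof.
split=> [|a B B' [Bl Br] [B'l B'r]].
  by split=> u b v w; rewrite /= -[RHS]/(b *: 0 + 0) scaler0 addr0.
split=> u b v w; rewrite -[LHS]/(a *: _ + _) -[RHS]/(b *: (a *: _ + _) + (a *: _ + _)).
  by rewrite Bl B'l; module K.
by rewrite (Br u) (B'r u); module K.
Qed.

Lemma bil_act_bilin B x : bilin B -> bilin (bil_act B x).
Proof.
move=> [Bl Br]; split=> u a v w; rewrite /bil_act.
  by rewrite lieDr lieZr !Bl; module K.
by rewrite lieDr lieZr (Br u) (Br (lie x u)); module K.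
Qed.

Lemma bil_act_linear x : linear (bil_act^~ x).
Proof.
move=> a B B'; apply/funext => u; apply/funext => v; rewrite /bil_act.
rewrite -[LHS]/((a *: B (lie x u) v + B' (lie x u) v)
  + (a *: B u (lie x v) + B' u (lie x v))).
rewrite -[RHS]/(a *: (B (lie x u) v + B u (lie x v))
  + (B' (lie x u) v + B' u (lie x v))).
by module K.
Qed.

Lemma bil_act_linearr B : bilin B -> linear (bil_act B).
Proof.
move=> [Bl Br] a x y; apply/funext => u; apply/funext => v.
rewrite -[RHS]/(a *: (B (lie x u) v + B u (lie x v))
  + (B (lie y u) v + B u (lie y v))).
by rewrite /bil_act !lieDl !lieZl Bl (Br v); module K.
Qed.

Lemma bil_act_lie B x y : bilin B ->
  bil_act B (lie x y) = bil_act (bil_act B x) y - bil_act (bil_act B y) x.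
Proof.
move=> [Bl Br]; apply/funext => u; apply/funext => v.
rewrite -[RHS]/((B (lie x (lie y u)) v + B (lie y u) (lie x v)
     + (B (lie x u) (lie y v) + B u (lie x (lie y v))))
   - (B (lie y (lie x u)) v + B (lie x u) (lie y v)
     + (B (lie y u) (lie x v) + B u (lie y (lie x v))))).
rewrite /bil_act -!lie_lieC (linB (Bl u)).
have -> : B (lie x (lie y u) - lie y (lie x u)) v
    = B (lie x (lie y u)) v - B (lie y (lie x u)) v by exact: linB (Br v) _ _.
by module K.
Qed.

Definition wedge x y B : L := B x y - B y x.

Lemma wedge_linear x y : linear (wedge x y).
Proof.
move=> a B B'; rewrite /wedge.
by rewrite -[LHS]/((a *: B x y + B' x y) - (a *: B y x + B' y x)); module K.
Qed.

End Bilinear.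

(** * Existence of the cobracket *)

Section Cobracket.
Variables (K : fieldType) (n : nat) (C : 'M[int]_n).
Hypotheses (Cgcm : gen_cartan_matrix C) (Csym : C^T = C).
Local Notation g := (kac_moody K C).
Local Notation e := (km_e K C).
Local Notation f := (km_f K C).
Local Notation h := (km_h K C).
Implicit Types (x y z : g) (B : g -> g -> g).
Let crel := km_chevalley_rel K C.

Definition cob_gen (s : chevalley n) : (g -> g -> g) -> g :=
  match s with
  | GenE i => wedge (h i) (e i)
  | GenF i => wedge (h i) (f i)
  | GenH i => fun=> 0
  end.

Lemma cob_gen_linear s : linear (cob_gen s).
Proof.
case: s => i; do ?exact: wedge_linear.
by move=> a B B'; rewrite /= scaler0 addr0.
Qed.

Local Notation V := ((g -> g -> g) * g)%type.

Definition cob_op (s : chevalley n) (v : V) : V :=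
  (- bil_act v.1 (km_gen K C s), cob_gen s v.1).

Lemma cob_op_linear s : linear (cob_op s).
Proof.
move=> a v w; congr pair; last exact: cob_gen_linear.
by rewrite /= bil_act_linear opprD scalerN.
Qed.

Definition cob_dom : set V := fun v => bilin v.1.

Lemma cob_dom_subspace : subspace cob_dom.
Proof. by have [b0 bD] := bilin_subspace g; split=> // a v w; exact: bD. Qed.

Lemma cob_op_stable s v : cob_dom v -> cob_dom (cob_op s v).
Proof.
by move=> vb; apply: subspaceN; [exact: bilin_subspace|exact: bil_act_bilin].
Qed.

(* A cocycle with values in [M] is an affine representation on [M] plus a line;
   [cob_op] is dual to the one of the cobracket, whose value [d] at a term [t] is
   seen as a functional on the bilinear maps [B]. *)
Definition cob_term (t : lie_term K (chevalley n)) (d : (g -> g -> g) -> g) :=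
  forall v, cob_dom v -> term_act cob_op t v = (- bil_act v.1 (km_pi C t), d v.1).

Lemma cob_term_gen s : cob_term (TGen s) (cob_gen s). Proof. by []. Qed.

Lemma cob_term0 : cob_term TZero (fun=> 0).
Proof.
move=> v vb; congr pair; rewrite km_pi0 (lin0 (bil_act_linearr vb)).
by rewrite oppr0.
Qed.

Lemma cob_termZ a t d : cob_term t d -> cob_term (TScale a t) (fun B => a *: d B).
Proof.
move=> td v vb; rewrite /= td //; congr pair.
by rewrite km_piZ (linZ (bil_act_linearr vb)) scalerN.
Qed.

Lemma cob_termL s t d d' : cob_term s d -> cob_term t d' ->
  cob_term (TLie s t) (fun B => d' (bil_act B (km_pi C s)) - d (bil_act B (km_pi C t))).
Proof.
move=> sd td' v vb.
have opN r d0 B : cob_term r d0 -> bilin B -> d0 (- B) = - d0 B.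
  move=> rd Bb; have nB := subspaceN (bilin_subspace g) Bb.
  have := rd (- B, 0) nB.
  have -> : (- B, 0) = - (B, 0) :> V by congr pair; rewrite oppr0.
  rewrite (linN (term_act_linear cob_op_linear _)) rd //.
  by move=> /(congr1 snd) /= ->.
have bN r := subspaceN (bilin_subspace g) (bil_act_bilin r vb).
rewrite /= !(sd, td') //=; [congr pair|exact: bN|exact: bN].
  rewrite km_piL bil_act_lie // !(linN (bil_act_linear _)) !opprK opprB.
  by rewrite addrC.
rewrite (opN _ _ _ sd (bil_act_bilin _ vb)) (opN _ _ _ td' (bil_act_bilin _ vb)).
by rewrite /= opprK addrC.
Qed.

(** Along the string [u N = ad(E_i)^N E_j] the cobracket is, up to [q], [(N H_i + H_j) /\ u N + c N
    (E_i /\ u N.-1)]. At the Serre exponent [c] vanishes, and the first term is 0 wherever the Serre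
    relation holds. The factor [q] is 1 for the [e]'s and -1 for the [f]'s, whose Cartan elements
    are the [- h i]. *)
Lemma cob_term_iter (E F H : 'I_n -> g) (tE : 'I_n -> chevalley n) (q : K) :
  chevalley_rel C E F H -> (forall i, km_gen K C (tE i) = E i) ->
  (forall i B, bilin B -> cob_gen (tE i) B = q *: wedge (H i) (E i) B) ->
  forall i j, i != j ->
  cob_term (iter `|1 - C j i|%N (TLie (TGen (tE i))) (TGen (tE j)))
    (fun B => q *: wedge (`|1 - C j i|%N%:R *: H i + H j)
                (iter `|1 - C j i|%N (lie (E i)) (E j)) B).
Proof.
move=> [HH HE HF EF] tEE tEd i j ij; have [Cd Cn _] := Cgcm.
have CS k l : C k l = C l k by rewrite -[in LHS]Csym mxE.
pose u N := iter N (lie (E i)) (E j).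
pose t N : lie_term K (chevalley n) := iter N (TLie (TGen (tE i))) (TGen (tE j)).
have tu N : km_pi C (t N) = u N.
  elim: N => [|N IHN]; first exact: tEE.
  by rewrite /t iterS km_piL -/(t N) IHN; congr lie; exact: tEE.
have Hu k N : lie (H k) (u N) = ((C i k) *+ N + C j k)%:~R *: u N.
  elim: N => [|N IHN]; first by rewrite mulr0n add0r HE.
  rewrite /u iterS lie_lie HE -/(u N) IHN lieZl lieZr mulrS -addrA intrD.
  by rewrite -scalerDl !intrD.
(* Solves [c N.+1 = c N - 2 (2 N + C j i)] with [c 0 = 0]: one half of the decrement is due to [Hw],
   the other to [uH]. *)
pose c N : K := - (2 * N%:R * ((C j i)%:~R + N%:R - 1)).
(* At [N = 0] the vector [u N.-1] is only a default, harmless because [c 0 = 0]. *)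
have cu N : c N *: lie (E i) (u N.-1) = c N *: u N.
  by case: N => [|N] //=; rewrite /c mulr0 mul0r oppr0 !scale0r.
have step N : cob_term (t N) (fun B => q *: (wedge (N%:R *: H i + H j) (u N) B
    + c N *: wedge (E i) (u N.-1) B)).
  elim: N => [|N IHN].
    move=> v vb; rewrite cob_term_gen //; congr pair; rewrite tEd //.
    by rewrite scale0r add0r /c mulr0 mul0r oppr0 scale0r addr0.
  move=> v vb; have [Bl Br] := vb.
  rewrite (cob_termL (cob_term_gen (tE i)) IHN) //; congr pair.
  rewrite tu -[km_pi C _]/(km_gen K C (tE i)) tEE tEd; last exact: bil_act_bilin.
  have Bll y := linZ (Bl y); have Blr y a z := linZ (Br y) a z.
  have Hw : lie (E i) (N%:R *: H i + H j) = - (2 * N%:R + (C j i)%:~R) *: E i.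
    rewrite lieDr lieZr [lie (E i) (H i)]lieC [lie (E i) (H j)]lieC !HE Cd CS.
    by module K.
  have uH : lie (u N) (H i) = - (2 * N%:R + (C j i)%:~R) *: u N.
    have N2 : (2 *+ N : int)%:~R = 2 * N%:R :> K by rewrite rmorphMn mulr_natr.
    by rewrite lieC Hu Cd intrD N2 scaleNr.
  have uE : lie (u N) (E i) = - u N.+1 by rewrite lieC.
  move: (v.1) Bl Br => b Bl Br; rewrite /wedge /bil_act Hw uH uE liexx /=.
  have bZl r y z : b (r *: y) z = r *: b y z by exact: linZ (Br z) _ _.
  have bZr r y z : b y (r *: z) = r *: b y z by exact: linZ (Bl y) _ _.
  have bDl y y' z : b (y + y') z = b y z + b y' z by exact: linD (Br z) _ _.
  have bDr y z z' : b y (z + z') = b y z + b y z' by exact: linD (Bl y) _ _.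
  have bNl y z : b (- y) z = - b y z by exact: linN (Br z) _.
  have bNr y z : b y (- z) = - b y z by exact: linN (Bl y) _.
  have -> : c N *: (b 0 (u N.-1) + b (E i) (lie (E i) (u N.-1))
      - (b (lie (E i) (u N.-1)) (E i) + b (u N.-1) 0))
      = c N *: b (E i) (u N) - c N *: b (u N) (E i).
    rewrite (lin0 (Bl _)) (lin0 (Br (u N.-1))) addr0 add0r scalerBr.
    by congr (_ - _); [rewrite -!bZr cu|rewrite -!bZl cu].
  rewrite -/(u N.+1) !(bDl, bDr) !(bZl, bZr) ?(bNl, bNr) /c -!(natr1 N).
  by module K.
have [N CN] : exists N : nat, C j i = - N%:Z.
  by exists `|C j i|%N; have := Cn j i; rewrite eq_sym => /(_ ij); lia.
have -> : `|1 - C j i|%N = N.+1 by rewrite CN; lia.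
move=> v vb; rewrite -/(t N.+1) step //; congr pair; congr (_ *: _).
have -> : c N.+1 = 0 by rewrite /c CN mulrNz -pmulrn -(natr1 N); ring.
by rewrite scale0r addr0.
Qed.

Lemma cob_rel s t : serre_rel C s t ->
  forall v, cob_dom v -> term_act cob_op s v = term_act cob_op t v.
Proof.
have [Cd Cn _] := Cgcm; have [HH HE HF EF] := crel.
have CS k l : C k l = C l k by rewrite -[in LHS]Csym mxE.
move=> st v vb; have [Bl Br] := vb; have pst : km_pi C s = km_pi C t.
  by rewrite /km_pi; have /cong_rel/pres_piP-> := st.
have eqd d d' : cob_term s d -> cob_term t d' -> d v.1 = d' v.1 ->
    term_act cob_op s v = term_act cob_op t v.
  by move=> sd td' dd'; rewrite sd // td' // pst dd'.
have b0l z : v.1 0 z = 0 by exact: lin0 (Br z).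
have b0r z : v.1 z 0 = 0 by exact: lin0 (Bl z).
have bZl r y z : v.1 (r *: y) z = r *: v.1 y z by exact: linZ (Br z) _ _.
have bZr r y z : v.1 y (r *: z) = r *: v.1 y z by exact: linZ (Bl y) _ _.
have bNl y z : v.1 (- y) z = - v.1 y z by exact: linN (Br z) _.
have bNr y z : v.1 y (- z) = - v.1 y z by exact: linN (Bl y) _.
have G := cob_term_gen.
case: st pst eqd => [i j|i j|i j|i|i j ij|i j ij|i j ij] _ eqd.
- by apply: (eqd _ _ (cob_termL (G _) (G _)) cob_term0); rewrite /= subrr.
- apply: (eqd _ _ (cob_termL (G _) (G _)) (cob_termZ _ (G _))).
  rewrite /cob_gen subr0 /wedge /bil_act -[km_pi C _]/(h i) HH HE b0l b0r.
  by rewrite !bZl !bZr add0r addr0 scalerBr.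
- apply: (eqd _ _ (cob_termL (G _) (G _)) (cob_termZ _ (G _))).
  rewrite /cob_gen subr0 /wedge /bil_act -[km_pi C _]/(h i) HH HF b0l b0r.
  by rewrite !bZl !bZr add0r addr0 scalerBr.
- apply: (eqd _ _ (cob_termL (G _) (G _)) (G _)).
  rewrite /cob_gen /wedge /bil_act -[km_pi C (TGen (GenE i))]/(e i).
  rewrite -[km_pi C (TGen (GenF i))]/(f i).
  rewrite [lie (e i) (h i)]lieC [lie (f i) (h i)]lieC [lie (f i) (e i)]lieC.
  rewrite HE HF EF eqxx.
  by rewrite !bNl !bNr !bZl !bZr; module K.
- apply: (eqd _ _ (cob_termL (G _) (G _)) cob_term0).
  rewrite /cob_gen /wedge /bil_act -[km_pi C (TGen (GenE i))]/(e i).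
  rewrite -[km_pi C (TGen (GenF j))]/(f j).
  rewrite [lie (e i) (h j)]lieC [lie (f j) (h i)]lieC [lie (f j) (e i)]lieC.
  rewrite HE HF EF.
  (* The coefficient of [e_i /\ f_j] is [C j i - C i j]; here the symmetry of [C] makes the
     cobracket compatible with [[e_i, f_j] = 0]. *)
  rewrite (negbTE ij) oppr0 !b0l !b0r !bNl !bNr !bZl !bZr (CS i j).
  by module K.
- have gE k B : bilin B -> cob_gen (GenE k) B = 1 *: wedge (h k) (e k) B.
    by rewrite scale1r.
  apply: (eqd _ _ (cob_term_iter crel (fun _ => erefl) gE ij) cob_term0).
  by rewrite km_serre_e // /wedge b0l b0r subrr scaler0.
- have gF k B : bilin B -> cob_gen (GenF k) B = -1 *: wedge (- h k) (f k) B.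
    move=> [B'l B'r]; rewrite /wedge (linN (B'l _)).
    have -> : B (- h k) (f k) = - B (h k) (f k) by exact: linN (B'r _) _.
    by rewrite -opprD scaleN1r opprK.
  apply: (eqd _ _ (cob_term_iter (chevalley_rel_opp crel) (fun _ => erefl) gF ij)
    cob_term0).
  by rewrite km_serre_f // /wedge b0l b0r subrr scaler0.
Qed.

Lemma cobracket_exists : exists cob : g -> (g -> g -> g) -> g,
  [/\ forall x, linear (cob x),
      forall a x y B, bilin B -> cob (a *: x + y) B = a *: cob x B + cob y B,
      forall x y B, bilin B ->
        cob (lie x y) B = cob y (bil_act B x) - cob x (bil_act B y)
    & forall s B, bilin B -> cob (km_gen K C s) B = cob_gen s B].
Proof.
have [rho [rl rA rx rb rt]] := representation_exists (R := serre_rel C)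
  cob_op_linear cob_dom_subspace cob_op_stable cob_rel.
pose cob x B := (rho x (B, 0)).2.
have cobl x : linear (cob x).
  move=> a B B'; rewrite /cob; have := rl x a (B, 0) (B', 0).
  have -> : a *: (B, 0) + (B', 0) = (a *: B + B', 0) :> V.
    by congr pair; rewrite /= scaler0 addr0.
  by move=> ->.
have r0 v : cob_dom v -> rho 0 v = 0.
  by move=> vd; have := rx (-1) 0 0 v vd; rewrite scaler0 addr0 scaleN1r addNr.
have rhoE x v : cob_dom v -> rho x v = (- bil_act v.1 x, cob x v.1).
  move: x v; apply: presented_lie_ind => [|s|x y IHx IHy].
  - split=> [v vd|a x y IHx IHy v vd].
      rewrite /cob !r0 //; congr pair; rewrite (lin0 (bil_act_linearr vd)).
      by rewrite oppr0.
    rewrite (bil_act_linearr vd) opprD -scalerN.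
    by rewrite /cob !rx // IHx // IHy // IHx // IHy.
  - by move=> v vd; rewrite /cob !rt.
  - have E v : cob_dom v -> rho (lie x y) v = (- bil_act v.1 (lie x y),
        cob y (bil_act v.1 x) - cob x (bil_act v.1 y)).
      move=> vd; have bN r := subspaceN (bilin_subspace g) (bil_act_bilin r vd).
      rewrite rb // (IHx _ vd) (IHy _ vd) IHx ?IHy; [|exact: bN|exact: bN].
      congr pair => /=.
        by rewrite bil_act_lie // !(linN (bil_act_linear _)) !opprK opprB addrC.
      by rewrite (linN (cobl x)) (linN (cobl y)) opprK addrC.
    by move=> v vd; rewrite E // /cob E.
exists cob; split=> [//|a x y B Bb|x y B Bb|s B Bb].
- by rewrite /cob rx.
- have bN r := subspaceN (bilin_subspace g) (bil_act_bilin r Bb).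
  rewrite -[LHS]/(rho (lie x y) (B, 0)).2 rb // !(rhoE _ (B, 0)) // !rhoE.
  - by rewrite /= (linN (cobl x)) (linN (cobl y)) opprK addrC.
  - exact: bN.
  - exact: bN.
- by rewrite /cob rt.
Qed.

End Cobracket.

(** * Singular vectors of positive height vanish *)

Section SingularVectors.
Variables (K : fieldType) (charK0 : [pchar K] =i pred0).
Variables (n : nat) (C : 'M[int]_n).
Hypotheses (Cgcm : gen_cartan_matrix C) (Csym : C^T = C).
Local Notation g := (kac_moody K C).
Local Notation e := (km_e K C).
Local Notation f := (km_f K C).
Local Notation h := (km_h K C).
Local Notation deg1 := (@km_deg K n C (fun=> 1)).
Local Notation ht := (wt_pair (fun=> 1)).
Implicit Types (x y z : g) (B : g -> g -> g) (c : 'rV[int]_n).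
Let crel := km_chevalley_rel K C.

Definition cobracket : g -> (g -> g -> g) -> g :=
  sval (cid (cobracket_exists K Cgcm Csym)).
Local Notation cob := cobracket.

Lemma cob_linear x : linear (cob x).
Proof. by rewrite /cob; case: cid => ? []. Qed.

Lemma cob_linearl a x y B : bilin B -> cob (a *: x + y) B = a *: cob x B + cob y B.
Proof. by rewrite /cob; case: cid => ? [] /= _ H _ _; exact: H. Qed.

Lemma cob_lie x y B : bilin B ->
  cob (lie x y) B = cob y (bil_act B x) - cob x (bil_act B y).
Proof. by rewrite /cob; case: cid => ? [] /= _ _ H _; exact: H. Qed.

Lemma cob_genE s B : bilin B -> cob (km_gen K C s) B = @cob_gen K n C s B.
Proof. by rewrite /cob; case: cid => ? [] /= _ _ _; exact. Qed.

Lemma cob0 B : bilin B -> cob 0 B = 0.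
Proof.
move=> Bb; have := cob_linearl (-1) 0 0 Bb.
by rewrite scaler0 addr0 scaleN1r addNr.
Qed.

Lemma bilin_comp (M N : g -> g) B : linear M -> linear N -> bilin B ->
  bilin (fun u v => B (M u) (N v)).
Proof.
move=> Ml Nl [Bl Br]; split=> u a v w; first by rewrite Nl Bl.
by rewrite Ml; exact: (Br (N u)).
Qed.

Lemma bilin_compl (M : g -> g) B : linear M -> bilin B -> bilin (fun u v => M (B u v)).
Proof.
move=> Ml [Bl Br]; split=> u a v w; first by rewrite Bl Ml.
by rewrite -Ml; congr M; exact: (Br u).
Qed.

(** Naturality in the target of the bilinear maps; it lets [cob_bracket] pull the maps [lie z] out
    of the cobracket. *)
Lemma cob_comp (M : g -> g) x B : linear M -> bilin B ->
  cob x (fun u v => M (B u v)) = M (cob x B).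
Proof.
move=> Ml; move: x B; apply: presented_lie_ind => [|s|x y IHx IHy].
- split=> [|a x y IHx IHy] B Bb.
    by rewrite !cob0 ?(lin0 Ml) //; exact: bilin_compl.
  by rewrite !cob_linearl ?IHx ?IHy ?Ml //; exact: bilin_compl.
- move=> B Bb; rewrite !cob_genE //; last exact: bilin_compl.
  by case: s => i /=; rewrite /wedge ?(linB Ml) ?(lin0 Ml).
- move=> B Bb; have MB z : bil_act (fun u v => M (B u v)) z
      = fun u v => M (bil_act B z u v).
    by apply/funext => u; apply/funext => v; rewrite /bil_act (linD Ml).
  rewrite !cob_lie //; last exact: bilin_compl.
  by rewrite !MB IHx ?IHy ?(linB Ml) //; exact: bil_act_bilin.
Qed.

Lemma bilin_lie : bilin (fun u v : g => lie u v).
Proof. by split=> u; [exact: lie_linear|exact: lie_linearl]. Qed.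

(* Composing the cobracket with the bracket gives a derivation, which is
   determined by its values on the generators. *)
Lemma cob_bracket x : cob x (fun u v => lie u v) = 4 *: deg1 x.
Proof.
have bl := bilin_lie; have [_ HE HF EF] := crel; have [Cd _ _] := Cgcm.
move: x; apply: derivation_eq.
- by move=> a x y; rewrite cob_linearl.
- by move=> a x y; rewrite km_deg_linear; module K.
- move=> x y; rewrite cob_lie //.
  have al z : bil_act (fun u v : g => lie u v) z = fun u v => lie z (lie u v).
    by apply/funext => u; apply/funext => v; rewrite /bil_act -lie_lie.
  rewrite !al !(cob_comp (M := lie _)) //; do ?exact: lie_linear.
  by rewrite [lie y _]lieC opprK addrC.
- by move=> x y; rewrite km_deg_lie lieZl lieZr scalerDr.
- move=> s; rewrite cob_genE // km_deg_gen; case: s => i /=; rewrite /wedge.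
  + rewrite [lie (e i) (h i)]lieC HE Cd opprK -[km_gen K C _]/(e i).
    by rewrite -scalerDl scalerA; congr (_ *: _); ring.
  + rewrite [lie (f i) (h i)]lieC HF Cd opprK -[km_gen K C _]/(f i).
    by rewrite -scalerDl scalerA; congr (_ *: _); ring.
  + by rewrite scale0r scaler0.
Qed.

(** The element [h_c] that the form given by the symmetric matrix [C] attaches to [c]; it is the
    coroot when [c] has norm 2. *)
Definition coroot c : g := \sum_i (c 0 i)%:~R *: h i.

Lemma coroot_root i c : coroot (simple_root i + c) = h i + coroot c.
Proof.
rewrite /coroot -[h i]scale1r (bigD1 i) //= [in RHS](bigD1 i) //= addrA.
rewrite !mxE !eqxx intrD scalerDl; congr (_ + _); apply: eq_bigr => j /negbTE ji.
by rewrite !mxE eqxx ji add0r.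
Qed.

Lemma coroot_simple i : coroot (simple_root i) = h i.
Proof.
rewrite -[simple_root i]addr0 coroot_root /coroot big1 ?addr0 // => j _.
by rewrite mxE scale0r.
Qed.

Definition root_pair (c d : 'rV[int]_n) : int := \sum_i c 0 i * (d *m C) 0 i.

Lemma lie_coroot c d x : homog d x ->
  lie (coroot c) x = (root_pair c d)%:~R *: x.
Proof.
move=> dx; rewrite (lin_sum (lie_linearl x)) /root_pair rmorph_sum scaler_suml.
by apply: eq_bigr => i _; rewrite /= lieZl (lie_h_homog _ dx) scalerA intrM.
Qed.

(** The identity holds modulo tensors with both factors of positive weight, and the condition on [B]
    makes these invisible. In the induction step the discarded terms are the multiples of
    [e_i /\ x]. *)
Lemma cob_lmon c x B : lmon e c x -> bilin B ->
  (forall d d' u v, lmon e d u -> lmon e d' v -> ht d + ht d' = ht c -> B u v = 0) ->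
  cob x B = wedge (coroot c) x B.
Proof.
move=> cx; elim: cx B => [i|i {}c {}x cx IH] B Bb B0.
  by rewrite cob_genE // coroot_simple.
have [Bl Br] := Bb; have [_ HE _ _] := crel.
have htS d : ht (simple_root i + d) = 1 + ht d.
  by rewrite wt_pairD wt_pair_root.
rewrite cob_lie // IH; last first.
- move=> d d' u v du dv dd'; rewrite /bil_act.
  rewrite (B0 _ _ _ _ (lmonS i du) dv) ?htS -?dd' ?addrA //.
  by rewrite (B0 _ _ _ _ du (lmonS i dv)) ?addr0 // !htS -dd' addrCA.
- exact: bil_act_bilin.
rewrite -[e i]/(km_gen K C (GenE i)) cob_genE; last exact: bil_act_bilin.
rewrite -[km_gen K C (GenE i)]/(e i) [cob_gen]lock /wedge /bil_act -lock /=.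
rewrite /wedge coroot_root.
have bZl r y z : B (r *: y) z = r *: B y z by exact: linZ (Br z) _ _.
have bZr r y z : B y (r *: z) = r *: B y z by exact: linZ (Bl y) _ _.
have bDl y y' z : B (y + y') z = B y z + B y' z by exact: linD (Br z) _ _.
have bDr y z z' : B y (z + z') = B y z + B y z' by exact: linD (Bl y) _ _.
have bNl y z : B (- y) z = - B y z by exact: linN (Br z) _.
have bNr y z : B y (- z) = - B y z by exact: linN (Bl y) _.
have ei := lmon1 e i.
have ex0 : B (e i) x = 0 by apply: B0 ei cx _; rewrite htS wt_pair_root.
have xe0 : B x (e i) = 0 by apply: B0 cx ei _; rewrite htS wt_pair_root addrC.
rewrite [lie (e i) (coroot c)]lieC (lie_coroot c (homog_e _ _ i)).
rewrite [lie x (h i)]lieC (lie_h_homog i (mono_homog (mono_e cx))).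
rewrite [lie x (e i)]lieC !(bDl, bDr) !(bNl, bNr) !(bZl, bZr) ex0 xe0.
by module K.
Qed.

Lemma cob_pos c x B : span (lmon e c) x -> bilin B ->
  (forall d d' u v, lmon e d u -> lmon e d' v -> ht d + ht d' = ht c -> B u v = 0) ->
  cob x B = wedge (coroot c) x B.
Proof.
move=> cx Bb B0; have [Bl Br] := Bb; elim: cx => [|a y z cy _ IH].
  by rewrite cob0 // /wedge (lin0 (Bl _)) (lin0 (Br _)) subrr.
rewrite cob_linearl // IH (cob_lmon cy Bb B0) /wedge Bl.
have -> : B (a *: y + z) (coroot c) = a *: B y (coroot c) + B z (coroot c).
  exact: (Br (coroot c)).
by module K.
Qed.

Lemma km_degC p q x : km_deg p (km_deg q x) = km_deg q (km_deg p x).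
Proof.
have pl := @km_deg_linear K n C p; have ql := @km_deg_linear K n C q.
move: x; apply: presented_lie_ind => [|s|x y IHx IHy].
- split=> [|a x y IHx IHy]; first by rewrite !(lin0 pl, lin0 ql).
  by rewrite ql pl pl ql IHx IHy.
- rewrite !km_deg_gen (linZ pl) (linZ ql) !km_deg_gen !scalerA.
  by rewrite [_ * _]mulrC.
- rewrite !km_deg_lie !(linD pl) !(linD ql) !km_deg_lie IHx IHy.
  by module K.
Qed.

(** The coordinate degrees are split off one after the other; as they commute, the eigenvalues
    already obtained survive. *)
Lemma homog_component (U : set g) x : subspace U ->
  (forall p y, U y -> U (km_deg p y)) -> U x -> x <> 0 ->
  exists c y, [/\ U y, homog c y & y <> 0].
Proof.
move=> Us Ud Ux x0; pose d i := @km_deg K n C (fun j => (j == i)%:R).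
suff [c [y [Uy y0 yc]]] : exists c y, [/\ U y, y <> 0 &
    forall i, i \in enum 'I_n -> eigen (d i) (c 0 i) y].
  exists c, y; split=> //; apply: homog_coord => i; apply: yc.
  by rewrite mem_enum.
elim: (enum 'I_n) => [|i s [c [y [Uy y0 yc]]]]; first by exists 0, x.
have dl j : linear (d j) by exact: km_deg_linear.
have [r [z [ur ze yE]]] := eigen_decomposition (dl i) (@km_deg_span _ _ _ _) y.
pose A u := U u /\ forall j, j \in s -> eigen (d j) (c 0 j) u.
have As : subspace A.
  split=> [|a u v [Uu ue] [Uv ve]].
    split=> [|j js]; first by case: Us.
    by case: (eigen_subspace (dl j) (c 0 j)).
  split=> [|j js]; first exact: Us.2.
  by apply: (eigen_subspace (dl j) (c 0 j)).2; [exact: ue|exact: ve].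
have [k kr zk] : exists2 k, k \in r & z k <> 0.
  apply: contrapT => nok; apply: y0; rewrite yE big1_seq // => k /andP[_ kr].
  by apply: contrapT => zk; apply: nok; exists k.
have Azk : A (z k).
  apply: (stable_components charK0 (dl i) (r := r)) => //.
  - move=> u [Uu ue]; split=> [|j js]; first exact: Ud.
    by rewrite /eigen (km_degC _ _ u : d j (d i u) = d i (d j u)) ue // (linZ (dl i)).
  - by rewrite -yE.
exists (\row_j if j == i then k else c 0 j), (z k); split=> //; first by case: Azk.
move=> j; rewrite inE mxE; case: eqP => [->//|_] /=; exact: Azk.2.
Qed.

Lemma deg_lie_f p j x :
  km_deg p (lie (f j) x) = lie (f j) (km_deg p x) - (p j)%:~R *: lie (f j) x.
Proof.
rewrite km_deg_lie (homog_f K C j p) wt_pairN wt_pair_root lieZl addrC.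
by rewrite mulrNz scaleNr.
Qed.

Lemma lie_f_eigen j k x : eigen deg1 (k + 1) x -> eigen deg1 k (lie (f j) x).
Proof.
move=> xk; rewrite /eigen deg_lie_f xk lieZr -scalerBl intrD addrK.
by [].
Qed.

Lemma height_proj_exists : exists pr : int -> g -> g, forall l, linear (pr l) /\
  forall k x, eigen deg1 k x -> pr l x = if k == l then x else 0.
Proof.
have /choice[pr prE] : forall l, exists p : g -> g, linear p /\
    forall k x, eigen deg1 k x -> p x = if k == l then x else 0.
  move=> l; have [p pl pE] := eigen_proj charK0 (@km_deg_linear K n C (fun=> 1))
    (@km_deg_span _ _ _ _) l.
  by exists p.
by exists pr.
Qed.

Lemma singular_root_pair c x : homog c x -> x <> 0 -> (forall j, lie (f j) x = 0) ->
  forall j, (c *m C) 0 j <= 0.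
Proof.
move=> cx x0 fx j; have [_ HE _ EF] := crel; have [Cd _ _] := Cgcm.
have ef : lie (e j) (f j) = h j by rewrite EF eqxx.
have he : lie (h j) (e j) = 2 *: e j by rewrite HE Cd.
have [N eN] := km_ad_nil_e Cgcm j x.
have [k ck _] := lowest_weight_nilpotent ef he (fx j) (lie_h_homog j cx) charK0 x0 eN.
have : ((c *m C) 0 j)%:~R = (- k%:Z)%:~R :> K by rewrite ck mulrNz.
by move=> /(intr_inj0 charK0) ->; rewrite oppr_le0.
Qed.

Lemma singular_eq0 (k : nat) y : (0 < k)%N -> eigen deg1 k y ->
  (forall j, lie (f j) y = 0) -> y = 0.
Proof.
elim/ltn_ind: k y => k IHk y k0 yk fy; apply: contrapT => y0.
have dl := @km_deg_linear K n C (fun=> 1).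
pose U z := eigen deg1 k z /\ forall j, lie (f j) z = 0.
have [c [x [[xk fx] cx x0]]] : exists c x, [/\ U x, homog c x & x <> 0].
  apply: (homog_component (x := y)) => //; last first.
    move=> p z [zk fz]; split.
      by rewrite /eigen km_degC zk (linZ (km_deg_linear p)).
    move=> j; have := deg_lie_f p j z.
    by rewrite fz (lin0 (km_deg_linear p)) scaler0 subr0.
  apply: subspaceI; first exact: eigen_subspace.
  split=> [j|a u v fu fv j]; first exact: lie0r.
  by rewrite lieDr lieZr fu fv scaler0 addr0.
have cht : ht c = k.
  have := cx (fun=> 1); rewrite /eigen xk => /eqP; rewrite -subr_eq0 -scalerBl.
  rewrite scaler_eq0 (introF eqP x0) orbF subr_eq0 => /eqP.
  by move=> /(intr_inj0 charK0).
have cge : forall i, 0 <= c 0 i.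
  case: (homog_sign charK0 cx x0) => [c00|[]//|[cle _]].
    by move: cht; rewrite c00 wt_pair0; lia.
  have : ht c <= 0 by apply: sumr_le0 => i _; rewrite mul1r.
  by rewrite cht; lia.
have [i ci] : exists i, 0 < c 0 i.
  case: (homog_sign charK0 cx x0) => [c00|[]//|[cle _]].
    by move: cht; rewrite c00 wt_pair0; lia.
  have : ht c <= 0 by apply: sumr_le0 => i _; rewrite mul1r.
  by rewrite cht; lia.
have xs := homog_pos charK0 cx ci.
have [pr prE] := height_proj_exists.
have prl l := (prE l).1; have {}prE l := (prE l).2.
pose T B := cob x B - wedge (coroot c) x B.
have Tl : linear T.
  by move=> a B B'; rewrite /T cob_linear wedge_linear; module K.
have lmon_ht d u : lmon e d u -> exists2 l : nat, (0 < l)%N & ht d = l.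
  move=> du; have d0 j := lmon_ge0 j du; have [j dj] := lmon_gt0 du.
  have : 0 < ht d.
    rewrite /wt_pair (bigD1 j) //= mul1r ltr_pwDl //.
    by apply: sumr_ge0 => j' _; rewrite mul1r.
  by case: (ht d) => // l l0; exists l.
have lmon_eigen d u : lmon e d u -> eigen deg1 (ht d) u.
  by move=> du; exact: (mono_homog (mono_e du)).
have prf l j z : pr l (lie (f j) z) = lie (f j) (pr (l + 1) z).
  apply: (@span_sub _ _ _ (fun z => pr l (lie (f j) z) = lie (f j) (pr (l + 1) z)))
    (km_deg_span (fun=> 1) z).
    split=> [|a u v uE vE]; first by rewrite (lin0 (prl _)) lie0r (lin0 (prl _)).
    by rewrite lieDr lieZr !prl uE vE lieDr lieZr.
  move=> u [m um].
  have um' : eigen deg1 (m - 1) (lie (f j) u) by apply: lie_f_eigen; rewrite subrK.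
  rewrite (prE _ _ _ um') (prE _ _ _ um) subr_eq; case: eqP => // _.
  by rewrite lie0r.
(* [T] is the part of the cobracket of [x] in the tensor square of the positive
   part. As [x] is singular, so are the first factors of its lowest component;
   they vanish by induction, i.e. the [lie (f j)] have a joint left inverse. *)
have Z m : (m < k)%N -> forall B, bilin B -> T (fun u v => B (pr m u) v) = 0.
  elim: m => [_|m IHm mk] B Bb.
    (* A positive monomial has positive height, so the projection to height 0 kills every first
       factor. *)
    apply/eqP; rewrite subr_eq0; apply/eqP/cob_pos => //.
      by apply: (bilin_comp (N := id)).
    move=> d d' u v du dv _; have [l l0 dl'] := lmon_ht _ _ du.
    rewrite (prE _ _ _ (lmon_eigen _ _ du)) dl'; case: eqP; first by lia.
    by move=> _; exact: (lin0 (Bb.2 v)).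
  have m1 : m.+1 = m%:Z + 1 :> int by lia.
  have [s sl sE] : exists2 s : ('I_n -> g) -> g, linear s
      & forall u, eigen deg1 m.+1 u -> s (fun j => lie (f j) u) = u.
    apply: (left_inverse_on (A := fun u j => lie (f j) u)).
    - by move=> a u v; apply/funext => j; rewrite lieDr lieZr.
    - exact: eigen_subspace.
    - by move=> u um /funeqP fu; apply: (IHk _ mk u isT um) => j; exact: fu.
  pose sj j z : g := s (fun i => if i == j then z else 0).
  have sjl j : linear (sj j).
    move=> a u v; rewrite /sj -sl; congr s; apply/funext => i'.
    by rewrite -[RHS]/(a *: _ + _); case: eqP => // _; rewrite scaler0 addr0.
  have sjE w : s w = \sum_j sj j (w j).
    rewrite /sj -(lin_sum sl); congr s; apply/funext => i'.
    rewrite fct_sumE (bigD1 i') //= eqxx big1 ?addr0 // => j.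
    by rewrite eq_sym => /negbTE->.
  pose A j : g -> g -> g := fun u v => B (sj j (pr m u)) v.
  have Ab j : bilin (A j).
    apply: (bilin_comp (M := sj j \o pr m) (N := id)) => //.
    exact: lin_comp.
  have prm u : eigen deg1 m.+1 (pr m.+1 u).
    apply: (@span_sub _ _ _ (fun u => eigen deg1 m.+1 (pr m.+1 u)))
      (km_deg_span (fun=> 1) u).
      exact: (subspace_preim (prl _) (eigen_subspace dl _)).
    move=> v [l vl]; rewrite (prE _ _ _ vl); case: eqP => [<-//|_].
    by case: (eigen_subspace dl m.+1).
  (* By [sE] the first factor, in height [m.+1], is the sum of the [sj j (lie (f j) u)]. By the
     Leibniz rule, [f_j] on the first factor is [f_j] on the tensor minus [f_j] on the second
     factor. The last term has first factors of height [m], so the induction hypothesis applies to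
     it. *)
  have BE : (fun u v => B (pr m.+1 u) v) =
      \sum_j (bil_act (A j) (f j) - (fun u v => A j u (lie (f j) v))).
    apply/funext => u; apply/funext => v; rewrite !fct_sumE.
    rewrite -[in LHS](sE _ (prm u)) sjE (lin_sum (Bb.2 v)).
    apply: eq_bigr => j _; rewrite m1 -prf.
    rewrite -[RHS]/(A j (lie (f j) u) v + A j u (lie (f j) v) - A j u (lie (f j) v)).
    by rewrite addrK.
  (* [A j] projects its first argument to height [m], whereas [x] has height [k > m] and [f j] has
     height -1. *)
  have Ax j v : A j x v = 0.
    rewrite /A (prE _ _ _ xk); case: eqP => [|_]; first by lia.
    by rewrite (lin0 (sjl j)) (lin0 (Bb.2 v)).
  have Af j v : A j (f j) v = 0.
    rewrite /A (prE _ _ _ (homog_f K C j (fun=> 1))) wt_pairN wt_pair_root.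
    by rewrite (lin0 (sjl j)) (lin0 (Bb.2 v)).
  rewrite BE (lin_sum Tl) big1 // => j _; rewrite (linB Tl).
  have [Al Ar] := Ab j.
  have A0l v : A j 0 v = 0 by exact: (lin0 (Ar v)).
  have A0r u : A j u 0 = 0 by exact: (lin0 (Al u)).
  have -> : T (fun u v => A j u (lie (f j) v)) = 0.
    apply: (IHm _ (fun u v => B (sj j u) (lie (f j) v))); first by lia.
    by apply: bilin_comp => //; exact: lie_linear.
  have hx := lie_h_homog j cx; have cf := lie_coroot c (homog_f K C j).
  have xf : lie x (f j) = 0 by rewrite lieC fx oppr0.
  have Zl r u v : A j (r *: u) v = r *: A j u v by exact: linZ (Ar v) _ _.
  have Zr r u v : A j u (r *: v) = r *: A j u v by exact: linZ (Al u) _ _.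
  have Nl u v : A j (- u) v = - A j u v by exact: linN (Ar v) _.
  have Nr u v : A j u (- v) = - A j u v by exact: linN (Al u) _.
  rewrite subr0 /T.
  (* As [f_j] kills [x], the cocycle identity trades [f_j] acting on the cobracket of [x] for [x]
     acting on the cobracket of [f_j]. All tensors that remain pair [x] with [f_j], and [A j]
     vanishes on them. *)
  have -> : cob x (bil_act (A j) (f j)) = wedge (h j) (f j) (bil_act (A j) x).
    rewrite -[RHS](cob_genE (GenF j) (bil_act_bilin x (Ab j))).
    apply/eqP; rewrite -subr_eq0 -cob_lie // fx.
    by rewrite cob0.
  rewrite /wedge /bil_act xf fx [lie x (h j)]lieC hx [lie (f j) _]lieC cf.
  by rewrite !(A0l, A0r, Nl, Nr, Zl, Zr, Ax, Af); module K.
have T0 B : bilin B -> T B = 0.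
  move=> Bb.
  (* When two positive heights add up to [k], the first is below [k]. So [B'] vanishes on all pairs
     that [cob_pos] has to ignore, while by [Z] the subtracted parts contribute nothing. *)
  pose B' : g -> g -> g := B - \sum_(m < k) (fun u v => B (pr m u) v).
  have B'b : bilin B'.
    apply: subspaceB; [exact: bilin_subspace|exact: Bb|].
    apply: subspace_sum; first exact: bilin_subspace.
    by move=> m _; apply: (bilin_comp (N := id)).
  have : T B' = 0.
    apply/eqP; rewrite subr_eq0; apply/eqP/cob_pos => //.
    move=> d d' u v du dv dd'.
    have [l l0 dl'] := lmon_ht _ _ du; have [l' l'0 dl''] := lmon_ht _ _ dv.
    have lk : (l < k)%N by move: dd'; rewrite dl' dl'' cht; lia.
    rewrite -[B' u v]/(B u v - (\sum_(m < k) (fun u v => B (pr m u) v)) u v).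
    rewrite !fct_sumE (bigD1 (Ordinal lk)) //= big1 ?addr0 => [|m ml].
      by rewrite (prE _ _ _ (lmon_eigen _ _ du)) dl' eqxx subrr.
    rewrite (prE _ _ _ (lmon_eigen _ _ du)) dl'.
    case: eqP => [[lm]|_]; last exact: (lin0 (Bb.2 v)).
    by case/eqP: ml; apply/val_inj.
  rewrite /B' (linB Tl) (lin_sum Tl) big1 ?subr0 // => m _.
  by apply: Z.
have /eqP := T0 _ bilin_lie; rewrite /T cob_bracket /wedge subr_eq0.
rewrite [lie x _]lieC opprK (lie_coroot c cx) xk -scalerDl scalerA.
rewrite -subr_eq0 -scalerBl scaler_eq0 (introF eqP x0) orbF.
have -> : 4 * k%:~R - ((root_pair c c)%:~R + (root_pair c c)%:~R) =
  (4 * k%:Z - (root_pair c c + root_pair c c))%:~R :> K by rewrite intrB intrM !intrD.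
rewrite intr_eq00 // => /eqP.
have : root_pair c c <= 0.
  apply: sumr_le0 => j _; rewrite mulr_ge0_le0 //.
  exact: singular_root_pair cx x0 fx j.
by lia.
Qed.

End SingularVectors.

(** * Ideals that meet the Cartan part trivially *)

Section Ideals.
Variables (K : fieldType) (charK0 : [pchar K] =i pred0).
Variables (n : nat) (C : 'M[int]_n).
Local Notation g := (kac_moody K C).
Local Notation e := (km_e K C).
Local Notation f := (km_f K C).
Local Notation h := (km_h K C).
Local Notation ht := (wt_pair (fun=> 1)).
Implicit Types (x y z : g) (c : 'rV[int]_n).

Lemma chevalley_involution_exists : exists w : g -> g, [/\ lie_morphism w,
  cancel w w, forall i, w (h i) = - h i & forall p x, km_deg p (w x) = - w (km_deg p x)].
Proof.
have [w wm wE] := km_lift (chevalley_rel_opp (km_chevalley_rel K C))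
  (@km_serre_f K n C) (@km_serre_e K n C).
have [wl wb] := wm; exists w; split=> //.
- apply: km_ind => [|i|i|i|x y wx wy]; try by case: (wE i) => we wf wh;
    rewrite ?(we, wf, wh, linN wl) ?opprK.
    split=> [|a x y wx wy]; first by rewrite !(lin0 wl).
    by rewrite !wl wx wy.
  by rewrite !wb wx wy.
- by move=> i; case: (wE i).
- move=> p; have pl := @km_deg_linear K n C p.
  apply: km_ind => [|i|i|i|x y IHx IHy].
  + split=> [|a x y IHx IHy]; first by rewrite !(lin0 wl, lin0 pl) oppr0.
    by rewrite wl !pl wl IHx IHy; module K.
  + have [-> _ _] := wE i; rewrite (homog_f K C i p) (homog_e K C i p) (linZ wl).
    by have [-> _ _] := wE i; rewrite wt_pairN mulrNz scaleNr.
  + have [_ -> _] := wE i; rewrite (homog_f K C i p) (homog_e K C i p) (linZ wl).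
    by have [_ -> _] := wE i; rewrite wt_pairN mulrNz scaleNr opprK.
  + have [_ _ ->] := wE i; rewrite (linN pl) (homog_h K C i p) wt_pair0 !scale0r.
    by rewrite (lin0 wl).
  + by rewrite wb !km_deg_lie (linD wl) !wb IHx IHy lieNl lieNr opprD.
Qed.

Hypotheses (Cgcm : gen_cartan_matrix C) (Csym : C^T = C).

(** Induction on the height: each [lie (f j) x] lies in the ideal at a smaller height and is
    therefore 0, so [x] is singular and [singular_eq0] applies. *)
Lemma ideal_positive_eq0 (r : set g) : subspace r ->
  (forall x y, r y -> r (lie x y)) ->
  (forall x, r x -> span (fun y => exists i, y = h i) x -> x = 0) ->
  forall c x, homog c x -> r x -> (forall i, 0 <= c 0 i) -> x = 0.
Proof.
move=> rs rl r0 c x; have [k] := ubnP `|ht c|%N.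
elim: k c x => // k IHk c x ck cx rx c0.
have htc : 0 <= ht c by apply: sumr_ge0 => i _; rewrite mul1r.
apply: contrapT => x0.
have r00 y : homog 0 y -> r y -> y = 0.
  by move=> /(homog0_span charK0) hy ry; exact: r0.
have htc1 : 0 < ht c.
  rewrite lt_neqAle htc andbT; apply/eqP => /esym/eqP; rewrite psumr_eq0.
    move=> /allP cz; apply: x0; apply: r00 => //; suff <- : c = 0 by [].
    apply/rowP => i; rewrite mxE; apply/eqP.
    by have := cz i (mem_index_enum _); rewrite /= mul1r.
  by move=> i _; rewrite mul1r.
apply: x0; apply: (singular_eq0 charK0 Cgcm Csym (k := `|ht c|%N)).
- by lia.
- have -> : `|ht c|%N = ht c :> int by lia.
  exact: cx.
move=> j; apply: contrapT => fx0.
have fx : homog (- simple_root j + c) (lie (f j) x).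
  by apply: homog_lie => //; exact: homog_f.
have rfx : r (lie (f j) x) by exact: rl.
have htf : ht (- simple_root j + c) = ht c - 1.
  by rewrite wt_pairD wt_pairN wt_pair_root addrC.
case: (homog_sign charK0 fx fx0) => [c00|[cge _]|[cle [i ci]]].
- by apply: fx0; apply: r00 => //; rewrite -c00.
- by apply: fx0; apply: (IHk _ _ _ fx rfx cge); rewrite htf; lia.
- have : ht (- simple_root j + c) < 0.
    rewrite /wt_pair (bigD1 i) //= mul1r ltr_nwDl //.
    by apply: sumr_le0 => l _; rewrite mul1r.
  by rewrite htf; lia.
Qed.

(* The theorem of Gabber and Kac, for symmetric matrices. *)
Lemma ideal_eq0 (r : set g) : subspace r ->
  (forall x y, r y -> r (lie x y)) -> (forall p x, r x -> r (km_deg p x)) ->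
  (forall x, r x -> span (fun y => exists i, y = h i) x -> x = 0) ->
  forall x, r x -> x = 0.
Proof.
move=> rs rl rd r0 x rx; apply: contrapT => x0.
have [c [y [ry cy y0]]] := homog_component charK0 rs rd rx x0.
case: (homog_sign charK0 cy y0) => [c0|[cge _]|[cle _]]; apply: y0.
- by apply: (ideal_positive_eq0 rs rl r0 cy) => // i; rewrite c0 mxE.
- exact: (ideal_positive_eq0 rs rl r0 cy).
(* Negative degrees: pull the ideal back by the Chevalley involution, which makes the degree
   positive. *)
have [w [wm wK wh wd]] := chevalley_involution_exists; have [wl wb] := wm.
rewrite -[y]wK; suff -> : w y = 0 by exact: lin0.
apply: (@ideal_positive_eq0 (fun z => r (w z)) _ _ _ (- c)).
- exact: subspace_preim.
- by move=> z t rt; rewrite wb; exact: rl.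
- move=> z rz hz; rewrite -[z]wK; suff -> : w z = 0 by exact: lin0.
  apply: r0 => //; move: hz; apply: (@span_sub _ _ _ (fun z => span _ (w z))).
    exact: (subspace_preim wl (span_subspace _)).
  move=> _ [i ->]; rewrite wh; apply: subspaceN; first exact: span_subspace.
  by apply: span_gen; exists i.
- by move=> p; rewrite /eigen wd cy wt_pairN mulrNz scaleNr (linZ wl).
- by rewrite wK.
- by move=> i; rewrite mxE oppr_ge0.
Qed.

End Ideals.

(** * Exponentials and reflections *)

Section Exponential.
Variables (K : fieldType) (charK0 : [pchar K] =i pred0) (L : lieAlgType K) (z : L).
Implicit Types x y : L.

Definition div_ad (k : nat) x : L := k`!%:R^-1 *: iter k (lie z) x.

Lemma natr_neq0 (k : nat) : (k.+1%:R : K) != 0.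
Proof. by rewrite (pcharf0P K).1. Qed.

Lemma div_ad_linear k : linear (div_ad k).
Proof. by move=> a x y; rewrite /div_ad iter_lie_linear; module K. Qed.

Lemma div_adS k x : k.+1%:R *: div_ad k.+1 x = lie z (div_ad k x).
Proof.
rewrite /div_ad lieZr scalerA factS natrM invfM mulrA divff ?mul1r //.
exact: natr_neq0.
Qed.

Lemma div_ad_eq0 k x : iter k (lie z) x = 0 -> div_ad k x = 0.
Proof. by move=> xk; rewrite /div_ad xk scaler0. Qed.

Lemma sum_shift (V : zmodType) (N : nat) (G : nat -> V) : G 0%N = 0 -> G N = 0 ->
  \sum_(i < N) G i.+1 = \sum_(i < N) G i.
Proof.
move=> G0 GN; have <- : \sum_(i < N.+1) G i = \sum_(i < N) G i.+1.
  by rewrite big_ord_recl G0 add0r.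
by rewrite big_ord_recr /= GN addr0.
Qed.

(** The Leibniz rule for divided powers. The induction multiplies by [k.+1], split as [i + j], and
    [sum_shift] reindexes over the square: terms at index 0 carry the factor 0, and those at index
    [N] vanish by nilpotency. *)
Lemma div_ad_lie N x y k : iter N (lie z) x = 0 -> iter N (lie z) y = 0 ->
  div_ad k (lie x y) = \sum_(i < N) \sum_(j < N)
    ((i + j)%N == k)%:R *: lie (div_ad i x) (div_ad j y).
Proof.
move=> xN yN; pose G i j := lie (div_ad i x) (div_ad j y).
have GNl j : G N j = 0 by rewrite /G div_ad_eq0 // lie0l.
have GNr i : G i N = 0 by rewrite /G (div_ad_eq0 yN) lie0r.
elim: k => [|k IHk].
  case: N xN yN {GNl GNr} => [/= -> _|N _ _].
    by rewrite lie0l big_ord0; apply: div_ad_eq0.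
  rewrite big_ord_recl big_ord_recl [X in _ + X + _]big1 => [|j _]; last by rewrite scale0r.
  rewrite [X in _ + X]big1 => [|i _]; last by rewrite big1 // => j _; rewrite scale0r.
  by rewrite !addr0 scale1r /div_ad fact0 invr1 !scale1r.
apply: (scalerI (natr_neq0 k)); rewrite div_adS IHk.
pose P i j : L := ((i + j)%N == k.+1)%:R *: (i%:R *: G i j).
pose Q i j : L := ((i + j)%N == k.+1)%:R *: (j%:R *: G i j).
transitivity (\sum_(i < N) \sum_(j < N) P i.+1 j + \sum_(i < N) \sum_(j < N) Q i j.+1).
  rewrite (lin_sum (lie_linear z)) -big_split; apply: eq_bigr => i _ /=.
  rewrite (lin_sum (lie_linear z)) -big_split; apply: eq_bigr => j _ /=.
  rewrite lieZr lie_lie -!div_adS (lieZl i.+1%:R) (lieZr j.+1%:R).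
  by rewrite /P /Q /G addSn addnS eqSS scalerDr.
have -> : \sum_(i < N) \sum_(j < N) P i.+1 j = \sum_(i < N) \sum_(j < N) P i j.
  apply: (sum_shift (G := fun i => \sum_(j < N) P i j)); apply: big1 => j _.
    by rewrite /P scale0r scaler0.
  by rewrite /P GNl !scaler0.
have -> : \sum_(i < N) \sum_(j < N) Q i j.+1 = \sum_(i < N) \sum_(j < N) Q i j.
  apply: eq_bigr => i _; apply: (sum_shift (G := Q i)).
    by rewrite /Q scale0r scaler0.
  by rewrite /Q GNr !scaler0.
rewrite scaler_sumr -big_split; apply: eq_bigr => i _ /=.
rewrite scaler_sumr -big_split; apply: eq_bigr => j _ /=.
rewrite /P /Q /G; case: eqP => [ijk|_]; last by rewrite !scale0r scaler0 addr0.
by rewrite !scale1r -scalerDl -natrD ijk.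
Qed.

Hypothesis zn : forall x, ad_nil z x.

(** The number of terms is a nilpotency index of [x] obtained by choice; [ad_expE] permits any
    other. *)
Definition ad_exp x : L := \sum_(k < sval (cid (zn x))) div_ad k x.

Lemma ad_expE N x : iter N (lie z) x = 0 -> ad_exp x = \sum_(k < N) div_ad k x.
Proof.
have wide M M' : (M <= M')%N -> iter M (lie z) x = 0 ->
    \sum_(k < M') div_ad k x = \sum_(k < M) div_ad k x.
  move=> MM' xM; rewrite -(subnKC MM') big_split_ord /= [X in _ + X]big1 ?addr0 //.
  by move=> k _; apply: div_ad_eq0; apply: iter_lie_ge xM; rewrite leq_addr.
move=> xN; rewrite /ad_exp; case: cid => M xM /=.
by case: (leqP M N) => MN; [rewrite (wide M N)|rewrite (wide N M) // ltnW].
Qed.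

Lemma ad_exp_morphism : lie_morphism ad_exp.
Proof.
split=> [a x y|x y]; have [N xN] := zn x; have [M yM] := zn y.
  have xT := iter_lie_ge (leq_maxl N M) xN; have yT := iter_lie_ge (leq_maxr N M) yM.
  have xyT : iter (maxn N M) (lie z) (a *: x + y) = 0.
    by rewrite iter_lie_linear xT yT scaler0 addr0.
  rewrite (ad_expE xT) (ad_expE yT) (ad_expE xyT) scaler_sumr -big_split.
  by apply: eq_bigr => k _; rewrite div_ad_linear.
pose T := maxn N M.
have xT : iter T (lie z) x = 0 := iter_lie_ge (leq_maxl N M) xN.
have yT : iter T (lie z) y = 0 := iter_lie_ge (leq_maxr N M) yM.
have [M' xyM] := zn (lie x y).
rewrite (ad_expE (iter_lie_ge (leq_maxr (T + T) M') xyM)) (ad_expE xT) (ad_expE yT).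
rewrite (lin_sum (lie_linearl _)).
under eq_bigr do rewrite (div_ad_lie _ xT yT).
rewrite exchange_big; apply: eq_bigr => i _ /=.
rewrite (lin_sum (lie_linear _)) exchange_big; apply: eq_bigr => j _ /=.
have ij : (i + j < maxn (T + T) M')%N.
  by apply: leq_trans (leq_maxl _ _); rewrite -addSn leq_add // ltnW.
rewrite (bigD1 (Ordinal ij)) //= eqxx scale1r big1 ?addr0 // => k.
by rewrite -val_eqE /= eq_sym => /negbTE->; rewrite scale0r.
Qed.

(** If [N.+1] brackets with [z] kill [x], then [N] brackets applied to the exponential of [x] leave
    only the leading term. So an [x] in the kernel is already killed by [N] brackets, and so on down
    to none. *)
Lemma ad_exp_inj : injective ad_exp.
Proof.
have [expl _] := ad_exp_morphism; move=> x y /eqP; rewrite -subr_eq0 -(linB expl).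
move=> /eqP xy0; apply/subr0_eq; move: (x - y) xy0 => {y} {}x x0.
have [N] := zn x; elim: N => [//|N IHN] xN; apply: IHN.
have := congr1 (iter N (lie z)) x0; rewrite (ad_expE xN) iter_lie0.
rewrite (lin_sum (iter_lie_linear z N)) big_ord_recl big1 => [|k _].
  by rewrite addr0 /div_ad fact0 invr1 scale1r.
rewrite /div_ad (linZ (iter_lie_linear z N)) -iterD (iter_lie_ge _ xN) ?scaler0 //.
by rewrite /= /bump /=; lia.
Qed.

End Exponential.

(** * Simple reflections and real roots *)

Section Reflections.
Variables (K : fieldType) (charK0 : [pchar K] =i pred0).
Variables (n : nat) (C : 'M[int]_n).
Hypotheses (Cgcm : gen_cartan_matrix C) (Csym : C^T = C).
Local Notation g := (kac_moody K C).
Local Notation e := (km_e K C).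
Local Notation f := (km_f K C).
Local Notation h := (km_h K C).
Implicit Types (x y z : g) (c : 'rV[int]_n).

Lemma ad_nil_opp (L : lieAlgType K) (z x : L) : ad_nil z x -> ad_nil (- z) x.
Proof.
move=> [N xN]; exists N.
suff [a ->] : exists a, iter N (lie (- z)) x = a *: iter N (lie z) x.
  by rewrite xN scaler0.
elim: N {xN} => [|N [a IH]]; first by exists 1; rewrite scale1r.
by exists (- a); rewrite !iterS IH lieNl lieZr scaleNr.
Qed.

Lemma reflection_exists i : exists t : g -> g, [/\ lie_morphism t, injective t
  & forall j, t (h j) = h j - (C i j)%:~R *: h i].
Proof.
have [HH HE HF EF] := km_chevalley_rel K C; have [Cd _ _] := Cgcm.
have en x : ad_nil (e i) x by exact: km_ad_nil_e.
have fn x : ad_nil (- f i) x by apply: ad_nil_opp; exact: km_ad_nil_f.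
(* The embedding will be [exp(ad e_i) exp(- ad f_i) exp(ad e_i)], which lifts the simple reflection
   as in SL2. *)
pose te := ad_exp en; pose tf := ad_exp fn.
have tem : lie_morphism te by exact: ad_exp_morphism.
have tfm : lie_morphism tf by exact: ad_exp_morphism.
have two0 : (2 : K) != 0 by exact: natr_neq0.
have eh j : lie (e i) (h j) = - (C i j)%:~R *: e i by rewrite lieC HE scaleNr.
have fh j : lie (f i) (h j) = (C i j)%:~R *: f i by rewrite lieC HF scaleNr opprK.
have fe : lie (f i) (e i) = - h i by rewrite lieC EF eqxx.
have teh j : te (h j) = h j - (C i j)%:~R *: e i.
  rewrite /te (ad_expE en (N := 2)) /= ?eh ?lieZr ?liexx ?scaler0 //.
  by rewrite !big_ord_recl big_ord0 /div_ad /= invr1 !scale1r addr0 eh scaleNr.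
have tee : te (e i) = e i.
  rewrite /te (ad_expE en (N := 1)) /= ?liexx //.
  by rewrite big_ord_recl big_ord0 /div_ad /= invr1 scale1r addr0.
have tfh j : tf (h j) = h j - (C i j)%:~R *: f i.
  rewrite /tf (ad_expE fn (N := 2)) /= ?lieNl ?fh ?lieNr ?lieZr ?liexx ?scaler0 ?oppr0 //.
  by rewrite !big_ord_recl big_ord0 /div_ad /= invr1 !scale1r addr0 lieNl fh.
have tfe : tf (e i) = e i + h i - f i.
  rewrite /tf (ad_expE fn (N := 3)) /=.
    rewrite !big_ord_recl big_ord0 /div_ad /= invr1 !scale1r addr0 !lieNl fe.
    by rewrite !opprK fh Cd scalerN scalerA mulVf // scale1r addrA.
  by rewrite !lieNl fe !opprK fh !lieNr lieZr liexx scaler0 !oppr0.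
exists (te \o tf \o te); split.
- by apply: lie_morph_comp => //; exact: lie_morph_comp.
- by move=> x y /ad_exp_inj-/(_ charK0) /ad_exp_inj-/(_ charK0) /ad_exp_inj-/(_ charK0).
move=> j; have [tel _] := tem; have [tfl _] := tfm.
rewrite /= teh (linB tfl) (linZ tfl) tfh tfe.
have -> : h j - (C i j)%:~R *: f i - (C i j)%:~R *: (e i + h i - f i)
    = h j - (C i j)%:~R *: e i - (C i j)%:~R *: h i by module K.
rewrite !(linB tel) !(linZ tel) tee !teh Cd.
by module K.
Qed.

Definition refl i c : 'rV[int]_n := c - (c *m C) 0 i *: simple_root i.

Lemma simple_root_mulmx i j : (simple_root i *m C) 0 j = C i j.
Proof. by rewrite -rowE mxE. Qed.

Lemma refl_mulmx i j c : (refl i c *m C) 0 j = (c *m C) 0 j - (c *m C) 0 i * C i j.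
Proof.
rewrite /refl mulmxBl -scalemxAl -(simple_root_mulmx i j).
by move: (c *m C) (simple_root i *m C) => X Y; rewrite !mxE.
Qed.

Lemma refl_refl i c : refl i (refl i c) = c.
Proof.
have [Cd _ _] := Cgcm; rewrite {1}/refl refl_mulmx Cd /refl -addrA -opprD -scalerDl.
have -> : (c *m C) 0 i + ((c *m C) 0 i - (c *m C) 0 i * 2) = 0 by ring.
by rewrite scale0r subr0.
Qed.

Lemma reflN i c : refl i (- c) = - refl i c.
Proof. by rewrite /refl mulNmx mxE scaleNr opprD. Qed.

Lemma reflection_coroot i c (t : g -> g) : lie_morphism t ->
  (forall j, t (h j) = h j - (C i j)%:~R *: h i) ->
  t (coroot K C c) = coroot K C (refl i c).
Proof.
move=> [tl _] th; rewrite /coroot (lin_sum tl).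
under eq_bigr do rewrite (linZ tl) th scalerBr scalerA -intrM.
rewrite sumrB -scaler_suml -rmorph_sum /=.
have -> : \sum_j c 0 j * C i j = (c *m C) 0 i.
  by rewrite mxE; apply: eq_bigr => j _; rewrite -[in LHS]Csym mxE.
rewrite /refl; move: ((c *m C) 0 i) => a.
under [RHS]eq_bigr do rewrite !mxE intrB scalerBl.
rewrite sumrB; congr (_ - _); rewrite (bigD1 i) //= !eqxx mulr1 big1 ?addr0 // => j.
by move=> /negbTE ji; rewrite ?eqxx ji mulr0 scale0r.
Qed.

Lemma reflection_root_space i c (t : g -> g) x : lie_morphism t ->
  (forall j, t (h j) = h j - (C i j)%:~R *: h i) ->
  root_space C c x -> root_space C (refl i c) (t x).
Proof.
move=> [tl tb] th cx j; have [Cd _ _] := Cgcm.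
have -> : h j = t (h j - (C i j)%:~R *: h i).
  by rewrite (linB tl) (linZ tl) !th Cd; module K.
rewrite -tb lieDl lieNl lieZl !cx refl_mulmx -(linZ tl); congr t.
by rewrite intrB intrM; module K.
Qed.

(* The embedding [t] plays the part of a Weyl group element that carries [c] to
   a simple root. *)
Definition real_root c :=
  (exists2 x : g, root_space C c x & x <> 0) /\
  exists (t : g -> g) i, [/\ lie_morphism t, injective t, t (coroot K C c) = h i
    & forall x, (root_space C c x -> root_space C (simple_root i) (t x)) /\
        (root_space C (- c) x -> root_space C (- simple_root i) (t x))].

Lemma real_root_simple i : real_root (simple_root i).
Proof.
have [HH HE HF EF] := km_chevalley_rel K C; split.
  exists (e i); last exact: km_e_neq0.
  by move=> j; rewrite HE simple_root_mulmx.
exists id, i; split=> //.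
exact: coroot_simple.
Qed.

Lemma real_root_refl i c : real_root (refl i c) -> real_root c.
Proof.
have [t [tm ti th]] := reflection_exists i; have [tl _] := tm.
move=> [[x cx x0] [t' [j [t'm t'i t'h t'r]]]]; split.
  exists (t x); first by rewrite -(refl_refl i c); exact: reflection_root_space.
  by move=> tx; apply: x0; apply: ti; rewrite tx (lin0 tl).
exists (t' \o t), j; split; first exact: lie_morph_comp.
- exact: inj_comp.
- by rewrite /= (reflection_coroot _ tm th).
- move=> y; split=> cy; first exact/(t'r _).1/reflection_root_space.
  by apply: (t'r _).2; rewrite -reflN; exact: reflection_root_space.
Qed.

Lemma real_root_sl2 (A : 'M[int]_n) d c (E F : g) :
  C *m A = d%:M -> d != 0 -> real_root c ->
  root_space C c E -> E <> 0 -> root_space C (- c) F -> F <> 0 ->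
  [/\ exists2 a, a != 0 & lie E F = a *: coroot K C c,
      forall x, ad_nil E x & forall x, ad_nil F x].
Proof.
move=> CA d0 [_ [t [i [[tl tb] ti th tr]]]] cE E0 cF F0.
have t0 y : y <> 0 -> t y <> 0.
  by move=> y0 ty; apply: y0; apply: ti; rewrite ty (lin0 tl).
have rh := root_space_homog charK0 CA d0.
have [a Ea] := homog_simple_root charK0 ((rh _ _).1 ((tr E).1 cE)).
have [b Fb] := homog_simple_rootN charK0 ((rh _ _).1 ((tr F).2 cF)).
have a0 : a != 0 by apply/eqP => a0; apply: (t0 E E0); rewrite Ea a0 scale0r.
have b0 : b != 0 by apply/eqP => b0; apply: (t0 F F0); rewrite Fb b0 scale0r.
have [_ _ _ EF] := km_chevalley_rel K C.
have nil (z y : g) r : t z = r *: y -> (forall x, ad_nil y x) -> forall x, ad_nil z x.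
  move=> zy yn x; have [N xN] := yn (t x); exists N; apply: ti; rewrite (lin0 tl).
  suff [q ->] : exists q, t (iter N (lie z) x) = q *: iter N (lie y) (t x).
    by rewrite xN scaler0.
  elim: N {xN} => [|N [q IH]]; first by exists 1; rewrite scale1r.
  by exists (r * q); rewrite !iterS tb IH zy lieZl lieZr scalerA.
split.
- exists (a * b); first exact: mulf_neq0.
  apply: ti; rewrite tb Ea Fb lieZl lieZr EF eqxx (linZ tl) th scalerA.
  by [].
- by apply: (nil _ _ _ Ea) => x; exact: km_ad_nil_e.
- by apply: (nil _ _ _ Fb) => x; exact: km_ad_nil_f.
Qed.

End Reflections.

(** * Subalgebras generated by real roots *)

Section RootSubalgebra.
Variables (K : fieldType) (charK0 : [pchar K] =i pred0).
Variables (n : nat) (C A : 'M[int]_n) (d : int).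
Hypotheses (Cgcm : gen_cartan_matrix C) (Csym : C^T = C).
Hypotheses (CA : C *m A = d%:M) (d0 : d != 0).
Variables (N : nat) (b : 'I_N -> 'rV[int]_n) (D : 'M[int]_N).
Hypotheses (Dgcm : gen_cartan_matrix D) (Dsym : D^T = D).
Hypothesis (bD : forall i j, root_pair C (b i) (b j) = D i j).
Hypothesis b_real : forall i, real_root K C (b i).
Hypothesis b_mixed : forall i j, i != j ->
  exists k l, 0 < (b i - b j) 0 k /\ (b i - b j) 0 l < 0.
(** Independence of the [b i] over the rationals, in the form that will be used: each degree on the
    rank [N] side comes, up to the factor [q], from one of the ambient algebra. *)
Hypothesis b_indep : forall p' : 'I_N -> int, exists p q, q != 0 /\
  forall i, wt_pair p (b i) = q * p' i.
Local Notation g := (kac_moody K C).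
Local Notation h := (km_h K C).
Implicit Types (x y z : g).

(** Bracketing with the nonzero [e_j] gives a linear system for [a] with matrix [C], and [CA] makes
    this matrix invertible over [K]. *)
Lemma km_h_indep (a : 'I_n -> K) : \sum_k a k *: h k = 0 -> forall k, a k = 0.
Proof.
move=> ah l; have dK : d%:~R != 0 :> K by rewrite intr_eq00.
have [_ HE _ _] := km_chevalley_rel K C.
have aC j : \sum_k a k * (C j k)%:~R = 0.
  have := congr1 (lie^~ (km_e K C j)) ah; rewrite /= lie0l (lin_sum (lie_linearl _)) /=.
  under eq_bigr do rewrite lieZl HE scalerA.
  rewrite -scaler_suml => /eqP; rewrite scaler_eq0 => /orP[/eqP//|/eqP e0].
  by case: (km_e_neq0 Cgcm e0).
apply: (mulIf dK); rewrite mul0r.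
have CAT k : \sum_j A j l * C j k = if k == l then d else 0.
  have /matrixP/(_ k l) := CA; rewrite !mxE => CAkl.
  have -> : \sum_j A j l * C j k = \sum_j C k j * A j l.
    by apply: eq_bigr => j _; rewrite -[in LHS]Csym mxE mulrC.
  by rewrite CAkl; case: eqP => _; rewrite ?mulr1n ?mulr0n.
transitivity (\sum_j (A j l)%:~R * \sum_k a k * (C j k)%:~R).
  under eq_bigr do rewrite mulr_sumr.
  rewrite exchange_big (bigD1 l) //= [X in _ + X]big1 ?addr0.
    have := CAT l; rewrite eqxx => <-; rewrite rmorph_sum mulr_sumr.
    by apply: eq_bigr => j _; rewrite /= intrM mulrCA.
  move=> k /negbTE kl; transitivity (a k * (\sum_j A j l * C j k)%:~R).
    rewrite rmorph_sum mulr_sumr.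
    by apply: eq_bigr => j _; rewrite /= intrM mulrCA.
  by rewrite CAT kl mulr0.
by apply: big1 => j _; rewrite aC mulr0.
Qed.

Lemma homog_coroot c : homog 0 (coroot K C c).
Proof.
have hs := @homog_subspace K n C 0; apply: (subspace_sum hs) => i _.
exact: (subspaceZ _ hs (homog_h K C i)).
Qed.

Lemma coroot_indep (a : 'I_N -> K) :
  \sum_i a i *: coroot K C (b i) = 0 -> forall i, a i = 0.
Proof.
move=> ab i; have [p [q [q0 pq]]] := b_indep (fun j => (j == i)%:R).
have qK : q%:~R != 0 :> K by rewrite intr_eq00.
have ak : forall k, \sum_j a j * (b j 0 k)%:~R = 0.
  apply: km_h_indep; rewrite -[RHS]ab; under eq_bigr do rewrite scaler_suml.
  rewrite exchange_big; apply: eq_bigr => j _ /=; rewrite scaler_sumr.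
  by apply: eq_bigr => k _; rewrite scalerA.
apply: (mulIf qK); rewrite mul0r.
transitivity (\sum_k (p k)%:~R * \sum_j a j * (b j 0 k)%:~R); last first.
  by apply: big1 => k _; rewrite ak mulr0.
under eq_bigr do rewrite mulr_sumr.
rewrite exchange_big; transitivity (\sum_j a j * (wt_pair p (b j))%:~R).
  rewrite (bigD1 i) //= pq eqxx mulr1 big1 ?addr0 // => j /negbTE ji.
  by rewrite pq ji !mulr0.
apply: eq_bigr => j _; rewrite rmorph_sum mulr_sumr.
by apply: eq_bigr => k _; rewrite /= intrM mulrCA.
Qed.

Variables (E F : 'I_N -> g).
Hypothesis E_root : forall i, root_space C (b i) (E i) /\ E i <> 0.
Hypothesis F_root : forall i, root_space C (- b i) (F i) /\ F i <> 0.

Let rh := root_space_homog charK0 CA d0.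

Lemma root_vectors_chevalley : exists c : 'I_N -> K, (forall i, c i != 0) /\
  chevalley_rel D E (fun i => c i *: F i) (fun i => coroot K C (b i)).
Proof.
have sl2 i : exists a, a != 0 /\ lie (E i) (a *: F i) = coroot K C (b i).
  have [[a a0 EF] _ _] := real_root_sl2 charK0 Cgcm CA d0 (b_real i)
    (E_root i).1 (E_root i).2 (F_root i).1 (F_root i).2.
  by exists a^-1; rewrite invr_eq0 lieZr EF scalerA mulVf ?scale1r.
have /choice[c cE] := sl2; exists c; split=> [i|]; first exact: (cE i).1.
have hE i := (rh _ _).1 (E_root i).1; have hF i := (rh _ _).1 (F_root i).1.
have DS i j : D i j = D j i by rewrite -[in LHS]Dsym mxE.
split=> i j.
- rewrite (lie_coroot _ (homog_coroot _)) /root_pair big1 ?scale0r // => k _.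
  by rewrite mul0mx mxE mulr0.
- by rewrite (lie_coroot _ (hE j)) bD DS.
- rewrite lieZr (lie_coroot _ (hF j)); have -> : root_pair C (b i) (- b j) = - D i j.
    rewrite -bD /root_pair -sumrN; apply: eq_bigr => k _.
    by rewrite mulNmx; move: (b j *m C) => X; rewrite mxE mulrN.
  by rewrite DS mulrNz; module K.
- have [<-|ij] := eqVneq i j; first exact: (cE i).2.
  have [k [l [bk bl]]] := b_mixed ij.
  by rewrite lieZr (homog_mixed charK0 (homog_lie (hE i) (hF j)) bk bl) scaler0.
Qed.

(** [X j] is a lowest weight vector for the sl2 of node [i], of weight [D j i]. Once its string is
    finite, [lowest_weight_nilpotent] says that it ends at the Serre exponent. *)
Lemma serre_of_ad_nil (X Y H : 'I_N -> g) i j : chevalley_rel D X Y H -> i != j ->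
  X j <> 0 -> ad_nil (X i) (X j) -> iter `|1 - D j i|%N (lie (X i)) (X j) = 0.
Proof.
move=> [HH HE HF EF] ij Xj [M xM]; have [Dd _ _] := Dgcm.
have ef : lie (X i) (Y i) = H i by rewrite EF eqxx.
have he : lie (H i) (X i) = 2 *: X i by rewrite HE Dd.
have fx : lie (Y i) (X j) = 0 by rewrite lieC EF eq_sym (negbTE ij) oppr0.
have [k Dk xk] := lowest_weight_nilpotent ef he fx (HE i j) charK0 Xj xM.
have /(intr_inj0 charK0) -> : (D j i)%:~R = (- k%:Z)%:~R :> K by rewrite Dk mulrNz.
by have -> : `|1 - - k%:Z|%N = k.+1 by lia.
Qed.

Lemma root_vectors_generate : generates_kac_moody D E F.
Proof.
have [c [c0 crel]] := root_vectors_chevalley.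
have nil i := real_root_sl2 charK0 Cgcm CA d0 (b_real i)
  (E_root i).1 (E_root i).2 (F_root i).1 (F_root i).2.
have cF0 i : c i *: F i <> 0.
  by move=> /eqP; rewrite scaler_eq0 (negbTE (c0 i)) => /eqP; exact: (F_root i).2.
have [|i j ij|phi [phil phib] phiE] := km_lift crel.
- move=> i j ij; apply: (serre_of_ad_nil crel ij); first exact: (E_root j).2.
  by have [_ En _] := nil i.
- apply: (serre_of_ad_nil (chevalley_rel_opp crel) ij) => //.
  have [_ _ Fn] := nil i; have [M FM] := Fn (c j *: F j); exists M.
  suff [a ->] : exists a, iter M (lie (c i *: F i)) (c j *: F j)
      = a *: iter M (lie (F i)) (c j *: F j) by rewrite FM scaler0.
  elim: M {FM} => [|M [a IH]]; first by exists 1; rewrite scale1r.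
  by exists (c i * a); rewrite !iterS IH lieZl lieZr scalerA.
have hE i := (rh _ _).1 (E_root i).1; have hF i := (rh _ _).1 (F_root i).1.
(* [phi] intertwines the degree derivations up to the factor [q]; this makes its kernel stable under
   each of them, as [ideal_eq0] requires. *)
have phideg p p' q (x : kac_moody K D) : (forall i, wt_pair p (b i) = q * p' i) ->
    phi (q%:~R *: km_deg p' x) = km_deg p (phi x).
  move=> pq; have pl := @km_deg_linear K n C p.
  have p'l := @km_deg_linear K N D p'.
  move: x; apply: km_ind => [|i|i|i|x y IHx IHy].
  + split=> [|a x y IHx IHy]; first by rewrite (lin0 p'l) scaler0 !(lin0 phil) (lin0 pl).
    by rewrite phil pl -IHx -IHy p'l -phil; congr phi; module K.
  + have [-> _ _] := phiE i; rewrite (hE i p) pq (homog_e K D i p') wt_pair_root.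
    by rewrite !(linZ phil); have [-> _ _] := phiE i; rewrite scalerA intrM.
  + have [_ -> _] := phiE i; rewrite (linZ pl) (hF i p) wt_pairN pq.
    rewrite (homog_f K D i p') wt_pairN wt_pair_root.
    rewrite !(linZ phil); have [_ -> _] := phiE i; rewrite !mulrNz intrM.
    by module K.
  + have [_ _ ->] := phiE i; rewrite (homog_coroot (b i) p) wt_pair0.
    by rewrite (homog_h K D i p') wt_pair0 !scale0r scaler0 (lin0 phil).
  + rewrite phib !km_deg_lie -IHx -IHy -!phib -(linD phil) scalerDr lieZl lieZr.
    by [].
have phi0 (x : kac_moody K D) : phi x = 0 -> x = 0.
  move: x; apply: (ideal_eq0 charK0 Dgcm Dsym).
  - exact: subspace_ker.
  - by move=> x y y0; rewrite phib y0 lie0r.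
  - move=> p' x x0; have [p [q [q0 pq]]] := b_indep p'.
    have qK : q%:~R != 0 :> K by rewrite intr_eq00.
    apply: (scalerI qK); rewrite scaler0 -(linZ phil) (phideg p) // x0.
    exact: lin0 (@km_deg_linear K n C p).
  - move=> x x0 hx; have [a xa] : exists a : 'I_N -> K, x = \sum_i a i *: km_h K D i.
      elim: hx => [|r y z [i ->] _ [a ->]].
        by exists (fun=> 0); rewrite big1 // => i _; rewrite scale0r.
      exists (fun j => (if j == i then r else 0) + a j).
      under [RHS]eq_bigr do rewrite scalerDl.
      rewrite big_split /=; congr (_ + _); rewrite (bigD1 i) //= eqxx big1 ?addr0 //.
      by move=> j /negbTE->; rewrite scale0r.
    rewrite xa big1 // => i _; rewrite (coroot_indep (a := a)) ?scale0r //.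
    rewrite -[RHS]x0 xa (lin_sum phil); apply: eq_bigr => j _.
    by rewrite (linZ phil); have [_ _ ->] := phiE j.
split=> //; exists c; split=> //; exists phi; split=> //.
- move=> x y /eqP; rewrite -subr_eq0 -(linB phil) => /eqP/phi0.
  exact: subr0_eq.
- have cinv i : F i = (c i)^-1 *: (c i *: F i) by rewrite scalerA mulVf ?scale1r.
  have [HH HE HF EF] := crel.
  have EFc i : lie (E i) (F i) = (c i)^-1 *: coroot K C (b i).
    by rewrite cinv lieZr EF eqxx.
  apply/seteqP; split=> [_ [x _ <-]|x].
    move=> B [[B0 Bs Bb] GB].
    have Bsub : subspace B by [].
    have BE i : B (E i) by apply: GB; exists i; left.
    have BF i : B (F i) by apply: GB; exists i; right; left.
    have BEF i : B (lie (E i) (F i)) by apply: GB; exists i; right; right.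
    move: x; apply: km_ind => [|i|i|i|x y Bx By].
    + exact: subspace_preim.
    + by have [-> _ _] := phiE i.
    + by have [_ -> _] := phiE i; exact: subspaceZ.
    + have [_ _ ->] := phiE i.
      have -> : coroot K C (b i) = c i *: lie (E i) (F i).
        by rewrite EFc scalerA mulfV ?scale1r.
      exact: subspaceZ.
    + by rewrite phib; exact: Bb.
  move=> /(_ (range phi)); apply; split.
    split.
    + by exists 0 => //; exact: lin0.
    + by move=> a _ _ [y _ <-] [z _ <-]; exists (a *: y + z) => //; exact: phil.
    + by move=> _ _ [y _ <-] [z _ <-]; exists (lie y z) => //; exact: phib.
  move=> _ [i [->|[->|->]]].
  + by exists (km_e K D i) => //; have [-> _ _] := phiE i.
  + exists ((c i)^-1 *: km_f K D i) => //; rewrite (linZ phil) [RHS]cinv.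
    by have [_ -> _] := phiE i.
  + exists ((c i)^-1 *: km_h K D i) => //; rewrite (linZ phil) EFc.
    by have [_ _ ->] := phiE i.
- move=> i; have [-> -> ->] := phiE i; split=> //.
  by have [_ _ _ EF] := crel; rewrite -lieZr EF eqxx.
Qed.

End RootSubalgebra.

(** * The rank 3 algebra and its rank 2 subalgebras *)

Lemma sum_ord3 (V : zmodType) (G : 'I_3 -> V) : \sum_i G i = G 0 + G 1 + G 2.
Proof.
rewrite !big_ord_recl big_ord0 addr0 addrA.
have -> : lift ord0 ord0 = 1 :> 'I_3 by exact/val_inj.
by have -> : lift ord0 (lift ord0 ord0) = 2 :> 'I_3 by exact/val_inj.
Qed.

Lemma ord3_ind (P : 'I_3 -> Prop) : P 0 -> P 1 -> P 2 -> forall i, P i.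
Proof.
move=> P0 P1 P2 [[|[|[|//]]] i3].
- by rewrite (_ : Ordinal i3 = 0) //; exact/val_inj.
- by rewrite (_ : Ordinal i3 = 1) //; exact/val_inj.
- by rewrite (_ : Ordinal i3 = 2) //; exact/val_inj.
Qed.

Lemma ord2_ind (P : 'I_2 -> Prop) : P 0 -> P 1 -> forall i, P i.
Proof.
move=> P0 P1 [[|[|//]] i2].
- by rewrite (_ : Ordinal i2 = 0) //; exact/val_inj.
- by rewrite (_ : Ordinal i2 = 1) //; exact/val_inj.
Qed.

Lemma cartan_F_sym : cartan_F^T = cartan_F.
Proof.
by apply/matrixP => i j; rewrite !mxE; elim/ord3_ind: i; elim/ord3_ind: j.
Qed.

Lemma cartan_F_gcm : gen_cartan_matrix cartan_F.
Proof.
split; first by elim/ord3_ind; rewrite mxE.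
- by move=> i j; elim/ord3_ind: i; elim/ord3_ind: j; rewrite !mxE.
- by move=> i j Cij; rewrite -cartan_F_sym mxE.
Qed.

(** The adjugate of [cartan_F], whose determinant is -2. *)
Definition cartan_F_adj : 'M[int]_3 :=
  int_mx 3 [:: [:: 0; 2; 2]; [:: 2; 4; 4]; [:: 2; 4; 3]].

Lemma cartan_F_adjE : cartan_F *m cartan_F_adj = (-2)%:M.
Proof.
apply/matrixP => i j; rewrite !mxE sum_ord3.
by elim/ord3_ind: i; elim/ord3_ind: j; rewrite !mxE.
Qed.

Lemma mul_cartan_F (c : 'rV[int]_3) :
  [/\ (c *m cartan_F) 0 0 = 2 * c 0 0 - c 0 1,
      (c *m cartan_F) 0 1 = - c 0 0 + 2 * c 0 1 - 2 * c 0 2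
    & (c *m cartan_F) 0 2 = - 2 * c 0 1 + 2 * c 0 2].
Proof. by split; rewrite mxE sum_ord3 !mxE /=; ring. Qed.

Definition aff_root (p q : int) : 'rV[int]_3 := p *: alpha_0 + q *: alpha_1.

Lemma aff_rootE p q :
  [/\ aff_root p q 0 0 = 0, aff_root p q 0 1 = p & aff_root p q 0 2 = q].
Proof. by split; rewrite !mxE /=; ring. Qed.

Lemma refl_aff_root1 p q : refl cartan_F 1 (aff_root p q) = aff_root (2 * q - p) q.
Proof.
rewrite /refl; have [_ -> _] := mul_cartan_F (aff_root p q).
have [-> -> ->] := aff_rootE p q.
by apply/rowP; elim/ord3_ind; rewrite !mxE /=; ring.
Qed.

Lemma refl_aff_root2 p q : refl cartan_F 2 (aff_root p q) = aff_root p (2 * p - q).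
Proof.
rewrite /refl; have [_ _ ->] := mul_cartan_F (aff_root p q).
have [_ -> ->] := aff_rootE p q.
by apply/rowP; elim/ord3_ind; rewrite !mxE /=; ring.
Qed.

Section Main.
Variables (K : fieldType) (charK0 : [pchar K] =i pred0).

(** The two families are proved together, because the reflections in [alpha_0] and [alpha_1]
    exchange them: each lowers the larger coordinate by 2, down to a simple root. *)
Lemma aff_root_real (m : nat) : real_root K cartan_F (aff_root m m.+1) /\
  real_root K cartan_F (aff_root m.+1 m).
Proof.
have simple i : real_root K cartan_F (simple_root i).
  exact: real_root_simple cartan_F_gcm i.
have rrefl := real_root_refl charK0 cartan_F_gcm cartan_F_sym.
elim: m => [|m [IH1 IH2]].
  split; first by rewrite /aff_root scale0r add0r scale1r; exact: simple.
  by rewrite /aff_root scale0r addr0 scale1r; exact: simple.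
split.
- apply: (rrefl 2); rewrite refl_aff_root2.
  by have -> : 2 * m.+1%:Z - m.+2%:Z = m by lia.
- apply: (rrefl 1); rewrite refl_aff_root1.
  by have -> : 2 * m.+1%:Z - m.+2%:Z = m by lia.
Qed.

Variables (m : nat) (hm : (1 <= m)%N) (s : int) (hs : s = 1 \/ s = -1).
Local Notation b := (beta m s).

Lemma beta1E : b 1 = aff_root m (m%:Z + s).
Proof.
by rewrite /beta /= -scaler_nat natz scalerDr /aff_root scalerDl addrA.
Qed.

Lemma beta_real i : real_root K cartan_F (b i).
Proof.
elim/ord2_ind: i; first exact: real_root_simple cartan_F_gcm _.
rewrite beta1E; case: hs => ->.
  have -> : m%:Z + 1 = m.+1 by lia.
  by have [] := aff_root_real m.
case: m hm => // m' _; have -> : m'.+1%:Z - 1 = m' by lia.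
by have [] := aff_root_real m'.
Qed.


Lemma cartan_rank2_sym : (cartan_rank2 m)^T = cartan_rank2 m.
Proof.
by apply/matrixP => i j; rewrite !mxE; elim/ord2_ind: i; elim/ord2_ind: j.
Qed.

Lemma cartan_rank2_gcm : gen_cartan_matrix (cartan_rank2 m).
Proof.
split; first by elim/ord2_ind; rewrite mxE.
- by move=> i j; elim/ord2_ind: i; elim/ord2_ind: j; rewrite !mxE //= oppr_le0.
- by move=> i j Cij; rewrite -cartan_rank2_sym mxE.
Qed.

Lemma beta_coord : [/\ b 0 0 0 = 1, b 0 0 1 = 0 & b 0 0 2 = 0] /\
  [/\ b 1 0 0 = 0, b 1 0 1 = m & b 1 0 2 = m%:Z + s].
Proof.
by rewrite beta1E; have [-> -> ->] := aff_rootE m (m%:Z + s); rewrite /beta /= !mxE.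
Qed.

Lemma beta_pair i j : root_pair cartan_F (b i) (b j) = cartan_rank2 m i j.
Proof.
rewrite /root_pair sum_ord3; have [-> -> ->] := mul_cartan_F (b j).
have [[b00 b01 b02] [b10 b11 b12]] := beta_coord.
have s2 : s * s = 1 by case: hs => ->.
elim/ord2_ind: i; elim/ord2_ind: j; rewrite ?(b00, b01, b02, b10, b11, b12) !mxE /=;
  try by ring.
(* The form of the affine subalgebra takes the value [2 (q - p)^2] at [p alpha_0 + q alpha_1], and
   here [q - p = s]. *)
have -> : 0 * (2 * 0 - m%:Z) + m%:Z * (- 0 + 2 * m%:Z - 2 * (m%:Z + s))
   + (m%:Z + s) * (- 2 * m%:Z + 2 * (m%:Z + s)) = 2 * (s * s) by ring.
by rewrite s2.
Qed.

Lemma beta_mixed i j : i != j -> exists k l, 0 < (b i - b j) 0 k /\ (b i - b j) 0 l < 0.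
Proof.
have [[b00 b01 b02] [b10 b11 b12]] := beta_coord.
have sub (c c' : 'rV[int]_3) k : (c - c') 0 k = c 0 k - c' 0 k by rewrite !mxE.
elim/ord2_ind: i; elim/ord2_ind: j => // _; [exists 0, 1|exists 1, 0];
  by rewrite !sub ?(b00, b01, b10, b11); split; lia.
Qed.

Lemma beta_indep (p' : 'I_2 -> int) :
  exists p q, q != 0 /\ forall i, wt_pair p (b i) = q * p' i.
Proof.
have [[b00 b01 b02] [b10 b11 b12]] := beta_coord.
(* With degree 0 at the last node, the pairing with [b 1] is [m] times the degree at the middle
   node; the factor [q = m] clears this denominator. *)
exists (fun k => if k == 0 then m%:Z * p' 0 else if k == 1 then p' 1 else 0), m%:Z.
split; first by lia.
elim/ord2_ind; rewrite /wt_pair sum_ord3 /= ?(b00, b01, b02, b10, b11, b12); ring.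
Qed.

Lemma beta_generate (E F : 'I_2 -> kac_moody K cartan_F) :
  (forall i, root_space cartan_F (b i) (E i) /\ E i <> 0) ->
  (forall i, root_space cartan_F (- b i) (F i) /\ F i <> 0) ->
  generates_kac_moody (cartan_rank2 m) E F.
Proof.
apply: (root_vectors_generate charK0 cartan_F_gcm cartan_F_sym cartan_F_adjE) => //.
- exact: cartan_rank2_gcm.
- exact: cartan_rank2_sym.
- exact: beta_pair.
- exact: beta_real.
- exact: beta_mixed.
- exact: beta_indep.
Qed.

Lemma beta_positive i : is_positive_root K cartan_F (b i).
Proof.
have [[b00 b01 b02] [b10 b11 b12]] := beta_coord; split; last first.
  elim/ord2_ind: i; elim/ord3_ind; rewrite ?(b00, b01, b02, b10, b11, b12) //.
  by case: hs => ->; lia.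
split; last by have [[x cx x0] _] := beta_real i; exists x.
elim/ord2_ind: i => /rowP b0.
  by have := b0 0; rewrite b00 mxE.
by have := b0 1; rewrite b11 mxE; lia.
Qed.

End Main.

(** * Hyperbolicity of the rank 2 matrix *)

Lemma cartan_rank2_hyperbolic (R : realType) (m : nat) :
  (3 <= m)%N -> hyperbolic_type R (cartan_rank2 m).
Proof.
move=> m3; pose A := cartan_rank2 m; pose AR : 'M[R]_2 := map_mx intr A.
have mR : 3 <= m%:R :> R by rewrite ler_nat.
have ARv (v : 'cV[R]_2) : (AR *m v) 0 0 = 2 * v 0 0 - m%:R * v 1 0 /\
    (AR *m v) 1 0 = - m%:R * v 0 0 + 2 * v 1 0.
  have i1 : lift ord0 ord0 = 1 :> 'I_2 by exact/val_inj.
  by split; rewrite mxE !big_ord_recl big_ord0 !mxE /= i1; ring.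
split.
- exact: cartan_rank2_gcm.
- exists (const_mx 1), AR; split.
  + by move=> i; rewrite mxE oner_neq0.
  + by apply/matrixP => i j; rewrite !mxE; elim/ord2_ind: i; elim/ord2_ind: j.
  + by rewrite diag_const_mx mul1mx.
- have A01 i j : i != j -> (A i j != 0).
    by elim/ord2_ind: i; elim/ord2_ind: j; rewrite // !mxE /= oppr_eq0; lia.
  move=> S [i iS] [j jS]; exists i, j; split=> //; rewrite A01 //.
  by apply: contraNneq jS => <-.
- split.
    (* Both coordinates of the image of [(1, 1)] are [2 - m], negative for [m >= 3]. *)
    exists (const_mx 1); first by move=> i; rewrite mxE ltr01.
    have [a0 a1] := ARv (const_mx 1).
    elim/ord2_ind; rewrite mxE ?a0 ?a1 !mxE; lra.
  move=> v Av v0; have [a0 a1] := ARv v; have := Av 0; have := Av 1.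
  rewrite -/AR a0 a1 => h1 h0; have v00 := v0 0; have v10 := v0 1.
  (* The sum of [h0] and [h1] reads [(2 - m) (v 0 0 + v 1 0) >= 0], so two nonnegative coordinates
     must be 0. *)
  have v00' : v 0 0 = 0 by nra.
  have v10' : v 1 0 = 0 by nra.
  apply/colP; elim/ord2_ind; rewrite mxE //.
(* A proper nonempty set of indices is a singleton here, and its submatrix [(2)] is of finite
   type. *)
move=> S [i iS] [j jS] _; left.
have ord2 (a b c : 'I_2) : a != c -> b != c -> a = b.
  by elim/ord2_ind: a; elim/ord2_ind: b; elim/ord2_ind: c.
have Sne k : k \in S -> k != j by apply: contraTneq => ->.
have SE : S = [set i].
  apply/setP => k; rewrite inE; apply/idP/eqP => [kS|->//].
  by apply: (@ord2 _ _ j); exact: Sne.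
have S1 : #|S| = 1%N by rewrite SE cards1.
have PA k l : principal_submx A S k l = 2.
  have Si (p : 'I_#|S|) : enum_val p = i.
    by apply: (@ord2 _ _ j); apply: Sne => //; exact: enum_valP.
  by rewrite mxE !Si; elim/ord2_ind: (i); rewrite mxE.
move: (principal_submx A S) PA; rewrite S1 => P PE.
have PR : map_mx intr P = 2%:M :> 'M[R]_1.
  by apply/matrixP => k l; rewrite !mxE PE !ord1.
rewrite /finite_type PR; split.
- by rewrite det_scalar1; lra.
- exists (const_mx 1); first by move=> k; rewrite mxE ltr01.
  by move=> k; rewrite mul_scalar_mx !mxE; lra.
- move=> v vge; have : 0 <= v 0 0.
    by have := vge 0; rewrite mul_scalar_mx mxE; lra.
  rewrite le_eqVlt => /orP[/eqP v0|v0]; [right|left].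
    by apply/matrixP => k l; rewrite !ord1 mxE.
  by move=> k; rewrite ord1.
Qed.

Theorem theorem3p2 (R : realType) (K : fieldType) (charK0 : [pchar K] =i pred0)
  (m : nat) (hm : (1 <= m)%N) (s : int) (hs : s = 1 \/ s = -1) :
  [/\ root_mx (beta m s 0) = sym2 1 0 (-1),
      root_mx (beta m s 1) = sym2 (- m%:Z) s 0
    & forall i : 'I_2, is_positive_root K cartan_F (beta m s i)] /\
  (forall E F : 'I_2 -> kac_moody K cartan_F,
     (forall i, root_space cartan_F (beta m s i) (E i) /\ E i <> 0) ->
     (forall i, root_space cartan_F (- beta m s i) (F i) /\ F i <> 0) ->
     generates_kac_moody (cartan_rank2 m) E F) /\
  ((3 <= m)%N -> hyperbolic_type R (cartan_rank2 m)).
Proof.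
have [[b00 b01 b02] [b10 b11 b12]] := beta_coord m s.
split; [split|split].
- by rewrite root_mxE b00 b01 b02 subr0 subrr.
- by rewrite root_mxE b10 b11 b12 sub0r oppr0 addrAC subrr add0r.
- exact: beta_positive.
- exact: beta_generate.
- exact: cartan_rank2_hyperbolic.
Qed.
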